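(* Let $M$ be a finite dimensional $C^2$ complete connected Riemannian manifold and let $G,H:T^*M\to\mathbb{R}$ be two Tonelli Hamiltonians which Poisson commute. If $M$ is compact, then any weak KAM solution for $G$ is a weak KAM solution for $H$.
   Context: A Hamiltonian $H:T^*M\to\mathbb{R}$ is Tonelli if it is $C^2$ and: (1) for every $K>0$ there is $C^*(K)\in\mathbb{R}$ with $H(x,p)\geqslant K\|p\|-C^*(K)$ for all $(x,p)\in T^*M$; (2) for every $R\geqslant 0$, $\sup\{H(x,p):\|p\|\leqslant R\}<+\infty$; (3) for every $(x,p)\in T^*M$ the second fiber derivative $\partial^2H/\partial p^2(x,p)$ is positive definite. $T^*M$ carries the symplectic form $\Omega=-d\lambda$, $\lambda$ the canonical Liouville form; the Hamiltonian vector field $X_H$ is defined by $\Omega(X_H(x,p),\cdot)=d_{(x,p)}H$. $G$ and $H$ Poisson commute if $\Omega(X_G,X_H)$ vanishes everywhere on $T^*M$. The Lagrangian associated with $H$ is $L_H(x,v)=\max_{p\in T_x^*M}\big(p(v)-H(x,p)\big)$ for $(x,v)\in TM$. For a function $u$ on $M$, $x\in M$, $s>0$, $$T_H^{-s}u(x)=\inf_{\gamma}\Big(u(\gamma(0))+\int_0^sL_H(\gamma(\sigma),\dot\gamma(\sigma))\,d\sigma\Big),$$ the infimum being over all absolutely continuous curves $\gamma:[0,s]\to M$ with $\gamma(s)=x$; $T_G^{-s}$ is defined in the same way from $L_G$. A function $u:M\to\mathbb{R}$ is a weak KAM solution for $H$ (resp. $G$) if there is a constant $\alpha\in\mathbb{R}$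 such that for every $t>0$, $u=T_H^{-t}u+t\alpha$ (resp. $u=T_G^{-t}u+t\alpha$). *)

(* Defs.v *)
From mathcomp Require Import all_boot all_order all_algebra.
From mathcomp Require Import all_classical all_reals all_analysis.

Set Implicit Arguments.
Unset Strict Implicit.
Unset Printing Implicit Defensive.

Import Order.TTheory GRing.Theory Num.Theory.
Import numFieldNormedType.Exports.

Local Open Scope classical_set_scope.
Local Open Scope ring_scope.

(* [Ck k D f]: f is of class C^k on the open set D.  It is meant for a
   finite-dimensional V, where continuity of x |-> 'd f x for the operator norm
   is the same as continuity of x |-> 'd f x v for every v. *)
Fixpoint Ck (R : realType) (V W : normedModType R) (k : nat)
    (D : set V) (f : V -> W) : Prop :=
  if k is k'.+1 then
    (forall x, D x -> differentiable f x) /\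
    (forall v : V, Ck k' D (fun x => 'd f x v))
  else forall x, D x -> {for x, continuous f}.

Definition abs_continuous_on (R : realType) (V : normedModType R)
    (a b : R) (f : R -> V) : Prop :=
  forall e : R, 0 < e -> exists2 d : R, 0 < d &
    forall (k : nat) (l r : 'I_k -> R),
      (forall i, [/\ a <= l i, l i <= r i & r i <= b]) ->
      (forall i j, i != j -> r i <= l j \/ r j <= l i) ->
      \sum_(i < k) (r i - l i) < d ->
      \sum_(i < k) `|f (r i) - f (l i)| < e.

(* Only the values of [chart_map] on [chart_dom], and those of [chart_inv] on
   the image of [chart_dom], are meaningful. *)
Record chart (R : realType) (n : nat) (M : topologicalType) := Chart {
  chart_dom : set M ;
  chart_map :> M -> 'rV[R]_n ;
  chart_inv : 'rV[R]_n -> M ;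
  open_chart_dom : open chart_dom ;
  open_chart_cod : open (chart_map @` chart_dom) ;
  chart_map_continuous : {within chart_dom, continuous chart_map} ;
  chart_inv_continuous :
    {within chart_map @` chart_dom, continuous chart_inv} ;
  chart_mapK : forall x, chart_dom x -> chart_inv (chart_map x) = x }.

Definition chart_cod (R : realType) (n : nat) (M : topologicalType)
  (c : chart R n M) : set 'rV[R]_n := c @` chart_dom c.

(* The atlas need not be maximal.  [chart_at x] is a preferred chart around x;
   it serves to identify the tangent space at x with R^n. *)
Record C2_manifold (R : realType) (n : nat) (M : topologicalType) :=
  C2Manifold {
  atlas : set (chart R n M) ;
  chart_at : M -> chart R n M ;
  chart_at_atlas : forall x, atlas (chart_at x) ;
  chart_at_dom : forall x, chart_dom (chart_at x) x ;
  atlas_C2 : forall c c', atlas c -> atlas c' ->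
    Ck 2 (c @` (chart_dom c `&` chart_dom c')) (c' \o chart_inv c) ;
  manifold_hausdorff : hausdorff_space M ;
  manifold_second_countable : @second_countable M }.

Section bundles.
Context (R : realType) (n : nat) (M : topologicalType).

(* (x, v) is the tangent vector at x whose coordinates in [chart_at x] are v. *)
Definition tangent_bundle (X : C2_manifold R n M) : Type :=
  (M * 'rV[R]_n)%type.

(* (x, p) is the covector at x whose coordinates in the basis dual to that of
   [chart_at x] are p. *)
Definition cotangent_bundle (X : C2_manifold R n M) : Type :=
  (M * 'rV[R]_n)%type.

(* p(v), for p and v at the same base point and expressed in the same chart. *)
Definition pairing (p v : 'rV[R]_n) : R := \sum_(i < n) p 0 i * v 0 i.

Variable X : C2_manifold R n M.

(* The bundle charts attached to c, going from coordinates (y, w), (y, q) to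
   the bundles.  A tangent vector is pushed forward by the change of charts;
   the covector of coordinates q in c satisfies
   p(v) = q('d (c \o chart_inv (chart_at x)) (chart_at x x) v),
   and 'd f a v = v *m 'J f a, whence the transposed jacobian. *)
Definition tangent_of_chart (c : chart R n M) (z : 'rV[R]_n * 'rV[R]_n)
    : tangent_bundle X :=
  let x := chart_inv c z.1 in
  (x, 'd (chart_at X x \o chart_inv c) (z.1) (z.2)).

Definition cotangent_of_chart (c : chart R n M) (z : 'rV[R]_n * 'rV[R]_n)
    : cotangent_bundle X :=
  let x := chart_inv c z.1 in
  let c0 := chart_at X x in
  (x, z.2 *m (jacobian (c \o chart_inv c0) (c0 x))^T).

(* The local expression of H in the cotangent chart attached to c. *)
Definition in_chart (H : cotangent_bundle X -> R) (c : chart R n M)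
    (z : 'rV[R]_n * 'rV[R]_n) : R :=
  H (cotangent_of_chart c z).

(* The coordinates in [chart_at (gamma t)] of the velocity of gamma at t. *)
Definition velocity (gamma : R -> M) (t : R) : 'rV[R]_n :=
  derive1 (chart_at X (gamma t) \o gamma) t.

End bundles.

Record riemannian_metric (R : realType) (n : nat) (M : topologicalType)
    (X : C2_manifold R n M) := RiemannianMetric {
  metric :> M -> 'rV[R]_n -> 'rV[R]_n -> R ;
  metric_linear : forall x a u v w,
    metric x (a *: u + v) w = a * metric x u w + metric x v w ;
  metric_sym : forall x v w, metric x v w = metric x w v ;
  metric_pos : forall x v, v != 0 -> 0 < metric x v v ;
  (* C^1 is the regularity that makes sense on a C^2 manifold. *)
  metric_C1 : forall c, atlas X c -> forall v w : 'rV[R]_n,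
    Ck 1 (chart_cod c) (fun y : 'rV[R]_n =>
      metric (chart_inv c y) (tangent_of_chart X c (y, v)).2
                             (tangent_of_chart X c (y, w)).2 : R^o) }.

Section riemannian.
Context (R : realType) (n : nat) (M : topologicalType).
Context (X : C2_manifold R n M) (g : riemannian_metric X).

Definition tangent_norm (z : tangent_bundle X) : R :=
  Num.sqrt (g z.1 z.2 z.2).

Definition cotangent_norm (z : cotangent_bundle X) : R :=
  sup [set pairing z.2 v | v in [set v | tangent_norm (z.1, v) <= 1]].

Definition C1_curve (gamma : R -> M) : Prop :=
  continuous gamma /\
  forall c, atlas X c ->
    Ck 1 (gamma @^-1` chart_dom c : set R^o) (c \o gamma : R^o -> 'rV[R]_n).

Definition curve_length (gamma : R -> M) : \bar R :=
  (\int[lebesgue_measure]_(t in `[0%R, 1%R])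
     (tangent_norm (gamma t, velocity X gamma t))%:E)%E.

Definition riemannian_dist (x y : M) : \bar R :=
  ereal_inf [set curve_length gamma | gamma in
    [set gamma | [/\ C1_curve gamma, gamma 0 = x & gamma 1 = y]]].

Definition riemannian_complete : Prop :=
  forall x : nat -> M,
    (forall e : R, 0 < e -> exists N : nat, forall i j : nat,
       (N <= i)%N -> (N <= j)%N -> (riemannian_dist (x i) (x j) < e%:E)%E) ->
    exists l : M, forall e : R, 0 < e -> exists N : nat, forall i : nat,
      (N <= i)%N -> (riemannian_dist (x i) l < e%:E)%E.

(* T^*M is only a C^1 manifold when M is C^2, so "H is C^2" is understood in the
   cotangent charts attached to the given atlas. *)
Record tonelli (H : cotangent_bundle X -> R) : Prop := Tonelli {
  tonelli_C2 : forall c, atlas X c ->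
    Ck 2 [set z | chart_cod c z.1] (in_chart H c : _ -> R^o) ;
  tonelli_superlinear : forall K : R, 0 < K -> exists C : R,
    forall z : cotangent_bundle X, K * cotangent_norm z - C <= H z ;
  tonelli_bounded : forall r : R, 0 <= r ->
    (ereal_sup [set (H z)%:E | z in [set z | cotangent_norm z <= r]%R]
       < +oo)%E ;
  tonelli_convex : forall (x : M) (p q : 'rV[R]_n), q != 0 ->
    0 < 'D_q ('D_q (fun p' : 'rV[R]_n => H (x, p') : R^o)) p }.

End riemannian.

Section symplectic.
Context (R : realType) (n : nat).

(* The Liouville form in canonical coordinates z = (y, q), the tangent vector
   at z being xi = (dy, dq). *)
Definition liouville_form (z xi : 'rV[R]_n * 'rV[R]_n) : R^o :=
  pairing z.2 xi.1.

(* - d lambda, where d lambda (xi, eta) = xi(lambda(eta)) - eta(lambda(xi)) for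
   constant vector fields xi and eta. *)
Definition symplectic_form (z xi eta : 'rV[R]_n * 'rV[R]_n) : R :=
  - ('d (liouville_form^~ eta) z xi - 'd (liouville_form^~ xi) z eta).

Definition hamiltonian_field (F : 'rV[R]_n * 'rV[R]_n -> R)
    (z : 'rV[R]_n * 'rV[R]_n) : 'rV[R]_n * 'rV[R]_n :=
  xget 0 [set xi | forall eta, symplectic_form z xi eta
                               = 'd (F : _ -> R^o) z eta].

Definition poisson_commute (M : topologicalType) (X : C2_manifold R n M)
    (G H : cotangent_bundle X -> R) : Prop :=
  forall c, atlas X c -> forall z : 'rV[R]_n * 'rV[R]_n, chart_cod c z.1 ->
    symplectic_form z (hamiltonian_field (in_chart G c) z)
                      (hamiltonian_field (in_chart H c) z) = 0.

End symplectic.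

Section weak_kam.
Context (R : realType) (n : nat) (M : topologicalType).
Context (X : C2_manifold R n M).

(* For a Tonelli Hamiltonian the supremum is finite and attained. *)
Definition lagrangian (H : cotangent_bundle X -> R) (z : tangent_bundle X) : R :=
  sup [set pairing p z.2 - H (z.1, p) | p in [set: 'rV[R]_n]].

Definition abs_continuous_curve (s : R) (gamma : R -> M) : Prop :=
  {within `[0, s], continuous gamma} /\
  forall c, atlas X c -> forall a b : R, 0 <= a -> b <= s ->
    `[a, b] `<=` gamma @^-1` chart_dom c ->
    abs_continuous_on a b (c \o gamma).

Definition action (H : cotangent_bundle X -> R) (s : R) (gamma : R -> M)
    : \bar R :=
  (\int[lebesgue_measure]_(t in `[0%R, s])
     (lagrangian H (gamma t, velocity X gamma t))%:E)%E.

(* The backward Lax-Oleinik operator T_H^{-s}. *)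
Definition lax_oleinik (H : cotangent_bundle X -> R) (s : R) (u : M -> R)
    (x : M) : \bar R :=
  ereal_inf [set ((u (gamma 0))%:E + action H s gamma)%E | gamma in
    [set gamma | abs_continuous_curve s gamma /\ gamma s = x]].

Definition weak_kam_solution (H : cotangent_bundle X -> R) (u : M -> R)
    : Prop :=
  exists alpha : R, forall t : R, 0 < t -> forall x : M,
    (u x)%:E = (lax_oleinik H t u x + (t * alpha)%:E)%E.

End weak_kam.

(* Main.v *)
From HB Require Import structures.
From mathcomp Require Import all_boot all_order all_algebra.
From mathcomp Require Import all_classical all_reals all_analysis.
From mathcomp Require Import measurable_realfun.
From mathcomp Require Import ring lra.
Require Import Defs.

Set Implicit Arguments.
Unset Strict Implicit.
Unset Printing Implicit Defensive.

Import Order.TTheory GRing.Theory Num.Theory.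
Import numFieldNormedType.Exports.

Local Open Scope classical_set_scope.
Local Open Scope ring_scope.

(** Let alpha be the constant of u and call fixed the functions v with v = T_G^-t v + t alpha
    for all t > 0. A minimizer for T^-tau from x can be perturbed at both ends at a quadratic cost
    only, and a Hamiltonian that Poisson commutes takes the same value on the initial and on the
    final momentum; all this survives in the limit from a time discretization, so that neither the
    flow nor the regularity of minimizers is needed. Therefore T_H^-tau preserves the fixed
    functions, and H keeps its value along the backward chains calibrated by u for G.
    Put v_i = (T_H^-tau)^i u. Along such a chain the functions u - v_i are monotone and bounded,
    hence somewhere almost stationary; there the gradient q of u at y is almost a subgradient of
    each v_i, and v_i(y) decreases at each step by about tau H(y, q). The oscillation of the v_i
    is bounded uniformly, so the value of H is the same on all chains: H is constant on
    suitable supergradients of u, which makes u a weak KAM solution for H. *)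

(** The preservation of fixed functions rests on two facts. A function is fixed as soon as every
    point has a supergradient on one energy level, with uniform quadratic constants; and every
    subgradient of a fixed function lies on the level [alpha] of [G]. The initial momentum of a
    minimizer for [H] is a subgradient of the initial function, its final momentum a supergradient
    of the final one, and [G] agrees on both. Existence of minimizing curves is never invoked: each
    discrete step minimizes over one point of a compact ball. The obstacle is that this is local to
    a chart, whereas the competitors in the Lax-Oleinik infimum are absolutely continuous curves
    that may leave the chart and have no speed bound. Short times, nested balls of radii [r],
    [6 * r], [7 * r], [8 * r] and a barrier deal with them. The final comparison has two scales.
    After [m] steps of length [tau] the drift is [m * tau] times the value of [H], with an error of
    order [m * tau ^ 2], while oscillations stay bounded: one divides by [m * tau], lets [m] grow,
    then lets [tau] tend to 0. *)

(* Hiding the local hypotheses keeps [lra] fast in large contexts; only the premises of the goal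
   and the hypotheses of the enclosing section are used. *)
Definition hidden (P : Prop) : Prop := P.

Ltac goal_lra := repeat match goal with
  | h : is_true ?b |- _ => change (hidden (is_true b)) in h end; intros; lra.

(** * Absolute continuity and total variation over finite families of intervals *)

Section interval_families.
Context {R : realType}.
Implicit Types (f g : R -> R) (s t : seq (R * R)) (a b x y : R).

Definition nonoverlapping (p q : R * R) := (p.2 <= q.1) || (q.2 <= p.1).

Definition itv_family s :=
  all (fun p => p.1 <= p.2) s && pairwise nonoverlapping s.

Definition family_length s := \sum_(p <- s) (p.2 - p.1).

Definition family_variation f s := \sum_(p <- s) `|f p.2 - f p.1|.

(** Stated for functions on the whole line; a function on [[a, b]] is extended by constants through
    [clamp]. The bound by [e] is not strict, so that it passes to suprema over partitions. *)
Definition abs_continuous_family f := forall e : R, 0 < e ->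
  exists2 d : R, 0 < d & forall s, itv_family s -> family_length s < d ->
    family_variation f s <= e.

Definition clamp a b x := Num.max a (Num.min x b).

Lemma clamp_itv a b x : a <= b -> a <= clamp a b x <= b.
Proof. by move=> ab; rewrite /clamp le_max lexx/= ge_max ab ge_min lexx orbT. Qed.

Lemma clamp_id a b x : a <= x <= b -> clamp a b x = x.
Proof. by move=> /andP[ax xb]; rewrite /clamp (min_l xb) max_r. Qed.

Lemma le_clamp a b x y : x <= y -> clamp a b x <= clamp a b y.
Proof.
by move=> xy; rewrite /clamp /Num.max /Num.min; do !case: ifPn; rewrite -?leNgt; lra.
Qed.

Lemma clamp_lip a b x y : a <= b -> x <= y -> clamp a b y - clamp a b x <= y - x.
Proof.
by move=> ab xy; rewrite /clamp /Num.max /Num.min; do !case: ifPn; rewrite -?leNgt; lra.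
Qed.

Lemma itv_family_map s a b : a <= b -> itv_family s ->
  itv_family [seq (clamp a b p.1, clamp a b p.2) | p <- s].
Proof.
move=> ab /andP[/allP /= s1 s2]; apply/andP; split.
  by apply/allP => _ /mapP[p ps ->] /=; apply/le_clamp/s1.
rewrite pairwise_map; apply: sub_pairwise s2 => p q /= /orP[] h.
  by apply/orP; left; apply: le_clamp.
by apply/orP; right; apply: le_clamp.
Qed.

Lemma family_length_map s a b : a <= b -> itv_family s ->
  family_length [seq (clamp a b p.1, clamp a b p.2) | p <- s] <= family_length s.
Proof.
move=> ab /andP[/allP /= s1 s2]; rewrite /family_length big_map big_seq [leRHS]big_seq.
by apply: ler_sum => p ps /=; apply: clamp_lip => //; apply: s1.
Qed.

Lemma abs_continuous_on_family a b f : a <= b -> @abs_continuous_on R R^o a b f ->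
  abs_continuous_family (f \o clamp a b).
Proof.
move=> ab acf e e0; have [d d0 dP] := acf _ e0; exists d => // s fs ls.
have := itv_family_map ab fs; set t := map _ _ => ft.
have lt : family_length t < d by apply: le_lt_trans ls; exact: family_length_map.
have tin : forall p, p \in t -> (a <= p.1) && (p.2 <= b).
  by move=> _ /mapP[p _ ->] /=; case/andP: (clamp_itv p.1 ab) => -> _;
     case/andP: (clamp_itv p.2 ab).
have -> : family_variation (f \o clamp a b) s = family_variation f t.
  by rewrite /family_variation big_map.
pose l (i : 'I_(size t)) := (nth (0, 0) t i).1.
pose r (i : 'I_(size t)) := (nth (0, 0) t i).2.
have -> : family_variation f t = \sum_(i < size t) `|f (r i) - f (l i)|.
  by rewrite /family_variation (big_nth (0, 0)) big_mkord.
apply: ltW; apply: (dP _ l r).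
- move=> i; have it : nth (0, 0) t i \in t by apply: mem_nth.
  have /andP[? ?] := tin _ it; split => //.
  by case/andP: ft => /allP /(_ _ it).
- move=> i j ij; case/andP: ft => _ /(pairwiseP (0, 0)) pw.
  have [h|h|/val_inj h] := ltngtP i j; last by rewrite h eqxx in ij.
    by have /orP[] := pw i j (ltn_ord i) (ltn_ord j) h; [left|right].
  by have /orP[] := pw j i (ltn_ord j) (ltn_ord i) h; [right|left].
- by move: lt; rewrite /family_length (big_nth (0, 0)) big_mkord.
Qed.

Lemma itv_family1 x y : x <= y -> itv_family [:: (x, y)].
Proof. by move=> xy; rewrite /itv_family /= xy. Qed.

Lemma abs_continuous_family_continuous f : abs_continuous_family f -> continuous (f : R -> R^o).
Proof.
move=> acf x; apply/cvgrPdist_le => e e0; have [d d0 dP] := acf _ e0.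
near=> y; have xyd : `|x - y| < d by near: y; apply: cvgr_dist_lt => //; exact: cvg_id.
have [xy|yx] := leP x y.
  have := dP _ (itv_family1 xy); rewrite /family_length /family_variation !big_seq1/=.
  rewrite distrC; apply.
  by rewrite -[_ - _]ger0_norm ?subr_ge0// distrC.
have := dP _ (itv_family1 (ltW yx)); rewrite /family_length /family_variation !big_seq1/=.
apply.
by rewrite -[_ - _]ger0_norm ?subr_ge0// ltW.
Unshelve. all: by end_near. Qed.

Lemma partition_itv_family a b (s : seq R) : itv_partition a b s ->
  let t := zip (a :: s) s in
  [/\ itv_family t, family_length t = b - a,
      all (fun p => (a <= p.1) && (p.2 <= b)) t &
      forall f, variation a b f s = family_variation f t].
Proof.
move=> abs /=; split; last first.
- move=> f; rewrite (variation_zip _ abs) /family_variation.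
  elim: s a {abs} => [|y s ih] c //=; first by rewrite !big_nil.
  by rewrite !big_cons ih.
- elim: s a abs => [|y s ih] a //= => -[/= /andP[ay ys] /eqP lb].
  have ys' : itv_partition y b s by split => //; apply/eqP.
  rewrite lexx/= (itv_partition_le ys')/=.
  apply: sub_all (ih _ ys') => p /andP[h1 ->]; rewrite andbT.
  by apply: le_trans h1; exact: ltW.
- elim: s a abs => [|y s ih] a //= => -[/=].
    by move=> _ /eqP ->; rewrite /family_length big_nil subrr.
  move=> /andP[ay ys] /eqP lb; have ys' : itv_partition y b s by split => //; apply/eqP.
  by rewrite /family_length big_cons/= [X in _ + X](ih _ ys'); lra.
- elim: s a abs => [|y s ih] a //= => -[/= /andP[ay ys] /eqP lb].
  have ys' : itv_partition y b s by split => //; apply/eqP.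
  have /andP[h1 h2] := ih _ ys'; apply/andP; split => /=; first by rewrite (ltW ay).
  rewrite h2 andbT; apply/allP => -[p q] /=.
  have : all (fun p => (y <= p.1)) (zip (y :: s) s).
    elim: s y {ay ys lb ih h1 h2} ys' => [|z s ih] y //= => -[/= /andP[yz zs] /eqP lb].
    rewrite lexx/=; have zs' : itv_partition z b s by split => //; apply/eqP.
    by apply: sub_all (ih _ zs') => p' /=; apply: le_trans; exact: ltW.
  by move=> /allP h /h /= hh; rewrite /nonoverlapping /= hh.
Qed.

(* Concatenating near-optimal partitions of the intervals of a short family
   yields a short family, so total variation inherits absolute continuity. *)
Lemma total_variation_family f (e d : R) :
  (forall s, itv_family s -> family_length s < d -> family_variation f s <= e) ->
  forall s t, itv_family (t ++ s) -> family_length (t ++ s) < d ->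
    ((family_variation f t)%:E + \sum_(p <- s) total_variation p.1 p.2 f <= e%:E)%E.
Proof.
move=> H; elim=> [|p s ih] t fts lts.
  by rewrite big_nil adde0 lee_fin; apply: H; rewrite -[t]cats0.
rewrite big_cons.
have [fs0 pw] := andP fts.
have ple : p.1 <= p.2.
  by move/allP : fs0 => /(_ p); apply; rewrite mem_cat mem_head orbT.
have key u : itv_partition p.1 p.2 u ->
    ((family_variation f t + variation p.1 p.2 f u)%:E
      + \sum_(q <- s) total_variation q.1 q.2 f <= e%:E)%E.
  move=> pu; have [fz lz az vz] := partition_itv_family pu.
  set z := zip _ _ in fz lz az vz; rewrite vz.
  have -> : family_variation f t + family_variation f z = family_variation f (t ++ z).
    by rewrite /family_variation big_cat.
  apply: ih; last first.
    by move: lts; rewrite /family_length !big_cat/= big_cons/= -lz /family_length; lra.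
  case/andP: fz => az0 pz.
  move: fs0; rewrite /itv_family !all_cat/= => /and3P[-> _ ->]; rewrite az0/=.
  move: pw; rewrite !pairwise_cat allrel_consr allrel_catl.
  rewrite pairwise_cons pz /= => /and3P[/andP[tp ->] -> /andP[ps ->]]; rewrite !andbT/=.
  apply/andP; split; apply/allrelP => q q' qin q'in.
  - have /andP[h1 h2] := allP az _ qin; have /orP[h|h] := allP ps _ q'in.
    + by apply/orP; left; apply: le_trans h.
    + by apply/orP; right; apply: le_trans h1.
  - have /andP[h1 h2] := allP az _ q'in; have /orP[h|h] := allP tp _ qin.
    + by apply/orP; left; apply: le_trans h1.
    + by apply/orP; right; apply: le_trans h.
have Sge0 : (0 <= \sum_(q <- s) total_variation q.1 q.2 f)%E.
  rewrite big_seq; apply: sume_ge0 => q qs; apply: total_variation_ge0.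
  by move/allP : fs0 => /(_ q); apply; rewrite mem_cat inE qs !orbT.
have [u0 pu0] : exists u, itv_partition p.1 p.2 u.
  move: ple; rewrite le_eqVlt => /predU1P[->|h].
    by exists [::]; split.
  by exists [:: p.2]; apply: itv_partition1.
have Sfin : (\sum_(q <- s) total_variation q.1 q.2 f)%E \is a fin_num.
  rewrite ge0_fin_numE//; have := key _ pu0.
  case: (\sum_(q <- s) _)%E Sge0 => [r _ _|_ |//]; first exact: ltry.
  by rewrite addey.
move: Sfin key; case: (\sum_(q <- s) _)%E => // r _ key.
rewrite addeA -leeBrDr// addeC -leeBrDr//.
rewrite /total_variation; apply: ge_ereal_sup => _ [_ [u pu <-] <-].
have := key _ pu.
by rewrite -EFinD -EFinB !lee_fin; lra.
Qed.

(** An interval shorter than the [d] attached to [e = 1] has variation at most 1, and every interval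
    is cut into finitely many pieces of length at most [d / 2]. *)
Lemma total_variation_fin_num f a b : abs_continuous_family f -> a <= b ->
  total_variation a b f \is a fin_num.
Proof.
move=> acf ab; have [d d0 dP] := acf _ ltr01.
have short x y : x <= y -> y - x < d -> total_variation x y f \is a fin_num.
  move=> xy yxd; rewrite ge0_fin_numE ?total_variation_ge0//.
  have := @total_variation_family f 1 d dP [:: (x, y)] [::] (itv_family1 xy).
  rewrite /family_length /family_variation !big_seq1 big_nil add0e => /(_ yxd).
  by move=> h; apply: le_lt_trans h _; exact: ltry.
suff H : forall n x y, x <= y -> y - x <= n%:R * (d / 2) ->
    total_variation x y f \is a fin_num.
  apply: (H (Num.bound ((b - a) / (d / 2)))) => //.
  rewrite -ler_pdivrMr ?divr_gt0//; apply: ltW; apply: archi_boundP.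
  by rewrite divr_ge0 ?subr_ge0// ltW// divr_gt0.
elim=> [|n ih] x y xy.
  by rewrite mul0r => h; apply: short => //; lra.
rewrite -natr1 => h; have [yx|yx] := leP (y - x) (d / 2); first by apply: short => //; lra.
have xz : x <= x + d / 2 by rewrite lerDl ltW// divr_gt0.
have zy : x + d / 2 <= y by lra.
rewrite (total_variationD _ xz zy) fin_numD; apply/andP; split.
  by apply: short => //; lra.
by apply: ih => //; lra.
Qed.

End interval_families.

(** * The fundamental theorem of calculus for monotone absolutely continuous functions *)

Section monotone_FTC.
Context {R : realType}.
Local Notation mu := (@lebesgue_measure R).

Lemma lebesgue_stieltjes_ocitv (g : cumulative R R) (a b : R) : a <= b ->
  lebesgue_stieltjes_measure g `]a, b] = (g b - g a)%:E.
Proof.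
move=> ab; rewrite /lebesgue_stieltjes_measure /measure_extension.
rewrite measurable_mu_extE/=; last exact: is_ocitv.
by rewrite wlength_itv/= lte_fin -EFinB; case: ltgtP ab => // -> _; rewrite subrr.
Qed.

(** The two inclusions serve the two measures: the Lebesgue measure is bounded from below on the
    open interval, the Stieltjes measure from above on the half-open one, where it is an
    increment. *)
Lemma open_is_interval_bounds (I : set R) : open I -> is_interval I -> I !=set0 ->
  (mu I < +oo)%E ->
  exists2 p : R * R, p.1 < p.2 & `]p.1, p.2[ `<=` I /\ I `<=` `]p.1, p.2].
Proof.
move=> oI iI [x0 Ix0]; have /is_intervalP := iI.
case: (Rhull I) => -[b1 l|b1] [b2 r|b2] II lI; last 3 first.
- move: Ix0 lI; rewrite II lebesgue_measure_itv/= in_itv/=.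
  by case: b2 {II} => /=; rewrite ?andbF ?ltry.
- move: Ix0 lI; rewrite II lebesgue_measure_itv/= in_itv/=.
  by case: b1 {II} => //=; rewrite ltNyr.
- move: Ix0 lI; rewrite II lebesgue_measure_itv/= in_itv/=.
  by case: b1 {II}; case: b2 => //; rewrite ?andbF.
have nl : ~ I l.
  move=> Il; have [e /= e0 eI] : \forall y \near l, I y by exact: oI.
  have : I (l - e / 2).
    by apply: eI; rewrite /= opprB addrC subrK gtr0_norm ?divr_gt0// ltr_pdivrMr// ltr_pMr ?ltr1n.
  rewrite II/= in_itv/=; case: b1 {II} => /= /andP[+ _].
    by rewrite lerDl oppr_ge0 leNgt divr_gt0.
  by rewrite ltrDl oppr_gt0 ltNge ltW// divr_gt0.
have lx y : I y -> l < y <= r.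
  move=> Iy; have ly : l != y by apply/eqP => h; apply: nl; rewrite h.
  move: Iy; rewrite II/= in_itv/= => /andP[h1 h2]; apply/andP; split.
    by rewrite lt_neqAle ly/=; case: b1 h1 {II} => //; exact: ltW.
  by case: b2 h2 {II} => //; exact: ltW.
exists (l, r); first by have /andP[h1 h2] := lx _ Ix0; exact: lt_le_trans h1 h2.
split; last by move=> y Iy /=; rewrite in_itv/=; exact: lx.
move=> y; rewrite /= in_itv/= => /andP[h1 h2]; rewrite II/= in_itv/=; apply/andP; split.
  by case: b1 {II} => //; exact: ltW.
by case: b2 {II} => //; exact: ltW.
Qed.

(** By outer regularity a null set lies in an open set of measure less than [d]. Finitely many of
    its components form a family of length less than [d], on which the increments of [g] sum to at
    most [e]; the Stieltjes measure of the open set is the limit of these sums. *)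
Lemma lebesgue_stieltjes_dominated (g : cumulative R R) : abs_continuous_family g ->
  content_dominates mu (lebesgue_stieltjes_measure g).
Proof.
move=> acg A mA A0; apply/eqP; rewrite eq_le measure_ge0 andbT.
apply/lee_addgt0Pr => e e0; rewrite add0e.
have [d d0 dP] := acg _ e0.
have Afin : (mu A < +oo)%E by rewrite A0 ltry.
have [U [oU AU UA]] := lebesgue_regularity_outer mA Afin d0.
have Ud : (mu U < d%:E)%E.
  rewrite (le_lt_trans _ UA)//; have := measureU2 mu mA (measurableD
    (measurable_realfun.open_measurable oU) mA).
  by rewrite A0 add0e setDUK.
have [I [Iitv tI UI]] := OpenSetDisjointItvs.open_disjoint_itv oU.
have mI i : measurable (I i : set (measurableTypeR R)).
  by apply: measurable_realfun.open_measurable; case: (Iitv i).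
have mU : measurable (\bigcup_q I q : set (measurableTypeR R)).
  by rewrite -UI; exact: measurable_realfun.open_measurable.
have IU i : I i `<=` U by rewrite UI; exact: bigcup_sup.
have muI i : (mu (I i) < +oo)%E.
  apply: le_lt_trans (ltry d); apply: le_trans (ltW Ud); apply: le_measure; rewrite ?inE;
    [exact: mI|exact: (measurable_realfun.open_measurable oU)|exact: IU].
have /choice[p pP] : forall i, exists p : R * R, I i !=set0 ->
    [/\ p.1 < p.2, `]p.1, p.2[ `<=` I i & I i `<=` `]p.1, p.2]].
  move=> i; have [i0|?] := pselect (I i !=set0); last by exists (0, 0).
  have [oi ii] := Iitv i.
  by have [q q12 [h1 h2]] := open_is_interval_bounds oi ii i0 (muI i); exists q.
apply: (@le_trans _ _ (lebesgue_stieltjes_measure g U)).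
  by apply: le_measure; rewrite ?inE//; exact: (measurable_realfun.open_measurable oU).
rewrite UI (measure_semi_bigcup _ mI tI mU).
apply: lime_le; first exact: is_cvg_nneseries.
near=> n.
(* Empty components have no endpoints and are discarded; [p i] has a default value there. *)
pose J := [seq i <- iota 0 n | `[< I i !=set0 >]].
pose t := [seq p i | i <- J].
have JP i : i \in J -> I i !=set0 by rewrite mem_filter => /andP[/asboolP].
have IJ i : i \in J -> (p i).1 < (p i).2 by move=> /JP/pP[].
have ft : itv_family t.
  apply/andP; split; first by apply/allP => _ /mapP[i iJ ->]; rewrite ltW// IJ.
  rewrite pairwise_map; have uJ : uniq J by rewrite filter_uniq// iota_uniq.
  apply/(pairwiseP 0%N) => i j iJ jJ ij; rewrite /nonoverlapping.
  have ii := mem_nth 0%N iJ; have jj := mem_nth 0%N jJ.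
  set i' := nth _ J i in ii *; set j' := nth _ J j in jj *.
  have ij' : i' != j' by rewrite /i' /j' nth_uniq// ltn_eqF.
  suff : ~~ (((p j').1 < (p i').2) && ((p i').1 < (p j').2)) by rewrite negb_and -!leNgt.
  apply/negP => /andP[h1 h2].
  have [a1 b1 _] := pP _ (JP _ ii); have [a2 b2 _] := pP _ (JP _ jj).
  pose l := Num.max (p i').1 (p j').1; pose r := Num.min (p i').2 (p j').2.
  have lr : l < r by rewrite /l /r gt_max !lt_min a1 a2 h1 h2.
  have : (I i' `&` I j') ((l + r) / 2).
    have hl := midf_lt lr.
    move: hl.1 hl.2; rewrite /l /r gt_max lt_min => /andP[u1 u2] /andP[u3 u4].
    by split; [apply: b1|apply: b2]; rewrite /= in_itv/= ?u1 ?u2 ?u3 ?u4.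
  by move/trivIsetP : tI => /(_ i' j' Logic.I Logic.I ij') ->.
have lt : family_length t < d.
  rewrite -lte_fin; apply: le_lt_trans Ud.
  rewrite UI (measure_semi_bigcup _ mI tI mU).
  apply: le_trans (nneseries_lim_ge n _) => //.
  rewrite /family_length -sumEFin big_map /J big_filter /index_iota subn0.
  rewrite [leRHS](bigID (fun i => `[< I i !=set0 >]))/=.
  apply: le_trans (leeDl _ _); last by apply: sume_ge0.
  apply: lee_sum => i /asboolP /pP[a1 b1 _].
  apply: le_trans (_ : mu `](p i).1, (p i).2[ <= _)%E.
    by rewrite lebesgue_measure_itv/= lte_fin a1 EFinB.
  by apply: le_measure; rewrite ?inE//; exact: measurable_itv.
have := dP _ ft lt; rewrite -lee_fin; apply: le_trans.
rewrite /family_variation -sumEFin big_map /J big_filter /index_iota subn0.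
rewrite (bigID (fun i => `[< I i !=set0 >]))/= [X in (_ + X)%E]big1 ?adde0; last first.
  move=> i /asboolPn /set0P/negP/negPn/eqP ->; exact: measure0.
apply: lee_sum => i /asboolP /pP[a1 _ c1].
apply: le_trans (_ : lebesgue_stieltjes_measure g `](p i).1, (p i).2] <= _)%E.
  by apply: le_measure; rewrite ?inE//; exact: measurable_itv.
by have -> := lebesgue_stieltjes_ocitv g (ltW a1); rewrite lee_fin ler_norm.
Unshelve. all: by end_near. Qed.

(* The density of the Lebesgue-Stieltjes measure of [g] is its derivative. *)
Lemma nondecreasing_abs_continuous_FTC (g : R -> R) (a b : R) :
  {homo g : x y / x <= y} -> abs_continuous_family g -> a < b ->
  exists h : R -> R, [/\ mu.-integrable setT (EFin \o h),
    (\int[mu]_(t in `]a, b]) (h t)%:E = (g b - g a)%:E)%E &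
    {ae mu, forall x, a < x < b -> is_derive x 1 (g : R -> R^o) (h x)}].
Proof.
move=> nd acg ab; have cg := abs_continuous_family_continuous acg.
pose gc : cumulative R R := HB.pack g
   (isCumulative.Build R _ R g nd (right_continuousW cg)).
have mD : measurable (`]a, b] : set (measurableTypeR R)) by exact: measurable_itv.
(* Restricting to []a, b]] yields a finite measure, to which the Radon-Nikodym theorem applies. *)
have nuD : (lebesgue_stieltjes_measure gc `]a, b] < +oo)%E.
  by rewrite lebesgue_stieltjes_ocitv ?ltW// ltry.
pose nu := mfrestr mD nuD.
have dom : nu `<< mu.
  apply/null_content_dominatesP => A mA A0; rewrite /nu /mfrestr /mrestr.
  apply/eqP; rewrite eq_le measure_ge0 andbT.
  rewrite -(lebesgue_stieltjes_dominated (g := gc) acg mA A0).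
  by apply: le_measure; rewrite ?inE//; exact: measurableI.
have [h [h0 hfin hint hE]] := radon_nikodym_sigma_finite dom.
have hfine x : (fine (h x))%:E = h x by rewrite fineK.
have hint' : mu.-integrable setT (EFin \o (fine \o h)).
  by apply: eq_integrable hint => // x _ /=; rewrite hfine.
have FE x : a <= x <= b ->
    (\int[mu]_(t in `]a, x]) (fine (h t))%:E = (g x - g a)%:E)%E.
  move=> /andP[ax xb].
  rewrite (eq_integral h); last by move=> y _; rewrite hfine.
  rewrite -hE; last exact: measurable_itv.
  rewrite (_ : measure_function_mfrestr__canonical__measure_function_FiniteMeasure _ _ _ =
    lebesgue_stieltjes_measure gc (`]a, x] `&` `]a, b]))//.
  rewrite setIidl; last by apply: subset_itvl; rewrite bnd_simp.
  exact: lebesgue_stieltjes_ocitv.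
exists (fine \o h); split => //; first by apply: FE; rewrite lexx ltW.
have locf : locally_integrable [set: R] (fine \o h).
  have := integrable_locally (@measurableT _ R) hint'.
  by rewrite patch_setT.
have intS y : mu.-integrable [set` Interval (BRight a) (BRight y)] (EFin \o (fine \o h)).
  exact: integrableS hint'.
(* Lebesgue differentiation: the indefinite integral of the density has the density as derivative
   almost everywhere, and it equals [g] up to a constant on the interval. *)
have := FTC1 intS locf; apply: filterS; first exact: (ae_filter_ringOfSetsType mu).
move=> x H /andP[ax xb].
have ax' : (BRight a < BRight x)%O by rewrite bnd_simp.
have [dF F'] := H ax'.
have geq : \forall y \near x, g a + (\int[mu]_(t in `]a, y]) (fine \o h) t)%R = g y.
  have xab : x \in `]a, b[ by rewrite in_itv/= ax.
  apply: filterS (near_in_itvoo xab) => y; rewrite in_itv/= => /andP[ay yb].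
  by rewrite /Rintegral FE/= ?ltW// addrC subrK.
apply: near_eq_is_derive geq _.
rewrite -[(fine \o h) x]add0r; apply: is_deriveD.
by rewrite -F' derive1E; exact: derivableP.
Qed.

End monotone_FTC.

(** * The fundamental theorem of calculus for absolutely continuous functions *)

Section abs_continuous_FTC.
Context {R : realType}.
Local Notation mu := (@lebesgue_measure R).

Lemma itv_integral_cc (h : R -> R) (a b : R) : mu.-integrable setT (EFin \o h) ->
  (\int[mu]_(t in `[a, b]) (h t)%:E = \int[mu]_(t in `]a, b]) (h t)%:E)%E.
Proof.
move=> hint; rewrite [RHS]integral_itv_obnd_cbnd//.
have /measurable_int hm := hint.
exact: measurable_funS hm.
Qed.

(** Jordan decomposition: on [[a, b]], [f] is the difference of the nondecreasing functions [V] and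
    [V - f], with [V] the total variation from [a], and both are absolutely continuous. This is what
    makes the action of an absolutely continuous curve comparable with its displacement. *)
Theorem abs_continuous_FTC (a b : R) (f : R -> R) : a < b ->
  @abs_continuous_on R R^o a b f ->
  exists h : R -> R, [/\ mu.-integrable `[a, b] (EFin \o h),
    (\int[mu]_(t in `[a, b]) (h t)%:E = (f b - f a)%:E)%E &
    {ae mu, forall x, a < x < b -> is_derive x 1 (f : R -> R^o) (h x)}].
Proof.
move=> ab /(abs_continuous_on_family (ltW ab)) acF.
set F := f \o clamp a b in acF.
pose V x := fine (total_variation a (clamp a b x) F).
have cab x : a <= clamp a b x <= b by apply: clamp_itv; exact: ltW.
have tvfin x y : x <= y -> total_variation x y F \is a fin_num.
  exact: total_variation_fin_num.
have VB x y : x <= y -> V y - V x = fine (total_variation (clamp a b x) (clamp a b y) F).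
  move=> xy; have cxy := le_clamp a b xy; have /andP[ax xb] := cab x.
  have /andP[ay yb] := cab y.
  rewrite /V (total_variationD F ax cxy) fineD ?tvfin//.
  by rewrite addrC addKr.
have FV x y : x <= y -> `|F y - F x| <= V y - V x.
  move=> xy; have cxy := le_clamp a b xy; rewrite VB//.
  have := total_variation_ge F cxy; rewrite -{1}[total_variation _ _ _]fineK ?tvfin//.
  by rewrite lee_fin /F /= !(clamp_id (clamp_itv _ (ltW ab))).
have ndV : {homo V : x y / x <= y}.
  by move=> x y xy; rewrite -subr_ge0; apply: le_trans (FV _ _ xy).
have ndVF : {homo (fun x => V x - F x) : x y / x <= y}.
  by move=> x y xy; have := FV _ _ xy; rewrite ler_norml; lra.
have acV : abs_continuous_family V.
  move=> e e0; have [d d0 dP] := acF _ e0; exists d => // s fs ls.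
  have ft := itv_family_map (ltW ab) fs.
  have lt := le_lt_trans (family_length_map (ltW ab) fs) ls.
  have := total_variation_family (s := map _ s) (t := [::]) dP ft lt.
  rewrite /family_variation big_nil add0e big_map => h.
  rewrite -lee_fin -sumEFin; apply: le_trans h.
  rewrite big_seq [leRHS]big_seq; apply: lee_sum => p ps /=.
  have p12 : p.1 <= p.2 by case/andP: fs => /allP /(_ _ ps).
  by rewrite VB// ger0_norm ?fine_ge0 ?total_variation_ge0 ?le_clamp// fineK ?tvfin// le_clamp.
have acVF : abs_continuous_family (fun x => V x - F x).
  move=> e e0; have e20 : 0 < e / 2 by rewrite divr_gt0.
  have [d d0 dP] := acF _ e20; have [d' d'0 d'P] := acV _ e20.
  exists (Num.min d d'); first by rewrite lt_min d0.
  move=> s fs; rewrite lt_min => /andP[/(dP _ fs) h1 /(d'P _ fs) h2].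
  rewrite (splitr e); apply: le_trans (lerD h2 h1).
  rewrite /family_variation -big_split/=; apply: ler_sum => p _.
  apply: le_trans (ler_normB _ _); rewrite le_eqVlt; apply/orP; left; apply/eqP; congr `|_|; lra.
have [h1 [i1 e1 d1]] := nondecreasing_abs_continuous_FTC ndV acV ab.
have [h2 [i2 e2 d2]] := nondecreasing_abs_continuous_FTC ndVF acVF ab.
exists (fun x => h1 x - h2 x).
have i12 : mu.-integrable setT (EFin \o (fun x => h1 x - h2 x)).
  by apply: eq_integrable (integrableB _ i1 i2) => //= x _; rewrite EFinB.
split; first exact: integrableS i12.
  rewrite itv_integral_cc//.
  under eq_integral do rewrite EFinB.
  rewrite integralB//; [|exact: integrableS i1|exact: integrableS i2].
  rewrite e1 e2 -EFinB; congr (_%:E).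
  by rewrite /F/= !clamp_id ?lexx ?ltW//; ring.
apply: filterS2 d1 d2; first exact: (ae_filter_ringOfSetsType mu).
move=> x D1 D2 xab.
have : is_derive x 1 ((V : R -> R^o) - (fun x => V x - F x : R^o)) (h1 x - h2 x).
  by apply: is_deriveB; [exact: D1|exact: D2].
apply: near_eq_is_derive.
have xab' : x \in `]a, b[ by rewrite in_itv.
apply: filterS (near_in_itvoo xab') => y; rewrite in_itv/= => /andP[ay yb].
transitivity (V y - (V y - F y)) => //.
by rewrite opprB addrC subrK /F /= clamp_id// !ltW.
Qed.

End abs_continuous_FTC.

(** * Covectors, vectors and closed balls in coordinates *)

Lemma closed_norm_le (R : realType) (V : normedModType R) (a : V) (r : R) :
  closed [set y : V | `|y - a| <= r].
Proof.
rewrite (_ : [set y | _] = (fun y : V => `|y - a|) @^-1` [set x | x <= r])//.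
apply: closed_comp; last exact: closed_le.
by move=> y _; apply: cvg_norm; apply: cvgB; [exact: cvg_id|exact: cvg_cst].
Qed.

Ltac row_ring := by apply/rowP => ?; rewrite !mxE; ring.

Section pairing_theory.
Context {R : realType} {n : nat}.
Implicit Types (p q v w : 'rV[R]_n).

Lemma pairingC p v : pairing p v = pairing v p.
Proof. by apply: eq_bigr => i _; rewrite mulrC. Qed.

Lemma pairingDl p q v : pairing (p + q) v = pairing p v + pairing q v.
Proof. by rewrite -big_split; apply: eq_bigr => i _; rewrite mxE mulrDl. Qed.

Lemma pairingZl a p v : pairing (a *: p) v = a * pairing p v.
Proof. by rewrite mulr_sumr; apply: eq_bigr => i _; rewrite mxE mulrA. Qed.

Lemma pairingNl p v : pairing (- p) v = - pairing p v.
Proof. by rewrite -scaleN1r pairingZl mulN1r. Qed.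

Lemma pairingBl p q v : pairing (p - q) v = pairing p v - pairing q v.
Proof. by rewrite pairingDl pairingNl. Qed.

Lemma pairingDr p v w : pairing p (v + w) = pairing p v + pairing p w.
Proof. by rewrite pairingC pairingDl !(pairingC p). Qed.

Lemma pairingZr a p v : pairing p (a *: v) = a * pairing p v.
Proof. by rewrite pairingC pairingZl pairingC. Qed.

Lemma pairingNr p v : pairing p (- v) = - pairing p v.
Proof. by rewrite pairingC pairingNl pairingC. Qed.

Lemma pairingBr p v w : pairing p (v - w) = pairing p v - pairing p w.
Proof. by rewrite pairingDr pairingNr. Qed.

Lemma pairing0l v : pairing 0 v = 0.
Proof. by rewrite -(scale0r 0) pairingZl mul0r. Qed.

Lemma pairing0r v : pairing v 0 = 0.
Proof. by rewrite pairingC pairing0l. Qed.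

Lemma coord_le_norm v i : `|v 0 i| <= `|v|.
Proof.
have -> : `|v| = mx_norm v by [].
rewrite mx_normrE.
exact: (@le_bigmax_cond _ _ _ 0 (0, i) xpredT (fun ij : 'I_1 * 'I_n => `|v ij.1 ij.2|)).
Qed.

Lemma norm_le_coord v (a : R) : 0 <= a -> (forall i, `|v 0 i| <= a) -> `|v| <= a.
Proof.
move=> a0 H; have -> : `|v| = mx_norm v by [].
rewrite mx_normrE; apply/bigmax_leP; split => //.
by move=> [i j] _ /=; rewrite (ord1 i).
Qed.

Lemma norm_attained v : v != 0 -> exists i, `|v| = `|v 0 i|.
Proof.
move=> v0; have /mx_norm_neq0[[i j] /= h] : mx_norm v != 0.
  by apply: contra v0 => /eqP/mx_norm_eq0 ->.
by exists j; rewrite -[LHS]/(mx_norm v) h (ord1 i).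
Qed.

(** The norm of ['rV[R]_n] is the maximum of the coordinates, for vectors and covectors alike; hence
    the factor [n] here and in later constants. *)
Lemma pairing_le p v : `|pairing p v| <= n%:R * `|p| * `|v|.
Proof.
apply: le_trans (ler_norm_sum _ _ _) _.
apply: (@le_trans _ _ (\sum_(i < n) `|p| * `|v|)).
  by apply: ler_sum => i _; rewrite normrM; apply: ler_pM => //; exact: coord_le_norm.
by rewrite sumr_const card_ord -[X in X <= _]mulr_natl mulrA.
Qed.

Lemma pairing_ler p v : pairing p v <= n%:R * `|p| * `|v|.
Proof. exact: le_trans (ler_norm _) (pairing_le _ _). Qed.

(** For the maximum norm, the sign vector of [v] scaled by [K] pairs with [v] to [K] times the sum
    of the absolute values of its coordinates. *)
Lemma exists_aligned (K : R) v : 0 <= K ->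
  exists2 p, `|p| <= K & K * `|v| <= pairing p v.
Proof.
move=> K0; have [->|v0] := eqVneq v 0.
  by exists 0; rewrite ?normr0// mulr0 pairing0r.
have [i vi] := norm_attained v0.
exists (K *: \row_j Num.sg (v 0 j)).
  apply: norm_le_coord => // j; rewrite !mxE normrM (ger0_norm K0) ler_piMr//.
  by rewrite normr_sg; case: (_ != _).
rewrite pairingZl ler_wpM2l// vi /pairing (bigD1 i)//= mxE -normrEsg lerDl.
by apply: sumr_ge0 => j _; rewrite mxE -normrEsg.
Qed.

Lemma pairing_eq p q : (forall v, pairing p v = pairing q v) -> p = q.
Proof.
move=> H; apply/rowP => i; have := H (delta_mx 0 i).
rewrite /pairing (bigD1 i)//= big1 ?addr0; last first.
  by move=> j ji; rewrite mxE eqxx/= (negbTE ji) mulr0.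
rewrite (bigD1 i)//= [in RHS]big1 ?addr0; last first.
  by move=> j ji; rewrite mxE eqxx/= (negbTE ji) mulr0.
by rewrite mxE !eqxx !mulr1.
Qed.

Definition cball (a : 'rV[R]_n) (r : R) : set 'rV[R]_n := [set y | `|y - a| <= r].

Lemma cball_compact a r : compact (cball a r).
Proof.
apply: bounded_closed_compact.
  exists (r + `|a|); split; first exact: num_real.
  move=> x xr y /= yar; apply: ltW; apply: le_lt_trans xr.
  by rewrite -[y](subrK a); apply: le_trans (ler_normD _ _) _; rewrite lerD2r.
exact: (@closed_norm_le R 'rV[R]_n).
Qed.

Lemma cball_segment a r y y' t : cball a r y -> cball a r y' -> 0 <= t <= 1 ->
  cball a r (y + t *: (y' - y)).
Proof.
rewrite /cball/= => h h' /andP[t0 t1].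
have -> : y + t *: (y' - y) - a = (1 - t) *: (y - a) + t *: (y' - a).
  by apply/rowP => i; rewrite !mxE; ring.
apply: le_trans (ler_normD _ _) _; rewrite !normrZ ger0_norm ?subr_ge0// (ger0_norm t0).
have -> : r = (1 - t) * r + t * r by ring.
by apply: lerD; apply: ler_wpM2l => //; rewrite subr_ge0.
Qed.

End pairing_theory.

(** * Uniform bounds by compactness and finiteness *)

Section compactness.
Context {R : realType}.

Lemma compact_bounded (T : topologicalType) (A : set T) (f : T -> R) :
  compact A -> (forall x, A x -> {for x, continuous (f : T -> R^o)}) ->
  exists2 C : R, 0 <= C & forall x, A x -> `|f x| <= C.
Proof.
move=> cA cf; have [[x0 Ax0]|A0] := pselect (A !=set0); last first.
  by exists 0 => // x Ax; exfalso; apply: A0; exists x.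
have [|||c cinA cP] := @compact_EVT_max T R (fun x => `|f x|) A => //.
- by exists x0.
- apply: continuous_in_subspaceT => x /set_mem Ax.
  by apply: cvg_norm; exact: cf.
by exists `|f c| => // x Ax; apply: cP; exact/mem_set.
Qed.

Lemma compact_pos_lower (T : topologicalType) (A : set T) (f : T -> R) :
  compact A -> (forall x, A x -> {for x, continuous (f : T -> R^o)}) ->
  (forall x, A x -> 0 < f x) ->
  exists2 c : R, 0 < c & forall x, A x -> c <= f x.
Proof.
move=> cA cf f0; have [[x0 Ax0]|A0] := pselect (A !=set0); last first.
  by exists 1 => // x Ax; exfalso; apply: A0; exists x.
have [|||c cinA cP] := @compact_EVT_min T R f A => //.
- by exists x0.
- by apply: continuous_in_subspaceT => x /set_mem Ax; exact: cf.
exists (f c); first by apply: f0; exact: set_mem.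
by move=> x Ax; apply: cP; exact/mem_set.
Qed.

Lemma finite_max (N : nat) (P : 'I_N -> R -> Prop) :
  (forall i (a b : R), a <= b -> P i a -> P i b) ->
  (forall i, exists a, P i a) -> exists2 a : R, 0 <= a & forall i, P i a.
Proof.
move=> mono /choice[a aP]; exists (\big[Num.max/0]_i a i).
  by apply: bigmax_ge_id.
by move=> i; apply: mono (aP i); exact: le_bigmax_cond.
Qed.

(** The substitution of [1 / (1 + max a 0)] for the parameter turns conditions inherited by smaller
    positive values into conditions inherited by larger values. *)
Lemma finite_min (N : nat) (P : 'I_N -> R -> Prop) :
  (forall i (a b : R), 0 < b -> b <= a -> P i a -> P i b) ->
  (forall i, exists2 a : R, 0 < a & P i a) -> exists2 a : R, 0 < a & forall i, P i a.
Proof.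
move=> mono H; have [] := @finite_max N (fun i a => P i (1 / (1 + Num.max a 0))).
- move=> i x y xy; have h : 0 < 1 + Num.max x 0 by rewrite ltr_pwDl// le_max lexx orbT.
  have xy' : 1 + Num.max x 0 <= 1 + Num.max y 0.
    by rewrite lerD2l ge_max !le_max xy lexx orbT.
  apply: mono; first by rewrite divr_gt0// (lt_le_trans h).
  by rewrite !div1r lef_pV2// posrE (lt_le_trans h).
- move=> i; have [a a0 aP] := H i; exists (1 / a).
  apply: mono aP.
    by rewrite divr_gt0// ltr_pwDl// le_max lexx orbT.
  have a1 : 0 < 1 / a by rewrite divr_gt0.
  rewrite max_l; last exact: ltW.
  by rewrite !div1r invf_ple ?posrE ?addr_gt0 ?invr_gt0// lerDr.
by move=> a _ aP; exists (1 / (1 + Num.max a 0)) => //; rewrite divr_gt0// ltr_pwDl// le_max lexx orbT.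
Qed.

End compactness.

(** * Second-order Taylor bounds from the entries of the Hessian *)

Section second_order.
Context {R : realType}.

Lemma second_order_real (f f1 f2 : R -> R) (m : R) :
  (forall t : R, 0 <= t <= 1 -> is_derive t 1 (f : R -> R^o) (f1 t)) ->
  (forall t : R, 0 <= t <= 1 -> is_derive t 1 (f1 : R -> R^o) (f2 t)) ->
  (forall t : R, 0 <= t <= 1 -> m <= f2 t) ->
  f 0 + f1 0 + m / 2 <= f 1.
Proof.
move=> d1 d2 m2.
have cont (g dg : R -> R) a b : 0 <= a -> b <= 1 ->
    (forall t : R, 0 <= t <= 1 -> is_derive t 1 (g : R -> R^o) (dg t)) ->
    {within `[a, b], continuous (g : R -> R^o)}.
  move=> a0 b1 dg'; apply: continuous_in_subspaceT => x /set_mem/=.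
  rewrite in_itv/= => /andP[ax xb].
  apply: differentiable_continuous; apply/derivable1_diffP.
  have x01 : 0 <= x <= 1 by rewrite (le_trans a0 ax) (le_trans xb b1).
  by have [] := dg' x x01.
have f1t (t : R) : 0 <= t <= 1 -> m * t <= f1 t - f1 0.
  move=> /andP[t0 t1].
  have [|||c cin ->] := @MVT_segment R f1 f2 0 t => //.
  - move=> x; rewrite in_itv/= => /andP[x0 xt]; apply: d2.
    by rewrite (ltW x0)/= (le_trans (ltW xt) t1).
  - exact: cont d2.
  rewrite subr0; apply: ler_wpM2r => //; apply: m2.
  by move: cin; rewrite in_itv/= => /andP[-> h]; exact: le_trans t1.
(* Once the quadratic model is subtracted, the derivative is nonnegative on the unit interval by
   [f1t]. *)
pose g t := f t - (f1 0 * t + (m / 2) * (t * t)).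
have dg (t : R) : 0 <= t <= 1 -> is_derive t 1 (g : R -> R^o) (f1 t - (f1 0 + m * t)).
  move=> t01; have := d1 _ t01 => ?.
  rewrite /g; apply: is_derive_eq; rewrite !scaler1 /GRing.scale/=; goal_lra.
have [||c cin gc] := @MVT_segment R g (fun t => f1 t - (f1 0 + m * t)) 0 1 ler01.
- by move=> x; rewrite in_itv/= => /andP[x0 x1]; apply: dg; rewrite !ltW.
- exact: cont dg.
have c01 : 0 <= c <= 1 by move: cin; rewrite in_itv.
have := f1t c c01.
by move: gc; rewrite /g; lra.
Qed.

Lemma line_is_derive (V W : normedModType R) (F : V -> W) (z v : V) (t : R) :
  differentiable F (z + t *: v) ->
  is_derive t 1 (fun s : R => F (z + s *: v)) ('d F (z + t *: v) v).
Proof.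
move=> dF.
have E : (fun h : R => h^-1 *: (F (z + (h *: 1 + t) *: v) - F (z + t *: v))) =
         (fun h : R => h^-1 *: (F (h *: v + (z + t *: v)) - F (z + t *: v))).
  apply/funext => h; congr (_ *: (F _ - _)).
  by rewrite [h *: 1]mulr1 scalerDl addrCA.
have dv := diff_derivable (v := v) dF.
split; first by move: dv; rewrite /derivable/= -E.
by rewrite -deriveE// /derive/= -E.
Qed.

Variables (V : normedModType R) (m : nat) (e : 'I_m -> V) (co : 'I_m -> V -> R).
Hypothesis coE : forall v, v = \sum_i co i v *: e i.
Hypothesis co_le : forall i v, `|co i v| <= `|v|.

(** [Ck] controls differentials direction by direction only. Expanding in the vectors [e] reduces
    uniform bounds on a compact set to the finitely many entries of this matrix. *)
Definition hessian (F : V -> R^o) i j (z : V) : R :=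
  'd (fun x => 'd F x (e i) : R^o) z (e j).

Lemma Ck2_second_derivative (D : set V) (F : V -> R^o) (z v : V) : Ck 2 D F -> D z ->
  differentiable (fun x => 'd F x v : R^o) z /\
  'd (fun x => 'd F x v : R^o) z v =
    \sum_i \sum_j co i v * co j v * hessian F i j z.
Proof.
move=> [dF dF2] Dz.
have di w : differentiable (fun x => 'd F x w : R^o) z by exact: (dF2 w).1.
split=> //; rewrite -deriveE//.
have -> : (fun x => 'd F x v : R^o) = \sum_i (co i v *: (fun x => 'd F x (e i) : R^o)).
  apply/funext => x; rewrite {1}[in LHS](coE v) linear_sum/= fct_sumE.
  by apply: eq_bigr => i _; rewrite linearZ.
rewrite derive_sum; last by move=> i; apply: derivableZ; exact: diff_derivable.
apply: eq_bigr => i _; rewrite deriveZ; last exact: diff_derivable.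
rewrite deriveE// {2}[v in LHS](coE v) linear_sum/= /GRing.scale/= mulr_sumr.
by apply: eq_bigr => j _; rewrite linearZ/= /GRing.scale/= mulrA.
Qed.

Lemma hessian_continuous (D : set V) (F : V -> R^o) i j z : Ck 2 D F -> D z ->
  {for z, continuous (hessian F i j : V -> R^o)}.
Proof. by move=> [_ /(_ (e i))[_ /(_ (e j))]]; apply. Qed.

Lemma hessian_bounded (D K : set V) (F : V -> R^o) : Ck 2 D F -> K `<=` D -> compact K ->
  exists2 B : R, 0 <= B & forall i j z, K z -> `|hessian F i j z| <= B.
Proof.
move=> CF KD cK.
have [|i|B B0 BP] := @finite_max R m (fun i B => forall j z, K z -> `|hessian F i j z| <= B).
- by move=> i a b ab h j z Kz; exact: le_trans (h j z Kz) ab.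
- have [|j|B B0 BP] := @finite_max R m (fun j B => forall z, K z -> `|hessian F i j z| <= B).
  + by move=> j a b ab h z Kz; exact: le_trans (h z Kz) ab.
  + have [B B0 BP] := compact_bounded cK (fun x (Kx : K x) => hessian_continuous (i := i) (j := j)
    CF (KD x Kx)).
    by exists B.
  + by exists B.
by exists B.
Qed.

Definition hessian_form (F : V -> R^o) (z v w : V) : R :=
  \sum_i \sum_j co i v * co j w * hessian F i j z.

Lemma hessian_form_le (F : V -> R^o) (z v w : V) (B : R) : 0 <= B ->
  (forall i j, `|hessian F i j z| <= B) ->
  `|hessian_form F z v w| <= m%:R * m%:R * B * (`|v| * `|w|).
Proof.
move=> B0 HB; apply: le_trans (ler_norm_sum _ _ _) _.
apply: (@le_trans _ _ (\sum_(i < m) \sum_(j < m) `|v| * `|w| * B)).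
  apply: ler_sum => i _; apply: le_trans (ler_norm_sum _ _ _) _.
  by apply: ler_sum => j _; rewrite !normrM !ler_pM ?mulr_ge0.
rewrite !sumr_const card_ord -[X in X <= _]mulr_natl -[X in _ * X <= _]mulr_natl.
by rewrite le_eqVlt; apply/orP; left; apply/eqP; ring.
Qed.

Lemma Ck2_taylor_lower (D : set V) (F : V -> R^o) (z v : V) (c : R) : Ck 2 D F ->
  (forall t : R, 0 <= t <= 1 -> D (z + t *: v)) ->
  (forall t : R, 0 <= t <= 1 -> c <= hessian_form F (z + t *: v) v v) ->
  F z + 'd F z v + c / 2 <= F (z + v).
Proof.
move=> CF Dt ct.
have := @second_order_real (fun t => F (z + t *: v)) (fun t => 'd F (z + t *: v) v)
  (fun t => hessian_form F (z + t *: v) v v) c.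
rewrite scale0r addr0 scale1r; apply => //.
  by move=> t t01; apply: line_is_derive; case: CF => + _; apply; exact: Dt.
move=> t t01; have [h1 h2] := @Ck2_second_derivative D F (z + t *: v) v CF (Dt t t01).
by rewrite /hessian_form -h2; exact: (line_is_derive (F := fun x => 'd F x v) h1).
Qed.

Lemma Ck2_taylor_upper (D : set V) (F : V -> R^o) (z v : V) (c : R) : Ck 2 D F ->
  (forall t : R, 0 <= t <= 1 -> D (z + t *: v)) ->
  (forall t : R, 0 <= t <= 1 -> hessian_form F (z + t *: v) v v <= c) ->
  F (z + v) <= F z + 'd F z v + c / 2.
Proof.
move=> CF Dt ct.
have := @second_order_real (fun t => - F (z + t *: v)) (fun t => - 'd F (z + t *: v) v)
  (fun t => - hessian_form F (z + t *: v) v v) (- c).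
rewrite scale0r addr0 scale1r => H.
suff : - F z + - 'd F z v + - c / 2 <= - F (z + v) by lra.
apply: H.
- move=> t t01; apply: is_deriveN; apply: line_is_derive; case: CF => + _; apply; exact: Dt.
- move=> t t01; have [h1 h2] := @Ck2_second_derivative D F (z + t *: v) v CF (Dt t t01).
  apply: is_deriveN.
  by rewrite /hessian_form -h2; exact: (line_is_derive (F := fun x => 'd F x v) h1).
- by move=> t t01; rewrite lerN2; exact: ct.
Qed.

End second_order.

(** * Hamiltonians on phase space: local bounds and fiber convexity *)

(* [gradx F z] and [gradp F z] are the partial gradients of [F] in the position
   and momentum variables; the last two bounds are what remains of the C^2
   regularity and of the fiber convexity of [F]. *)
Section phase_space.
Context {R : realType} {n : nat}.
Local Notation V := 'rV[R]_n.
Implicit Types (F : V * V -> R) (a y q v : V).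

Definition gradx F (z : V * V) : V :=
  \row_i 'd (F : V * V -> R^o) z (delta_mx 0 i, 0).

Definition gradp F (z : V * V) : V :=
  \row_i 'd (F : V * V -> R^o) z (0, delta_mx 0 i).

Record nice_ham F a (rho : R) : Prop := {
  nice_superlinear : forall K : R, exists C : R, forall y q, cball a rho y ->
    K * `|q| - C <= F (y, q) ;
  nice_bounded : forall r : R, exists2 C : R, 0 <= C & forall y q, cball a rho y ->
    `|q| <= r -> [/\ `|F (y, q)| <= C, `|gradx F (y, q)| <= C & `|gradp F (y, q)| <= C] ;
  nice_taylor : forall r : R, exists2 C : R, 0 <= C & forall y q y' q',
    cball a rho y -> `|q| <= r -> cball a rho y' -> `|q'| <= r ->
    `|F (y', q') - (F (y, q) + pairing (gradx F (y, q)) (y' - y)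
                     + pairing (gradp F (y, q)) (q' - q))|
      <= C * (`|y' - y| ^+ 2 + `|q' - q| ^+ 2) ;
  nice_convex : forall r : R, exists2 l : R, 0 < l & exists2 C : R, 0 <= C &
    forall y q y' q',
    cball a rho y -> `|q| <= r -> cball a rho y' -> `|q'| <= r ->
    F (y, q) + pairing (gradx F (y, q)) (y' - y) + pairing (gradp F (y, q)) (q' - q)
      + l * `|q' - q| ^+ 2 - C * `|y' - y| ^+ 2 <= F (y', q') }.

Definition phase_basis (i : 'I_(n + n)) : V * V :=
  match fintype.split i with inl j => (delta_mx 0 j, 0) | inr j => (0, delta_mx 0 j) end.

Definition phase_coord (i : 'I_(n + n)) (z : V * V) : R :=
  match fintype.split i with inl j => z.1 0 j | inr j => z.2 0 j end.

Lemma row_sum_coord v : v = \sum_i v 0 i *: delta_mx 0 i.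
Proof. exact: row_sum_delta. Qed.

Lemma sum_fst (I : finType) (f : I -> V * V) : (\sum_i f i).1 = \sum_i (f i).1.
Proof. by elim/big_rec2 : _ => // i x y _ <-. Qed.

Lemma sum_snd (I : finType) (f : I -> V * V) : (\sum_i f i).2 = \sum_i (f i).2.
Proof. by elim/big_rec2 : _ => // i x y _ <-. Qed.

Lemma phase_coordE z : z = \sum_i phase_coord i z *: phase_basis i.
Proof.
rewrite big_split_ord/= /phase_coord /phase_basis.
under eq_bigr => i _ do rewrite (unsplitK (inl i)).
under [X in _ + X]eq_bigr => i _ do rewrite (unsplitK (inr i)).
case: z => x y /=; rewrite [RHS]surjective_pairing/= !sum_fst !sum_snd/=.
congr pair.
  by rewrite [X in _ + X]big1 ?addr0 -?row_sum_coord// => i _; rewrite scaler0.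
by rewrite big1 ?add0r -?row_sum_coord// => i _; rewrite scaler0.
Qed.

Lemma prod_norm v w : `|(v, w) : V * V| = Num.max `|v| `|w|.
Proof. by rewrite [LHS]prod_normE. Qed.

Lemma norm_fst_le (z : V * V) : `|z.1| <= `|z|.
Proof. by rewrite [leRHS]prod_normE le_max lexx. Qed.

Lemma norm_snd_le (z : V * V) : `|z.2| <= `|z|.
Proof. by rewrite [leRHS]prod_normE le_max lexx orbT. Qed.

Lemma phase_coord_le i z : `|phase_coord i z| <= `|z|.
Proof.
rewrite /phase_coord; case: (fintype.split _) => j.
  exact: le_trans (coord_le_norm _ _) (norm_fst_le _).
exact: le_trans (coord_le_norm _ _) (norm_snd_le _).
Qed.

Lemma diff_grad F z y q : 'd (F : V * V -> R^o) z (y, q) =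
  pairing (gradx F z) y + pairing (gradp F z) q.
Proof.
rewrite {1}[(y, q)]phase_coordE linear_sum big_split_ord/= /phase_coord /phase_basis.
congr (_ + _); apply: eq_bigr => i _.
  by rewrite (unsplitK (inl i)) linearZ/= mxE mulrC.
by rewrite (unsplitK (inr i)) linearZ/= mxE mulrC.
Qed.

Local Notation hess F z v w := (hessian_form phase_basis phase_coord F z v w).

(** This isolates the momentum block, the only one with a sign; each remaining term of the quadratic
    form contains a factor [y]. *)
Lemma hess_split F z (B : R) y q : 0 <= B ->
  (forall i j, `|hessian phase_basis F i j z| <= B) ->
  `|hess F z (y, q) (y, q) - hess F z (0, q) (0, q)|
     <= (n + n)%:R * (n + n)%:R * B * (`|y| ^+ 2 + 2 * `|y| * `|q|).
Proof.
move=> B0 HB.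
have coB i (v w : V * V) : phase_coord i (v + w) = phase_coord i v + phase_coord i w.
  by rewrite /phase_coord; case: (fintype.split _) => j; rewrite mxE.
have -> : hess F z (y, q) (y, q) - hess F z (0, q) (0, q) =
   hess F z (y, 0) (y, 0) + hess F z (y, 0) (0, q) + hess F z (0, q) (y, 0).
  rewrite /hessian_form -sumrB -!big_split/=; apply: eq_bigr => i _.
  rewrite -sumrB -!big_split/=; apply: eq_bigr => j _.
  have -> : (y, q) = (y, 0) + (0, q) :> V * V.
    by rewrite [RHS]surjective_pairing/= addr0 add0r.
  by rewrite !coB; ring.
have ny : `|(y, 0) : V * V| = `|y| by rewrite prod_norm normr0 max_l.
have nq : `|(0, q) : V * V| = `|q| by rewrite prod_norm normr0 max_r.
have h (v w : V * V) : `|hess F z v w| <= (n + n)%:R * (n + n)%:R * B * (`|v| * `|w|).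
  by apply: hessian_form_le => //; exact: phase_coord_le.
apply: le_trans (ler_normD _ _) _.
apply: (@le_trans _ _ ((n + n)%:R * (n + n)%:R * B * (`|y| * `|y|) +
   (n + n)%:R * (n + n)%:R * B * (`|y| * `|q|) + (n + n)%:R * (n + n)%:R * B * (`|q| * `|y|))).
  apply: lerD.
    apply: le_trans (ler_normD _ _) _; apply: lerD.
      by have := h (y, 0) (y, 0); rewrite ny.
    by have := h (y, 0) (0, q); rewrite ny nq.
  by have := h (0, q) (y, 0); rewrite ny nq.
by rewrite le_eqVlt; apply/orP; left; apply/eqP; ring.
Qed.

Lemma cont_sum (T : topologicalType) (I : finType) (f : I -> T -> R^o) (x : T) :
  (forall i, {for x, continuous (f i)}) -> {for x, continuous (fun t => \sum_i f i t : R^o)}.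
Proof.
move=> H; rewrite /index_enum/=; elim: (Finite.enum I) => [|i s ih].
  by rewrite (_ : (fun t => _) = cst (0:R^o)); [exact: cst_continuous|apply/funext => t;
    rewrite big_nil].
rewrite (_ : (fun t => _) = (fun t => f i t + \sum_(j <- s) f j t)); last first.
  by apply/funext => t; rewrite big_cons.
by apply: continuousD.
Qed.

(** All constants come from compactness of the product of the base ball with a momentum ball, which
    is stable under segments, so that the Taylor bounds hold between any two of its points. *)
Lemma Ck2_nice_ham F a rho (D : set (V * V)) : Ck 2 D (F : V * V -> R^o) ->
  (forall y q, cball a rho y -> D (y, q)) ->
  (forall K : R, exists C : R, forall y q, cball a rho y -> K * `|q| - C <= F (y, q)) ->
  (forall y q w, cball a rho y -> w != 0 ->
     0 < 'd (fun x => 'd (F : V * V -> R^o) x (0, w) : R^o) (y, q) (0, w)) ->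
  nice_ham F a rho.
Proof.
move=> CF DP sl cvx.
pose K r : set (V * V) := cball a rho `*` cball 0 r.
have cK r : compact (K r) by apply: compact_setX; exact: cball_compact.
have KD r : K r `<=` D by move=> [y q] [/= h _]; exact: DP.
have KP r y q : cball a rho y -> `|q| <= r -> K r (y, q).
  by move=> h1 h2; split => //=; rewrite /cball/= subr0.
have Kseg r y q y' q' t : K r (y, q) -> K r (y', q') -> 0 <= t <= 1 ->
    K r ((y, q) + t *: (y' - y, q' - q)).
  by move=> [/= h1 h2] [/= h3 h4] t01; split => /=; exact: cball_segment.
have dE y q y' q' : (y', q') = (y, q) + (y' - y, q' - q) :> V * V.
  by rewrite [RHS]surjective_pairing/= !subrKC.
have nv (v w : V) : `|(v, w) : V * V| ^+ 2 <= `|v| ^+ 2 + `|w| ^+ 2.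
  have := sqr_ge0 `|v|; have := sqr_ge0 `|w|.
  by rewrite prod_norm; case: (leP `|v| `|w|) => _; lra.
have hb r := hessian_bounded phase_basis CF (@KD r) (cK r).
split=> //.
- move=> r.
  have [B1 B10 B1P] : exists2 C : R, 0 <= C & forall z, K r z -> `|F z| <= C.
    apply: compact_bounded => // z Kz; apply: differentiable_continuous.
    by case: CF => + _; apply; exact: KD Kz.
  have [|i|B2 B20 B2P] := @finite_max R (n + n) (fun i B => forall z, K r z ->
      `|'d (F : V * V -> R^o) z (phase_basis i)| <= B).
  + by move=> i x y xy h z Kz; exact: le_trans (h z Kz) xy.
  + have [|B B0 BP] := compact_bounded (f := fun z => 'd (F : V * V -> R^o) z (phase_basis i)) (cK r).
      move=> z Kz; apply: differentiable_continuous.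
      by case: CF => _ /(_ (phase_basis i)) [+ _]; apply; exact: KD Kz.
    by exists B.
  exists (B1 + B2); first exact: addr_ge0.
  move=> y q yb qr; have Kz := KP _ _ _ yb qr; split.
  + by apply: le_trans (B1P _ Kz) _; rewrite lerDl.
  + apply: norm_le_coord => [|i]; first exact: addr_ge0.
    rewrite mxE; have := B2P (lshift n i) _ Kz.
    rewrite /phase_basis (unsplitK (inl i)) => h; apply: le_trans h _.
    by rewrite lerDr.
  + apply: norm_le_coord => [|i]; first exact: addr_ge0.
    rewrite mxE; have := B2P (rshift n i) _ Kz.
    rewrite /phase_basis (unsplitK (inr i)) => h; apply: le_trans h _.
    by rewrite lerDr.
- move=> r; have [B B0 BP] := hb r.
  pose m2 : R := (n + n)%:R * (n + n)%:R.
  have m20 : 0 <= m2 * B by rewrite !mulr_ge0.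
  exists (m2 * B) => // y q y' q' yb qr y'b q'r.
  have Kz := KP _ _ _ yb qr; have Kz' := KP _ _ _ y'b q'r.
  have Dt (t : R) : 0 <= t <= 1 -> D ((y, q) + t *: (y' - y, q' - q)).
    by move=> t01; apply: (KD r); exact: Kseg.
  have hle (t : R) : 0 <= t <= 1 ->
      `|hess F ((y, q) + t *: (y' - y, q' - q)) (y' - y, q' - q) (y' - y, q' - q)| <=
      m2 * B * (`|y' - y| ^+ 2 + `|q' - q| ^+ 2).
    move=> t01; set w : V * V := (y' - y, q' - q).
    apply: (@le_trans _ _ (m2 * B * (`|w| * `|w|))).
      apply: hessian_form_le => //; first exact: phase_coord_le.
      by move=> i j; apply: BP; exact: Kseg.
    by apply: ler_wpM2l => //; rewrite -expr2; exact: nv.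
  set E := m2 * B * _ in hle *.
  have E0 : 0 <= E by rewrite /E mulr_ge0// addr_ge0// sqr_ge0.
  have := Ck2_taylor_lower phase_coordE (c := - E) CF Dt.
  have := Ck2_taylor_upper phase_coordE (c := E) CF Dt.
  rewrite -dE diff_grad => U L.
  have {}U := U (fun t t01 => le_trans (ler_norm _) (hle t t01)).
  have {}L : F (y, q) + (pairing (gradx F (y, q)) (y' - y) + pairing (gradp F (y, q)) (q' - q)) +
     - E / 2 <= F (y', q').
    by apply: L => t t01; have := hle t t01; rewrite ler_norml => /andP[].
  by rewrite ler_norml; lra.
- move=> r; have [B B0 BP] := hb r.
  pose S : set V := [set q | `|q| = 1].
  have cS : compact S.
    apply: (@subclosed_compact _ _ (cball 0 1)); last 2 first.
    + exact: cball_compact.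
    + by move=> q; rewrite /S /cball/= subr0 => ->.
    rewrite (_ : S = (fun y : V => `|y|) @^-1` [set 1])//.
    apply: closed_comp; last exact: closed_eq.
    by move=> y _; exact: (@norm_continuous R V).
  (* The fiber Hessian on unit momenta is positive and continuous on a compact set, hence bounded
     below by some [l > 0]; homogeneity extends the bound to all momenta. *)
  pose Q (u : (V * V) * V) := hess F u.1 (0, u.2) (0, u.2).
  have [|u [Ku Su]|l l0 lP] := compact_pos_lower (f := Q) (compact_setX (cK r) cS).
  + move=> u [Ku Su]; apply: cont_sum => i; apply: cont_sum => j.
    have cco k : {for u, continuous (fun x : (V * V) * V => phase_coord k (0, x.2) : R^o)}.
      rewrite /phase_coord; case: (fintype.split k) => l /=.
        by rewrite (_ : (fun x => _) = cst (0:R^o)); [exact: cst_continuous|apply/funext => t;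
          rewrite mxE].
      apply: (@continuous_comp _ _ _ snd (fun x : V => x 0 l : R^o)); first exact: cvg_snd.
      exact: coord_continuous.
    apply: continuousM; first by apply: continuousM; exact: cco.
    apply: (@continuous_comp _ _ _ fst); first exact: cvg_fst.
    apply: (hessian_continuous CF); exact: KD Ku.
  + have [h1 h2] := Ck2_second_derivative phase_coordE (0, u.2) CF (@KD r _ Ku).
    rewrite /Q/hessian_form -h2; case: u Ku Su {h1 h2} => -[y q] w/= [yb _] Sw; apply: cvx => //.
    by rewrite -normr_eq0 Sw oner_eq0.
  have lP' z q : K r z -> l * `|q| ^+ 2 <= hess F z (0, q) (0, q).
    move=> Kz; have [->|q0] := eqVneq q 0.
      rewrite normr0 expr0n mulr0; rewrite /hessian_form big1// => i _; rewrite big1// => j _.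
      rewrite (_ : phase_coord i _ = 0) ?mul0r//.
      by rewrite /phase_coord; case: (fintype.split i) => k; rewrite mxE.
    have nq0 : `|q| != 0 by rewrite normr_eq0.
    have := lP (z, `|q|^-1 *: q) _.
    have Su : S (`|q|^-1 *: q) by rewrite /S/= normrZ normfV normr_id mulVf.
    move=> /(_ (conj Kz Su)); rewrite /Q/=.
    have -> : hess F z (0, `|q|^-1 *: q) (0, `|q|^-1 *: q) = `|q| ^- 2 * hess F z (0, q) (0, q).
      rewrite /hessian_form mulr_sumr; apply: eq_bigr => i _.
      rewrite mulr_sumr; apply: eq_bigr => j _.
      have co k : phase_coord k (0, `|q|^-1 *: q) = `|q|^-1 * phase_coord k (0, q).
        by rewrite /phase_coord; case: (fintype.split k) => k' /=; rewrite !mxE ?mulr0.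
      by rewrite !co; field.
    by rewrite mulrC ler_pdivlMr// exprn_gt0// normr_gt0.
  pose m2 : R := (n + n)%:R * (n + n)%:R * B.
  have m20 : 0 <= m2 by rewrite !mulr_ge0.
  (* Young's inequality spends half of [l] on the mixed terms, at the price [2 * m2 ^ 2 / l] in the
     position; the other factor [1 / 2] is that of the Taylor formula. *)
  exists (l / 4); first by rewrite divr_gt0.
  exists (m2 + 2 * m2 ^+ 2 / l).
    by rewrite addr_ge0// !mulr_ge0// ?sqr_ge0// invr_ge0 ltW.
  move=> y q y' q' yb qr y'b q'r.
  have Kz := KP _ _ _ yb qr; have Kz' := KP _ _ _ y'b q'r.
  have Dt (t : R) : 0 <= t <= 1 -> D ((y, q) + t *: (y' - y, q' - q)).
    by move=> t01; apply: (KD r); exact: Kseg.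
  have := Ck2_taylor_lower phase_coordE
    (c := l * `|q' - q| ^+ 2 - m2 * (`|y' - y| ^+ 2 + 2 * `|y' - y| * `|q' - q|)) CF Dt.
  rewrite -dE diff_grad => L.
  have {}L := L _; have AG : 2 * m2 * (`|y' - y| * `|q' - q|) <=
      l / 2 * `|q' - q| ^+ 2 + 2 * m2 ^+ 2 / l * `|y' - y| ^+ 2.
    rewrite -subr_ge0.
    have -> : l / 2 * `|q' - q| ^+ 2 + 2 * m2 ^+ 2 / l * `|y' - y| ^+ 2
        - 2 * m2 * (`|y' - y| * `|q' - q|) =
        (l / 2) * (`|q' - q| - 2 * m2 / l * `|y' - y|) ^+ 2.
      by field; rewrite gt_eqF.
    by rewrite mulr_ge0 ?sqr_ge0// ltW// divr_gt0.
  have X0 : 0 <= m2 * `|y' - y| ^+ 2 by rewrite mulr_ge0 ?sqr_ge0.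
  have Y0 : 0 <= m2 ^+ 2 / l * `|y' - y| ^+ 2.
    by rewrite !mulr_ge0 ?sqr_ge0// invr_ge0 ltW.
  apply: le_trans (L _).
    rewrite -!addrA; do 2![apply: lerD => //]; move: AG X0 Y0.
    set X := `|y' - y|; set Y := `|q' - q|.
    have -> : 2 * m2 ^+ 2 / l * X ^+ 2 = 2 * (m2 ^+ 2 / l * X ^+ 2) by ring.
    have -> : (m2 + 2 * m2 ^+ 2 / l) * X ^+ 2 = m2 * X ^+ 2 + 2 * (m2 ^+ 2 / l * X ^+ 2) by ring.
    have -> : m2 * (X ^+ 2 + 2 * X * Y) = m2 * X ^+ 2 + 2 * m2 * (X * Y) by ring.
    by lra.
  move=> t t01; have Kt := Kseg _ _ _ _ _ _ Kz Kz' t01.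
  have := @hess_split F ((y, q) + t *: (y' - y, q' - q)) B (y' - y) (q' - q) B0
    (fun i j => BP i j _ Kt).
  have := lP' _ (q' - q) Kt; rewrite ler_norml -/m2 => h /andP[h' _].
  by move: h h'; goal_lra.
Qed.

End phase_space.

(** * The Legendre transform in a chart *)

Section lagrangian_theory.
Context {R : realType} {n : nat}.
Local Notation V := 'rV[R]_n.
Implicit Types (a y q v : V).

(** A variational inequality with quadratic remainder, divided by [t], becomes a sign condition by
    this lemma; all first-order conditions are extracted in this way. *)
Lemma le0_of_small (x C t0 : R) : 0 < t0 ->
  (forall t : R, 0 < t -> t <= t0 -> x <= C * t) -> x <= 0.
Proof.
move=> t00 H; rewrite leNgt; apply/negP => x0.
pose C' := `|C| + 1; have C'0 : 0 < C' by rewrite ltr_pwDr.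
pose t := Num.min t0 (x / (2 * C')).
have xC : 0 < x / (2 * C') by rewrite divr_gt0// mulr_gt0.
have t_gt0 : 0 < t by rewrite lt_min t00.
have := H t t_gt0; rewrite ge_min lexx => /(_ isT) h.
have : C * t <= x / 2.
  apply: (@le_trans _ _ (C' * (x / (2 * C')))).
    apply: (@le_trans _ _ (C' * t)).
      by apply: ler_wpM2r; [exact: ltW|rewrite /C'; have := ler_norm C; lra].
    by rewrite ler_wpM2l ?(ltW C'0)// ge_min lexx orbT.
  by rewrite le_eqVlt; apply/orP; left; apply/eqP; field; rewrite gt_eqF.
by move: h x0; lra.
Qed.

Lemma lipschitz_within_continuous (A : set V) (f : V -> R) (L : R) :
  (forall x y, A x -> A y -> `|f x - f y| <= L * `|x - y|) ->
  {within A, continuous (f : V -> R^o)}.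
Proof.
move=> lf; apply/subspace_continuousP => x Ax; apply/cvgrPdist_le => e e0.
have L0 : 0 < `|L| + 1 by rewrite ltr_pwDr.
have d0 : 0 < e / (`|L| + 1) by rewrite divr_gt0.
near=> y.
have Ay : A y by near: y; exact: withinT.
apply: le_trans (lf _ _ Ax Ay) _.
have : `|x - y| <= e / (`|L| + 1).
  near: y; apply: cvg_within.
  by apply: filterS (@nbhsx_ballx _ V x _ d0) => z; rewrite -ball_normE/=; exact: ltW.
rewrite ler_pdivlMr// => h; apply: le_trans h; rewrite mulrC.
by rewrite ler_wpM2l// (le_trans (ler_norm L))// lerDl.
Unshelve. all: by end_near. Qed.

Lemma lipschitz_attains_min (A : set V) (f : V -> R) (L : R) : compact A -> A !=set0 ->
  (forall x y, A x -> A y -> `|f x - f y| <= L * `|x - y|) ->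
  exists2 c, A c & forall x, A x -> f c <= f x.
Proof.
move=> cA A0 lf; have [c cA' cP] := EVT_min_rV A0 cA (lipschitz_within_continuous lf).
by exists c; [exact: set_mem|move=> x Ax; apply: cP; exact/mem_set].
Qed.

(** The coordinate version of [lagrangian]; [lagrangian_in_chart] identifies the two. *)
Definition lag (F : V * V -> R) y v : R :=
  sup [set pairing p v - F (y, p) | p in [set: V]].

Variables (F : V * V -> R) (a : V) (rho : R).
Hypothesis hF : nice_ham F a rho.

Lemma nice_lipschitz (r : R) : exists2 L : R, 0 <= L & forall y q y' q',
    cball a rho y -> `|q| <= r -> cball a rho y' -> `|q'| <= r ->
    `|F (y', q') - F (y, q)| <= L * (`|y' - y| + `|q' - q|).
Proof.
have [B B0 BP] := nice_bounded hF r; have [C C0 CP] := nice_taylor hF r.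
exists (n%:R * B + C * (2 * `|rho| + 2 * `|r|)).
  by rewrite addr_ge0// mulr_ge0// addr_ge0// mulr_ge0.
move=> y q y' q' yb qr y'b q'r.
have [_ bx bp] := BP _ _ yb qr; have := CP _ _ _ _ yb qr y'b q'r.
have := pairing_le (gradx F (y, q)) (y' - y); have := pairing_le (gradp F (y, q)) (q' - q).
have nx : n%:R * `|gradx F (y, q)| * `|y' - y| <= n%:R * B * `|y' - y|.
  by rewrite ler_wpM2r// ler_wpM2l.
have np : n%:R * `|gradp F (y, q)| * `|q' - q| <= n%:R * B * `|q' - q|.
  by rewrite ler_wpM2r// ler_wpM2l.
have dy : `|y' - y| <= 2 * `|rho|.
  have -> : y' - y = (y' - a) - (y - a) by rewrite opprB addrA subrK.
  apply: le_trans (ler_normB _ _) _; have := ler_norm rho.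
  by move: yb y'b; rewrite /cball/=; goal_lra.
have dq : `|q' - q| <= 2 * `|r|.
  by apply: le_trans (ler_normB _ _) _; have := ler_norm r; lra.
have dy2 : C * `|y' - y| ^+ 2 <= C * (2 * `|rho| + 2 * `|r|) * `|y' - y|.
  rewrite expr2 mulrA ler_wpM2r// ler_wpM2l// (le_trans dy)// lerDl mulr_ge0//.
have dq2 : C * `|q' - q| ^+ 2 <= C * (2 * `|rho| + 2 * `|r|) * `|q' - q|.
  rewrite expr2 mulrA ler_wpM2r// ler_wpM2l// (le_trans dq)// lerDr mulr_ge0//.
move: nx np dy2 dq2.
set X := `|y' - y|; set Y := `|q' - q|; set E := C * (_ + _).
rewrite !ler_norml => h1 h2 h3 h4 /andP[h5 h6] /andP[h7 h8] /andP[h9 h10].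
by apply/andP; split; lra.
Qed.

(** Superlinearity with slope [n * A + 1] makes a momentum of norm larger than [|C| + B] worse than
    the momentum 0, for every [y] in the ball and [v] of norm at most [A]; the maximum is thus taken
    over a fixed compact ball. *)
Lemma lag_max (A : R) : exists2 r : R, 0 <= r & forall y v, cball a rho y -> `|v| <= A ->
  exists2 p, `|p| <= r & forall q, pairing q v - F (y, q) <= pairing p v - F (y, p).
Proof.
have [A0|A0] := ltP A 0.
  by exists 0 => // y v _ vA; have := normr_ge0 v; rewrite leNgt (le_lt_trans vA A0).
have [C CP] := nice_superlinear hF (n%:R * A + 1).
have [B B0 BP] := nice_bounded hF 0.
exists (`|C| + B); first by rewrite addr_ge0.
move=> y v yb vA.
have [L L0 LP] := nice_lipschitz (`|C| + B).
have [||x x' xb x'b|p pb pP] := @lipschitz_attains_min (cball 0 (`|C| + B))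
   (fun q => F (y, q) - pairing q v) (L + n%:R * A).
- exact: cball_compact.
- by exists 0; rewrite /cball/= subr0 normr0 addr_ge0.
- move: xb x'b; rewrite /cball/= !subr0 => xb x'b.
  have := LP _ _ _ _ yb x'b yb xb; rewrite subrr normr0 add0r.
  have -> : F (y, x) - pairing x v - (F (y, x') - pairing x' v) =
    (F (y, x) - F (y, x')) - pairing (x - x') v by rewrite pairingBl; ring.
  move=> h; apply: le_trans (ler_normB _ _) _; rewrite mulrDl; apply: lerD => //.
  apply: le_trans (pairing_le _ _) _; rewrite -!mulrA [`|x - x'| * _]mulrC.
  by rewrite ler_wpM2l// ler_wpM2r.
exists p; first by move: pb; rewrite /cball/= subr0.
move=> q; have [qr|qr] := leP `|q| (`|C| + B).
  by have := pP q; rewrite /cball/= subr0 => /(_ qr); lra.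
have := pP 0; rewrite /cball/= subr0 normr0 pairing0l => /(_ (addr_ge0 (normr_ge0 _) B0)).
have := CP _ q yb; have := pairing_ler q v.
have : n%:R * `|q| * `|v| <= n%:R * A * `|q|.
  by rewrite -!mulrA [_ * `|v|]mulrC ler_wpM2l// ler_wpM2r.
have [] := BP y 0 yb _; first by rewrite normr0.
rewrite ler_norml => /andP[_ h] _ _; have := ler_norm C.
by rewrite mulrDl; lra.
Qed.

Lemma lag_has_sup y v : cball a rho y ->
  has_sup [set pairing p v - F (y, p) | p in [set: V]].
Proof.
move=> yb; split; first by exists (pairing 0 v - F (y, 0)), 0.
have [r r0 /(_ y v yb (lexx _))[p _ pP]] := lag_max `|v|.
by exists (pairing p v - F (y, p)) => _ [q _ <-].
Qed.

Lemma lag_ge y v q : cball a rho y -> pairing q v - F (y, q) <= lag F y v.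
Proof. by move=> yb; apply: sup_upper_bound; [exact: lag_has_sup|exists q]. Qed.

Lemma lag_le y v (b : R) : cball a rho y -> (forall q, pairing q v - F (y, q) <= b) ->
  lag F y v <= b.
Proof.
by move=> yb H; apply: ge_sup; [case: (lag_has_sup v yb)|move=> _ [q _ <-]].
Qed.

Lemma lag_maxE y v p : cball a rho y ->
  (forall q, pairing q v - F (y, q) <= pairing p v - F (y, p)) ->
  lag F y v = pairing p v - F (y, p).
Proof.
by move=> yb H; apply/eqP; rewrite eq_le lag_le//= lag_ge.
Qed.

Lemma gradp_max y v p : cball a rho y ->
  (forall q, pairing q v - F (y, q) <= pairing p v - F (y, p)) -> v = gradp F (y, p).
Proof.
move=> yb H.
suff key w : pairing (v - gradp F (y, p)) w <= 0.
  apply/eqP; rewrite -subr_eq0; apply/eqP; apply: pairing_eq => w.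
  apply/eqP; rewrite pairing0l eq_le key/= -oppr_le0 -pairingNr; exact: key.
have [C C0 CP] := nice_taylor hF (`|p| + `|w|).
apply: (@le0_of_small _ (C * `|w| ^+ 2) 1) => // t t0 t1.
have pw : `|t *: w + p| <= `|p| + `|w|.
  rewrite addrC; apply: le_trans (ler_normD _ _) _; rewrite lerD2l normrZ gtr0_norm//.
  by rewrite ler_piMl.
have pp : `|p| <= `|p| + `|w| by rewrite lerDl.
have := CP _ _ _ _ yb pp yb pw; rewrite subrr pairing0r addrK normr0 expr0n add0r addr0.
rewrite normrZ gtr0_norm// exprMn pairingZr ler_norml => /andP[_ h].
have := H (t *: w + p); rewrite (pairingDl (t *: w)) pairingZl => h'.
rewrite -(ler_pM2r t0) pairingBl (pairingC v).
have -> : C * `|w| ^+ 2 * t * t = C * (t ^+ 2 * `|w| ^+ 2) by ring.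
by move: h h'; goal_lra.
Qed.

(** Strong fiber convexity of [F] gives a quadratic upper bound on its Legendre transform: the
    product of [q - p] and [v' - v] is absorbed by [l * |q - p| ^ 2], whence the term
    [n ^ 2 / (4 * l)]. This one-sided expansion takes the place of differentiability of the
    Lagrangian. *)
Lemma lag_expand (A : R) : exists2 r : R, 0 <= r & exists2 C : R, 0 <= C & forall y v,
  cball a rho y -> `|v| <= A -> exists p, [/\ `|p| <= r,
    lag F y v = pairing p v - F (y, p), v = gradp F (y, p) &
    forall y' v', cball a rho y' -> `|v'| <= A ->
      lag F y' v' <= lag F y v - pairing (gradx F (y, p)) (y' - y) + pairing p (v' - v)
        + C * (`|y' - y| ^+ 2 + `|v' - v| ^+ 2)].
Proof.
have [r r0 rP] := lag_max A; have [l l0 [C C0 CP]] := nice_convex hF r.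
exists r => //; exists (C + n%:R ^+ 2 / (4 * l)).
  by rewrite addr_ge0// divr_ge0// ?sqr_ge0// mulr_ge0// ltW.
move=> y v yb vA; have [p pr pP] := rP _ _ yb vA; exists p.
have vE := gradp_max yb pP; have lE := lag_maxE yb pP; split=> //.
move=> y' v' y'b v'A; have [q qr qP] := rP _ _ y'b v'A.
rewrite (lag_maxE y'b qP) lE.
have := CP _ _ _ _ yb pr y'b qr; rewrite -vE.
have : pairing (q - p) (v' - v) <= l * `|q - p| ^+ 2 + n%:R ^+ 2 / (4 * l) * `|v' - v| ^+ 2.
  apply: le_trans (pairing_ler _ _) _; rewrite -subr_ge0.
  have -> : l * `|q - p| ^+ 2 + n%:R ^+ 2 / (4 * l) * `|v' - v| ^+ 2
      - n%:R * `|q - p| * `|v' - v| = l * (`|q - p| - n%:R / (2 * l) * `|v' - v|) ^+ 2.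
    by field; rewrite gt_eqF.
  by rewrite mulr_ge0 ?sqr_ge0// ltW.
have X0 : 0 <= n%:R ^+ 2 / (4 * l) * `|y' - y| ^+ 2.
  by rewrite mulr_ge0 ?sqr_ge0// divr_ge0 ?sqr_ge0// mulr_ge0// ltW.
have Y0 : 0 <= C * `|v' - v| ^+ 2 by rewrite mulr_ge0 ?sqr_ge0.
move: X0 Y0; rewrite !(pairingBl, pairingBr) (pairingC v q) (pairingC v p).
have -> : (C + n%:R ^+ 2 / (4 * l)) * (`|y' - y| ^+ 2 + `|v' - v| ^+ 2) =
  C * `|y' - y| ^+ 2 + n%:R ^+ 2 / (4 * l) * `|v' - v| ^+ 2 +
  (n%:R ^+ 2 / (4 * l) * `|y' - y| ^+ 2 + C * `|v' - v| ^+ 2) by ring.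
by lra.
Qed.

Lemma lag_bounded (A : R) : exists2 C : R, 0 <= C & forall y v,
  cball a rho y -> `|v| <= A -> `|lag F y v| <= C.
Proof.
have [r r0 [C' _ rP]] := lag_expand A; have [B B0 BP] := nice_bounded hF r.
exists (n%:R * r * `|A| + B); first by rewrite addr_ge0// !mulr_ge0.
move=> y v yb vA; have [p [pr -> _ _]] := rP _ _ yb vA; have [h _ _] := BP _ _ yb pr.
apply: le_trans (ler_normB _ _) _; apply: lerD => //.
apply: le_trans (pairing_le _ _) _; apply: ler_pM; rewrite ?mulr_ge0//.
  by rewrite ler_wpM2l.
exact: le_trans (ler_norm _).
Qed.

(** The supremum is tested with a momentum of norm at most [K] aligned with [v]. *)
Lemma lag_superlinear (K : R) : 0 <= K -> exists2 C : R, 0 <= C & forall y v,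
  cball a rho y -> K * `|v| - C <= lag F y v.
Proof.
move=> K0; have [B B0 BP] := nice_bounded hF K; exists B => // y v yb.
have [s sK sv] := exists_aligned v K0; apply: le_trans (lag_ge v s yb).
by have [] := BP _ _ yb sK; rewrite ler_norml => /andP[_ h] _ _; lra.
Qed.

Lemma lag_lipschitz (A : R) : exists2 L : R, 0 <= L & forall y v y' v',
  cball a rho y -> `|v| <= A -> cball a rho y' -> `|v'| <= A ->
  `|lag F y' v' - lag F y v| <= L * (`|y' - y| + `|v' - v|).
Proof.
have [r r0 [C C0 rP]] := lag_expand A; have [B B0 BP] := nice_bounded hF r.
pose L := n%:R * B + n%:R * r + C * (2 * `|rho| + 2 * `|A|).
have L0 : 0 <= L by rewrite !addr_ge0// !mulr_ge0// addr_ge0// mulr_ge0.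
exists L => //.
suff key y v y' v' : cball a rho y -> `|v| <= A -> cball a rho y' -> `|v'| <= A ->
    lag F y' v' - lag F y v <= L * (`|y' - y| + `|v' - v|).
  move=> y v y' v' h1 h2 h3 h4; rewrite ler_norml; have := key _ _ _ _ h1 h2 h3 h4.
  by have := key _ _ _ _ h3 h4 h1 h2; rewrite (distrC y) (distrC v); lra.
move=> yb vA y'b v'A; have [p [pr _ _ /(_ _ _ y'b v'A)]] := rP _ _ yb vA.
have [_ bx _] := BP _ _ yb pr.
have := pairing_le (gradx F (y, p)) (y' - y); have := pairing_ler p (v' - v).
have nx : n%:R * `|gradx F (y, p)| * `|y' - y| <= n%:R * B * `|y' - y|.
  by rewrite ler_wpM2r// ler_wpM2l.
have np : n%:R * `|p| * `|v' - v| <= n%:R * r * `|v' - v|.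
  by rewrite ler_wpM2r// ler_wpM2l.
have dy : `|y' - y| <= 2 * `|rho|.
  have -> : y' - y = (y' - a) - (y - a) by rewrite opprB addrA subrK.
  apply: le_trans (ler_normB _ _) _; have := ler_norm rho.
  by move: yb y'b; rewrite /cball/=; goal_lra.
have dv : `|v' - v| <= 2 * `|A|.
  by apply: le_trans (ler_normB _ _) _; have := ler_norm A; lra.
have dy2 : C * `|y' - y| ^+ 2 <= C * (2 * `|rho| + 2 * `|A|) * `|y' - y|.
  by rewrite expr2 mulrA ler_wpM2r// ler_wpM2l// (le_trans dy)// lerDl mulr_ge0.
have dv2 : C * `|v' - v| ^+ 2 <= C * (2 * `|rho| + 2 * `|A|) * `|v' - v|.
  by rewrite expr2 mulrA ler_wpM2r// ler_wpM2l// (le_trans dv)// lerDr mulr_ge0.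
have z1 : 0 <= n%:R * r * `|y' - y| by rewrite !mulr_ge0.
have z2 : 0 <= n%:R * B * `|v' - v| by rewrite !mulr_ge0.
rewrite /L; move: nx np dy2 dv2 z1 z2; set X := `|y' - y|; set Y := `|v' - v|.
rewrite ler_norml => h1 h2 h3 h4 h5 h6 h7 /andP[h8 h9] h10.
set E := C * (_ + _) in h3 h4 *.
have -> : (n%:R * B + n%:R * r + E) * (X + Y) = n%:R * B * X + n%:R * r * Y + E * X + E * Y +
  n%:R * r * X + n%:R * B * Y by ring.
by lra.
Qed.

End lagrangian_theory.

(** * Discrete minimization and the symplectic Euler scheme *)

Section discrete_dynamics.
Context {R : realType} {n : nat}.
Local Notation V := 'rV[R]_n.
Implicit Types (x y z p q v w : V).

(* Constants attached to a nice Hamiltonian and to a Lipschitz constant [K]: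
   minimizing steps of a (K+1)-Lipschitz function have speed at most [A - 2]. *)
Record dp_constants (F : V * V -> R) (a : V) (r K A C0 C1 R0 C L : R) : Prop := {
  dp_pos : [/\ 0 <= K, 0 <= C0, 0 <= C1, 0 <= R0 & 0 <= C /\ 0 <= L] ;
  dp_A : A = C0 + C1 + 2 ;
  dp_rest : forall y, cball a (8 * r) y -> lag F y 0 <= C0 ;
  dp_superlinear : forall y v, cball a (8 * r) y -> (K + 2) * `|v| - C1 <= lag F y v ;
  dp_expand : forall y v, cball a (8 * r) y -> `|v| <= A -> exists p, [/\ `|p| <= R0,
    lag F y v = pairing p v - F (y, p), v = gradp F (y, p) &
    forall y' v', cball a (8 * r) y' -> `|v'| <= A ->
      lag F y' v' <= lag F y v - pairing (gradx F (y, p)) (y' - y) + pairing p (v' - v)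
        + C * (`|y' - y| ^+ 2 + `|v' - v| ^+ 2)] ;
  dp_lipschitz : forall y v y' v', cball a (8 * r) y -> `|v| <= A ->
    cball a (8 * r) y' -> `|v'| <= A ->
    `|lag F y' v' - lag F y v| <= L * (`|y' - y| + `|v' - v|) }.

Lemma dp_constants_exist (F : V * V -> R) (a : V) (r K : R) : 0 <= K ->
  nice_ham F a (8 * r) -> exists A C0 C1 R0 C L, dp_constants F a r K A C0 C1 R0 C L.
Proof.
move=> K0 hF; have [C0 C00 C0P] := lag_bounded hF 0.
have K20 : 0 <= K + 2 by rewrite addr_ge0.
have [C1 C10 C1P] := lag_superlinear hF K20.
pose A := C0 + C1 + 2; have [R0 R00 [C CC0 CP]] := lag_expand hF A.
have [L L0 LP] := lag_lipschitz hF A.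
exists A, C0, C1, R0, C, L; split=> // y yb.
by have := C0P y 0 yb; rewrite normr0 lexx => /(_ isT); rewrite ler_norml => /andP[].
Qed.

Section dp.
Variables (F : V * V -> R) (a : V) (r K A C0 C1 R0 C L h : R).
Hypothesis dp : dp_constants F a r K A C0 C1 R0 C L.
Hypothesis h0 : 0 < h.

(** The Lagrangian is evaluated at the origin of the step and the speed is limited to [A], so that
    the infimum is a minimum over a compact ball. *)
Definition dstep (W : V -> R) x : R :=
  inf [set W y + h * lag F y (h^-1 *: (x - y)) | y in cball x (A * h)].

Let hn0 : h != 0. Proof. by rewrite gt_eqF. Qed.

Let A2 : 2 <= A.
Proof. by have [_ ? ? _ _] := dp_pos dp; rewrite (dp_A dp); lra. Qed.

Let A2le : A - 2 <= A. Proof. by rewrite lerBlDr lerDl. Qed.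

Let Ah_split : A * h = (A - 2) * h + h + h. Proof. by ring. Qed.

Lemma speed_le y x (c : R) : (`|h^-1 *: (x - y)| <= c) = (`|x - y| <= c * h).
Proof. by rewrite normrZ gtr0_norm ?invr_gt0// mulrC ler_pdivrMr. Qed.

Lemma step_in s x y (d : R) : cball a s x -> `|x - y| <= d -> cball a (s + d) y.
Proof.
rewrite /cball/= => xs xy; have -> : y - a = (x - a) - (x - y) by row_ring.
by apply: le_trans (ler_normB _ _) _; apply: lerD.
Qed.

(** Standing still at [x] costs at most [C0 * h]. In a step of speed [|w|], [W] gains at most slope
    [K + 1] while the Lagrangian grows with slope [K + 2] up to [C1]; hence [|w| <= C0 + C1 = A - 2]
    at a minimum. The constraint is inactive, with a margin [2 * h] for perturbations. *)
Lemma dstep_spec (W : V -> R) (s k : R) : k <= K + 1 -> s + A * h <= 8 * r ->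
  (forall x y, cball a (s + A * h) x -> cball a (s + A * h) y ->
     `|W x - W y| <= k * `|x - y|) ->
  forall x, cball a s x ->
    (exists2 y, `|x - y| <= (A - 2) * h &
       dstep W x = W y + h * lag F y (h^-1 *: (x - y))) /\
    (forall y, `|x - y| <= A * h -> dstep W x <= W y + h * lag F y (h^-1 *: (x - y))).
Proof.
move=> kK sA Wl x xs; have h0' := h0; have A2' := A2.
have [K0 C00 C10 _ [_ L0]] := dp_pos dp.
have b8 y : cball a (s + A * h) y -> cball a (8 * r) y by move=> h1; exact: le_trans h1 sA.
have inb y : cball x (A * h) y -> cball a (s + A * h) y.
  by rewrite /cball/= distrC => xy; apply: (step_in xs).
have spA y : cball x (A * h) y -> `|h^-1 *: (x - y)| <= A.
  by rewrite /cball/= distrC speed_le.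
have Ah0 : 0 <= A * h by rewrite mulr_ge0; lra.
have xx : cball x (A * h) x by rewrite /cball/= subrr normr0.
have [||y1 y2 yb1 yb2|c cb cP] := @lipschitz_attains_min R n (cball x (A * h))
    (fun y => W y + h * lag F y (h^-1 *: (x - y))) (k + h * (L * (1 + h^-1))).
- exact: cball_compact.
- by exists x.
- have -> : W y1 + h * lag F y1 (h^-1 *: (x - y1)) - (W y2 + h * lag F y2 (h^-1 *: (x - y2)))
    = (W y1 - W y2) + h * (lag F y1 (h^-1 *: (x - y1)) - lag F y2 (h^-1 *: (x - y2))) by ring.
  apply: le_trans (ler_normD _ _) _; rewrite mulrDl; apply: lerD.
    by apply: Wl; exact: inb.
  rewrite normrM gtr0_norm// -mulrA ler_wpM2l ?(ltW h0)//.
  apply: le_trans (dp_lipschitz dp (b8 _ (inb _ yb2)) (spA _ yb2) (b8 _ (inb _ yb1)) (spA _ yb1)) _.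
  rewrite -scalerBr (_ : x - y1 - (x - y2) = - (y1 - y2)); last first.
    by rewrite !opprB addrC addrA subrK.
  by rewrite scalerN normrN normrZ gtr0_norm ?invr_gt0// -mulrA mulrDl mul1r.
have hi : has_inf [set W y + h * lag F y (h^-1 *: (x - y)) | y in cball x (A * h)].
  split; first by exists (W x + h * lag F x (h^-1 *: (x - x))); exists x.
  by exists (W c + h * lag F c (h^-1 *: (x - c))) => _ [y yb <-]; exact: cP.
have le1 y : `|x - y| <= A * h -> dstep W x <= W y + h * lag F y (h^-1 *: (x - y)).
  by move=> xy; apply: ge_inf; [case: hi|exists y => //; rewrite /cball/= distrC].
split=> //; exists c; last first.
  apply/eqP; rewrite eq_le le1/=; last by move: cb; rewrite /cball/= distrC.
  by apply: lb_le_inf; [case: hi|move=> _ [y yb <-]; exact: cP].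
have := cP x xx; rewrite subrr scaler0 => H1.
have := dp_superlinear dp (h^-1 *: (x - c)) (b8 _ (inb _ cb)).
have := dp_rest dp (b8 _ (inb _ xx)).
have := Wl x c (inb _ xx) (inb _ cb); rewrite ler_norml => /andP[_ H2] H3 H4.
rewrite -speed_le (dp_A dp).
set w := h^-1 *: (x - c) in H1 H4 *.
have xc : `|x - c| = h * `|w| by rewrite /w normrZ gtr0_norm ?invr_gt0// mulrA divff// mul1r.
have H5 : k * `|x - c| <= h * ((K + 1) * `|w|).
  by rewrite xc mulrCA ler_wpM2l ?(ltW h0)// ler_wpM2r.
have : h * lag F c w <= h * (C0 + (K + 1) * `|w|).
  have : h * lag F x 0 <= h * C0 by rewrite ler_wpM2l ?(ltW h0).
  by rewrite mulrDr; lra.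
by rewrite ler_pM2l// => H6; lra.
Qed.

(** The optimal step ending at one point is translated to the other with the same velocity, which
    changes the Lagrangian by at most [L] times the distance. *)
Lemma dstep_lipschitz (W : V -> R) (s k : R) : k <= K + 1 -> s + A * h <= 8 * r ->
  (forall x y, cball a (s + A * h) x -> cball a (s + A * h) y ->
     `|W x - W y| <= k * `|x - y|) ->
  forall x y, cball a s x -> cball a s y ->
    `|dstep W x - dstep W y| <= (k + h * L) * `|x - y|.
Proof.
move=> kK sA Wl; have h0' := h0; have A2' := A2.
have b8 y : cball a (s + A * h) y -> cball a (8 * r) y by move=> h1; exact: le_trans h1 sA.
suff key x y : cball a s x -> cball a s y -> dstep W x - dstep W y <= (k + h * L) * `|x - y|.
  move=> x y xs ys; rewrite ler_norml (key _ _ xs ys) andbT lerNl opprB distrC.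
  exact: key.
move=> xs ys.
have [[c cy ->] _] := dstep_spec kK sA Wl ys.
have [_ le1] := dstep_spec kK sA Wl xs.
have cyA : `|y - c| <= A * h.
  by apply: le_trans cy _; rewrite ler_pM2r//; lra.
have e : x - (c + (x - y)) = y - c by row_ring.
have := le1 (c + (x - y)); rewrite e => /(_ cyA) H1.
have cb := step_in ys cyA.
have cb' : cball a (s + A * h) (c + (x - y)) by apply: (step_in xs); rewrite e.
have e2 : c + (x - y) - c = x - y by row_ring.
have := Wl _ _ cb' cb; rewrite e2 ler_norml => /andP[_ H2].
have sp : `|h^-1 *: (y - c)| <= A by rewrite speed_le.
have := dp_lipschitz dp (b8 _ cb) sp (b8 _ cb') sp.
rewrite subrr normr0 addr0 e2 ler_norml => /andP[_ H3].
have H4 : h * (lag F (c + (x - y)) (h^-1 *: (y - c)) - lag F c (h^-1 *: (y - c)))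
   <= h * (L * `|x - y|) by rewrite ler_pM2l.
move: H1 H2 H4; move: (dstep W x) (W c) (W _) (lag F c _) (lag F _ _) `|x - y|.
by move=> d w w' l l' X; rewrite mulrDl mulrBr mulrA; goal_lra.
Qed.

(* One optimal step from [x] back to [y]: [p] and [q] are the momenta of a step
   of the symplectic Euler scheme. *)
Lemma step_expand x y : cball a (8 * r) y -> `|x - y| <= (A - 2) * h ->
  exists p, let q := p + h *: gradx F (y, p) in
    [/\ `|p| <= R0, x - y = h *: gradp F (y, p) &
    forall z z', `|z - z'| <= h -> cball a (8 * r) (y + z') ->
      h * lag F (y + z') (h^-1 *: (x + z - (y + z'))) <=
      h * lag F y (h^-1 *: (x - y)) + pairing p z - pairing q z'
      + C * (`|z - z'| ^+ 2 / h + h * `|z'| ^+ 2)].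
Proof.
move=> yb; rewrite -speed_le => sp; have h0' := h0.
have spA : `|h^-1 *: (x - y)| <= A by apply: le_trans sp _; lra.
have [p [pR _ vE H]] := dp_expand dp yb spA; exists p => q; split=> //.
  by rewrite -vE scalerA divff// scale1r.
move=> z z' zz yb'.
have E : h^-1 *: (x + z - (y + z')) = h^-1 *: (x - y) + h^-1 *: (z - z').
  by rewrite -scalerDr opprD addrACA.
have nz : `|h^-1 *: (z - z')| = `|z - z'| / h.
  by rewrite normrZ gtr0_norm ?invr_gt0// mulrC.
have sp' : `|h^-1 *: (x + z - (y + z'))| <= A.
  rewrite E; apply: le_trans (ler_normD _ _) _; rewrite nz.
  have : `|z - z'| / h <= 1 by rewrite ler_pdivrMr// mul1r.
  by move: sp; lra.
have := H _ _ yb' sp'; rewrite E [X in _ <= X -> _]addrAC.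
rewrite (_ : y + z' - y = z'); last by rewrite addrAC subrr add0r.
rewrite (_ : h^-1 *: (x - y) + h^-1 *: (z - z') - h^-1 *: (x - y) = h^-1 *: (z - z')); last first.
  by rewrite addrAC subrr add0r.
rewrite nz pairingZr pairingBr.
have -> : C * (`|z - z'| ^+ 2 / h + h * `|z'| ^+ 2) = h * (C * (`|z'| ^+ 2 + (`|z - z'| / h) ^+ 2)).
  by field.
rewrite /q pairingDl pairingZl => H1.
have := H1; rewrite -(ler_pM2l h0) => H2; apply: le_trans H2 _.
rewrite le_eqVlt; apply/orP; left; apply/eqP.
by field.
Qed.

Variables (u : V -> R) (tau : R).
Hypothesis r0 : 0 < r.
Hypothesis tauA : A * tau <= r / 2.
Hypothesis tauL : L * tau <= 1.
Hypothesis u_lip : forall x y, cball a (8 * r) x -> cball a (8 * r) y ->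
  `|u x - u y| <= K * `|x - y|.

Definition dval k : V -> R := iter k dstep u.

(** Each step may move by [A * h], and the domain shrinks accordingly. As [A * tau <= r / 2], the
    ball of radius [7 * r] is still contained in it at time [tau]. *)
Definition dom k : set V := cball a (15 / 2 * r - k%:R * (A * h)).

Let domS k x y : dom k.+1 x -> `|x - y| <= A * h -> dom k y.
Proof.
move=> xk xy; have := step_in xk xy; rewrite /dom -natr1.
by move=> H; apply: le_trans H _; rewrite le_eqVlt; apply/orP; left; apply/eqP; ring.
Qed.

Lemma dom_ball k x : k%:R * h <= tau -> cball a (7 * r) x -> dom k x.
Proof.
move=> kt xb; apply: le_trans xb _; have A2' := A2; have tA := tauA.
have : A * (k%:R * h) <= A * tau by rewrite ler_wpM2l//; lra.
by rewrite mulrCA; lra.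
Qed.

Lemma dom_sub k x : dom k x -> cball a (15 / 2 * r) x.
Proof.
move=> xk; apply: le_trans xk _; have A2' := A2.
have : 0 <= k%:R * (A * h) by rewrite !mulr_ge0 ?(ltW h0)//; lra.
by lra.
Qed.

Lemma dom_sub8 k x : dom k x -> cball a (8 * r) x.
Proof. by move/dom_sub => h1; apply: le_trans h1 _; have := r0; lra. Qed.

(** The constant grows by [h * L] at each step, and [L * tau <= 1] keeps it below [K + 1], the slope
    for which the speed of minimizers is controlled. *)
Lemma dval_lipschitz k : k%:R * h <= tau -> forall x y, dom k x -> dom k y ->
  `|dval k x - dval k y| <= (K + k%:R * h * L) * `|x - y|.
Proof.
have h0' := h0; have r0' := r0; have [K0 _ _ _ [_ L0]] := dp_pos dp.
elim: k => [|k ih] kt x y xk yk.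
  by rewrite mul0r mul0r addr0; apply: u_lip; apply: (@dom_sub8 0).
have kt' : k%:R * h <= tau by move: kt; rewrite -natr1; lra.
rewrite /dval iterS -natr1.
have -> : (K + (k%:R + 1) * h * L) = (K + k%:R * h * L) + h * L by ring.
apply: (@dstep_lipschitz _ (15 / 2 * r - k.+1%:R * (A * h))) => //.
- rewrite lerD2l; apply: le_trans tauL; rewrite mulrC ler_wpM2l//.
- rewrite -natr1; have A2' := A2.
  have : 0 <= k%:R * (A * h) by rewrite !mulr_ge0 ?(ltW h0)//; lra.
  by lra.
- have -> : 15 / 2 * r - k.+1%:R * (A * h) + A * h = 15 / 2 * r - k%:R * (A * h).
    by rewrite -natr1; ring.
  exact: ih.
Qed.

Lemma dval_spec k x : k.+1%:R * h <= tau -> dom k.+1 x ->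
    (exists2 y, `|x - y| <= (A - 2) * h &
       dval k.+1 x = dval k y + h * lag F y (h^-1 *: (x - y))) /\
    (forall y, `|x - y| <= A * h -> dval k.+1 x <= dval k y + h * lag F y (h^-1 *: (x - y))).
Proof.
move=> kt xk; have h0' := h0; have r0' := r0; have [K0 _ _ _ [_ L0]] := dp_pos dp.
have kt' : k%:R * h <= tau by move: kt; rewrite -natr1; lra.
apply: (@dstep_spec (dval k) (15 / 2 * r - k.+1%:R * (A * h)) (K + k%:R * h * L)) => //.
- rewrite lerD2l; apply: le_trans tauL; rewrite mulrC ler_wpM2l//.
- rewrite -natr1; have A2' := A2.
  have : 0 <= k%:R * (A * h) by rewrite !mulr_ge0 ?(ltW h0)//; lra.
  by lra.
- have -> : 15 / 2 * r - k.+1%:R * (A * h) + A * h = 15 / 2 * r - k%:R * (A * h).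
    by rewrite -natr1; ring.
  exact: dval_lipschitz.
Qed.

Fixpoint chain k y x (b : R) : Prop :=
  if k is k'.+1 then exists x1 b1, [/\ chain k' y x1 b1, cball a (8 * r) x1,
    cball a (8 * r) x, `|x - x1| <= A * h & b = b1 + h * lag F x1 (h^-1 *: (x - x1))]
  else y = x /\ b = 0.

Lemma dval_chain k y x b : k%:R * h <= tau -> dom k x -> chain k y x b ->
  dval k x <= u y + b.
Proof.
elim: k x b => [|k ih] x b kt xk /=; first by move=> [-> ->]; rewrite addr0.
move=> [x1 [b1 [c1 x1b xb xx1 ->]]].
have kt' : k%:R * h <= tau by move: kt; rewrite -natr1; have := h0; lra.
have [_ /(_ _ xx1)] := dval_spec kt xk.
by have := ih _ _ kt' (domS xk xx1) c1; lra.
Qed.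

Lemma chain_dist k y x b : chain k y x b -> `|x - y| <= k%:R * (A * h).
Proof.
elim: k x b => [|k ih] x b /=; first by move=> [-> _]; rewrite subrr normr0 mul0r.
move=> [x1 [b1 [c1 _ _ xx1 _]]]; rewrite -(subrK x1 x) -addrA.
by apply: le_trans (ler_normD _ _) _; have := ih _ _ c1; rewrite -natr1; lra.
Qed.

(** Fenchel's inequality with the fixed covector [s], summed over the steps; all points of the chain
    are within [d] of [x0], where [F (_, s)] is evaluated. *)
Lemma chain_lower (L' d : R) k y x b s x0 : nice_ham F a (8 * r) -> 0 <= L' ->
  (forall y1 y2, cball a (8 * r) y1 -> cball a (8 * r) y2 ->
    F (y1, s) <= F (y2, s) + L' * `|y1 - y2|) ->
  cball a (8 * r) x0 -> chain k y x b -> `|x - x0| + k%:R * (A * h) <= d ->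
  pairing s (x - y) - k%:R * h * (F (x0, s) + L' * d) <= b.
Proof.
move=> hF L'0 FL x0b; elim: k x b => [|k ih] x b /=.
  by move=> [-> ->] _; rewrite subrr pairing0r !mul0r subrr.
move=> [x1 [b1 [c1 x1b xb xx1 ->]]] xd.
have h0' := h0; have A2' := A2.
have d1 : `|x1 - x0| <= `|x - x0| + A * h.
  rewrite (_ : x1 - x0 = (x - x0) - (x - x1)); last by row_ring.
  by apply: le_trans (ler_normB _ _) _; rewrite lerD2l.
have kAh : 0 <= k%:R * (A * h) by rewrite !mulr_ge0 ?(ltW h0)//; lra.
have := ih _ _ c1 _; rewrite -natr1 in xd * => /(_ _)H1.
have {}H1 : pairing s (x1 - y) - k%:R * h * (F (x0, s) + L' * d) <= b1.
  by apply: H1; lra.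
have := lag_ge hF (h^-1 *: (x - x1)) s x1b; rewrite pairingZr => H2.
have H3 : F (x1, s) <= F (x0, s) + L' * d.
  apply: le_trans (FL _ _ x1b x0b) _; rewrite lerD2l ler_wpM2l//; lra.
have H4 : pairing s (x - x1) - h * (F (x0, s) + L' * d) <= h * lag F x1 (h^-1 *: (x - x1)).
  apply: (@le_trans _ _ (h * (h^-1 * pairing s (x - x1) - F (x1, s)))).
    rewrite mulrBr mulrA divff// mul1r lerD2l lerN2 ler_pM2l//.
  by rewrite ler_pM2l.
have -> : pairing s (x - y) = pairing s (x - x1) + pairing s (x1 - y).
  by rewrite -pairingDr addrA subrK.
by lra.
Qed.

(* Two-point semiconcavity: both ends of an optimal chain can be moved, the
   displacement being interpolated linearly along the chain. *)
Lemma dval_two_point (k : nat) (Fk : V * V -> R) : nice_ham F a (8 * r) ->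
  nice_ham Fk a (8 * r) -> h <= 1 ->
  (forall y q, cball a (8 * r) y -> pairing (gradx Fk (y, q)) (gradp F (y, q)) =
     pairing (gradp Fk (y, q)) (gradx F (y, q))) ->
  forall CK BF : R, 
  (forall y q y' q', cball a (8 * r) y -> `|q| <= R0 + BF -> cball a (8 * r) y' ->
      `|q'| <= R0 + BF ->
    `|Fk (y', q') - (Fk (y, q) + pairing (gradx Fk (y, q)) (y' - y)
                     + pairing (gradp Fk (y, q)) (q' - q))|
      <= CK * (`|y' - y| ^+ 2 + `|q' - q| ^+ 2)) ->
  0 <= CK -> 0 <= BF ->
  (forall y q, cball a (8 * r) y -> `|q| <= R0 -> `|gradx F (y, q)| <= BF) ->
  forall x, k.+1%:R * h <= tau -> dom k.+1 x ->
  exists y p q b, [/\ dval k.+1 x = u y + b, chain k.+1 y x b, `|p| <= R0,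
    forall z z' m, m <= r / 2 -> `|z| <= m -> `|z'| <= m -> `|z - z'| <= k.+1%:R * h ->
      exists2 b', chain k.+1 (y + z') (x + z) b' &
        b' <= b + pairing p z - pairing q z' + C * (`|z - z'| ^+ 2 / (k.+1%:R * h)
           + k.+1%:R * h * m ^+ 2) &
    `|Fk (x, p) - Fk (y, q)| <= k.+1%:R * (CK * (A ^+ 2 + BF ^+ 2) * 2 * h ^+ 2)].
Proof.
move=> hF hFk h1 poisson CK BF hCK CK0 BF0 hBF.
have h0' := h0; have A2' := A2; have r0' := r0.
have [K0 C00 C10 R00 [CC0 L0]] := dp_pos dp.
pose D := CK * (A ^+ 2 + BF ^+ 2) * 2 * h ^+ 2.
have inb8 x z : cball a (15 / 2 * r) x -> `|z| <= r / 2 -> cball a (8 * r) (x + z).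
  move=> xb zr; have -> : 8 * r = 15 / 2 * r + r / 2 by field.
  by apply: (step_in xb); rewrite opprD addrA subrr add0r normrN.
(* A symplectic Euler step changes [Fk] only at order [h ^ 2]: from [Fk (y, p)], the first-order
   increments to [Fk (x, p)] and to [Fk (y, q)] are equal by [poisson]. *)
have kf x y p : cball a (8 * r) x -> cball a (8 * r) y -> `|p| <= R0 ->
    `|x - y| <= A * h -> x - y = h *: gradp F (y, p) ->
    `|Fk (x, p) - Fk (y, p + h *: gradx F (y, p))| <= D.
  move=> xb yb pR xy xyE; have gx := hBF _ _ yb pR.
  have pR' : `|p| <= R0 + BF by lra.
  have qR' : `|p + h *: gradx F (y, p)| <= R0 + BF.
    apply: le_trans (ler_normD _ _) _; apply: lerD => //; rewrite normrZ gtr0_norm//.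
    by apply: le_trans gx; rewrite ler_piMl.
  have := hCK _ _ _ _ yb pR' xb pR'; rewrite subrr pairing0r normr0 expr0n addr0.
  have := hCK _ _ _ _ yb pR' yb qR'; rewrite subrr pairing0r normr0 expr0n addr0.
  rewrite (_ : p + _ - p = h *: gradx F (y, p)); last by row_ring.
  rewrite addr0 add0r xyE !pairingZr poisson//.
  pose X := CK * (A ^+ 2 + BF ^+ 2) * h ^+ 2.
  have n1 : CK * `|h *: gradx F (y, p)| ^+ 2 <= X.
    rewrite normrZ gtr0_norm// exprMn /X -mulrA ler_wpM2l// mulrC ler_wpM2r ?sqr_ge0//.
    have : `|gradx F (y, p)| ^+ 2 <= BF ^+ 2 by rewrite lerXn2r ?nnegrE.
    by have := sqr_ge0 A; goal_lra.
  have n2 : CK * `|h *: gradp F (y, p)| ^+ 2 <= X.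
    rewrite -xyE /X -mulrA ler_wpM2l//.
    have : `|x - y| ^+ 2 <= (A * h) ^+ 2 by rewrite lerXn2r ?nnegrE// mulr_ge0; lra.
    rewrite exprMn mulrDl; have := mulr_ge0 (sqr_ge0 BF) (sqr_ge0 h); goal_lra.
  have -> : D = 2 * X by rewrite /D /X; ring.
  move: n1 n2; move: (Fk _) (Fk _) (Fk _) => f1 f2 f3; move: (pairing _ _) => e.
  move: (CK * _ ^+ 2) (CK * _ ^+ 2) => e1 e2 n1 n2; rewrite !ler_norml.
  by move=> /andP[? ?] /andP[? ?]; apply/andP; split; lra.
elim: k => [|k ih] x kt xk.
  have [[y xy dE] _] := dval_spec kt xk.
  have xyA := le_trans xy (ler_wpM2r (ltW h0) A2le).
  have yk := domS xk xyA; have yb := dom_sub8 yk; have xb := dom_sub8 xk.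
  have [p [pR xyE H]] := step_expand yb xy.
  exists y, p, (p + h *: gradx F (y, p)), (h * lag F y (h^-1 *: (x - y))).
  rewrite mul1r; split=> //.
  - by exists y, 0; split=> //; rewrite add0r.
  - move=> z z' m mr zm z'm zz.
    have yb' : cball a (8 * r) (y + z').
      by apply: inb8; [exact: dom_sub yk|exact: le_trans mr].
    exists (h * lag F (y + z') (h^-1 *: (x + z - (y + z')))).
      exists (y + z'), 0; split=> //; rewrite ?add0r//.
        by apply: inb8; [exact: dom_sub xk|exact: le_trans mr].
      rewrite (_ : x + z - (y + z') = (x - y) + (z - z')); last by row_ring.
      apply: le_trans (ler_normD _ _) _; rewrite Ah_split -addrA lerD// (le_trans zz)// lerDl.
      exact: ltW.
    apply: le_trans (H _ _ zz yb') _; rewrite lerD2l ler_wpM2l// lerD2l ler_wpM2l ?(ltW h0)//.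
    by rewrite lerXn2r ?nnegrE// (le_trans _ z'm).
  - by rewrite [leRHS]mul1r; exact: kf.
have kt' : k.+1%:R * h <= tau by move: kt; rewrite -(natr1 k.+1) => *; lra.
have [[x1 xx1 dE] dle] := dval_spec kt xk.
have xx1A := le_trans xx1 (ler_wpM2r (ltW h0) A2le).
have x1k := domS xk xx1A; have x1b := dom_sub8 x1k; have xb := dom_sub8 xk.
have [p [pR xyE H]] := step_expand x1b xx1; set q1 := p + _ in H.
have [y [p2 [q [b [vE ch p2R H2 kfE]]]]] := ih _ kt' x1k.
have kh0 : 0 < k.+1%:R * h by rewrite mulr_gt0.
(* Discrete Euler-Lagrange equation. Moving the junction [x1] by [t *: w] with both ends kept cannot
   lower the cost, so the final momentum of the chain to [x1] is the initial momentum of the last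
   step. *)
have pq : p2 = q1.
  suff key w : pairing (q1 - p2) w <= 0.
    apply/esym/eqP; rewrite -subr_eq0; apply/eqP; apply: pairing_eq => w.
    apply/eqP; rewrite pairing0l eq_le key/= -oppr_le0 -pairingNr; exact: key.
  pose t0 := Num.min h (r / 2) / (1 + `|w|).
  have w1 : 0 < 1 + `|w| by rewrite ltr_pwDl.
  have t00 : 0 < t0 by rewrite divr_gt0// lt_min h0 divr_gt0.
  pose C' := C * `|w| ^+ 2 * ((h^-1 + h) + ((k.+1%:R * h)^-1 + k.+1%:R * h)).
  apply: (@le0_of_small _ _ C' t0) => // t tpos tt0.
  have tw : `|t *: w| = t * `|w| by rewrite normrZ gtr0_norm.
  have twm : `|t *: w| <= Num.min h (r / 2).
    rewrite tw; apply: (@le_trans _ _ (t * (1 + `|w|))).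
      by rewrite ler_wpM2l ?(ltW tpos)// lerDr.
    by rewrite -ler_pdivlMr.
  have [twh twr] : `|t *: w| <= h /\ `|t *: w| <= r / 2.
    by move: twm; rewrite le_min => /andP.
  have e0 : x + 0 - (x1 + t *: w) = x - (x1 + t *: w) by rewrite addr0.
  have sx : `|x - (x1 + t *: w)| <= A * h.
    rewrite (_ : x - (x1 + t *: w) = (x - x1) - t *: w); last by row_ring.
    apply: le_trans (ler_normB _ _) _; rewrite Ah_split -addrA lerD// (le_trans twh)// lerDl.
    exact: ltW.
  have := H 0 (t *: w); rewrite sub0r normrN e0 => /(_ twh (inb8 _ _ (dom_sub x1k) twr)) H3.
  have := dle _ sx => H4.
  have := H2 (t *: w) 0 `|t *: w|; rewrite normr0 subr0 => -[] //.
  + by apply: le_trans twh _; rewrite -natr1 mulrDl mul1r lerDr mulr_ge0// ltW.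
  move=> b'; rewrite addr0 => ch' b'le.
  have H5 := dval_chain kt' (domS xk sx) ch'.
  move: H3 b'le; rewrite !pairing0r !addr0 !tw !pairingZr => H3 b'le.
  rewrite -(ler_pM2r tpos) (mulrC _ t) pairingBl.
  have -> : C' * t * t = C * ((t * `|w|) ^+ 2 / h + h * (t * `|w|) ^+ 2) +
     C * ((t * `|w|) ^+ 2 / (k.+1%:R * h) + k.+1%:R * h * (t * `|w|) ^+ 2).
    by rewrite /C'; ring.
  move: H3 H4 H5 b'le dE vE.
  move: (dval _ _) (dval _ _) (dval _ _) (lag _ _ _) (lag _ _ _) (C * _) (C * _).
  by move: (pairing _ _) (pairing _ _) (u y) ; goal_lra.
exists y, p, q, (b + h * lag F x1 (h^-1 *: (x - x1))); split=> //.
- by rewrite dE vE addrA.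
- by exists x1, b.
- have k10 : 0 < k.+1%:R :> R by rewrite ltr0n.
  have k2E : k.+2%:R = k.+1%:R + 1 :> R by rewrite -(natr1 k.+1).
  move=> z z' m mr zm z'm; rewrite k2E; move: {k2E kfE kt' kt} k10 kh0 H2.
  move: (k.+1%:R : R) => k1 k10 kh0 H2 zz.
  (* The junction is displaced in proportion to the elapsed time; the quadratic costs of the two
     parts then add up exactly, which is [E1]. *)
  pose z1 := z' + (k1 / (k1 + 1)) *: (z - z').
  have k1p : 0 < k1 + 1 by rewrite addr_gt0.
  have k1n : k1 + 1 != 0 by rewrite gt_eqF.
  have d1 : z - z1 = (k1 + 1)^-1 *: (z - z').
    apply/rowP => i; rewrite !mxE; field; exact: k1n.
  have d2 : z1 - z' = (k1 / (k1 + 1)) *: (z - z') by row_ring.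
  have n1 : `|z - z1| = `|z - z'| / (k1 + 1).
    by rewrite d1 normrZ gtr0_norm ?invr_gt0// mulrC.
  have n2 : `|z1 - z'| = k1 / (k1 + 1) * `|z - z'|.
    by rewrite d2 normrZ gtr0_norm// divr_gt0.
  have zzk : `|z - z'| / (k1 + 1) <= h by rewrite ler_pdivrMr// mulrC.
  have z1m : `|z1| <= m.
    have -> : z1 = (1 - k1 / (k1 + 1)) *: z' + (k1 / (k1 + 1)) *: z by row_ring.
    have f0 : 0 <= k1 / (k1 + 1) by rewrite divr_ge0// ltW.
    have f1 : k1 / (k1 + 1) <= 1 by rewrite ler_pdivrMr// mul1r lerDl.
    apply: le_trans (ler_normD _ _) _; rewrite (normrZ _ z') (normrZ _ z) (ger0_norm f0) ger0_norm
      ?subr_ge0//.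
    have m1 : (1 - k1 / (k1 + 1)) * `|z'| <= (1 - k1 / (k1 + 1)) * m.
      by rewrite ler_wpM2l ?subr_ge0.
    have m2 : (k1 / (k1 + 1)) * `|z| <= (k1 / (k1 + 1)) * m by rewrite ler_wpM2l.
    by apply: le_trans (lerD m1 m2) _; rewrite -mulrDl subrK mul1r.
  have z1r := le_trans z1m mr.
  have [|b' ch' b'le] := H2 z1 z' m mr z1m z'm.
    by rewrite n2 mulrAC -mulrA ler_wpM2l// ltW.
  have := H z z1; rewrite n1 => /(_ zzk (inb8 _ _ (dom_sub x1k) z1r)) Hs.
  exists (b' + h * lag F (x1 + z1) (h^-1 *: (x + z - (x1 + z1)))).
    exists (x1 + z1), b'; split=> //.
    + by apply: inb8 => //; exact: dom_sub x1k.
    + by apply: inb8; [exact: dom_sub xk|exact: le_trans mr].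
    rewrite (_ : x + z - (x1 + z1) = (x - x1) + (z - z1)); last by row_ring.
    apply: le_trans (ler_normD _ _) _; rewrite n1 Ah_split -addrA lerD// (le_trans zzk)// lerDl.
    exact: ltW.
  have E1 : C * (`|z - z'| ^+ 2 / ((k1 + 1) * h)) =
    C * ((`|z - z'| / (k1 + 1)) ^+ 2 / h) + C * ((k1 / (k1 + 1) * `|z - z'|) ^+ 2 / (k1 * h)).
    by field; rewrite k1n hn0 gt_eqF.
  have s1 : C * (h * `|z1| ^+ 2) <= C * (h * m ^+ 2).
    by rewrite ler_wpM2l// ler_wpM2l ?(ltW h0)// lerXn2r ?nnegrE// (le_trans _ z1m).
  move: b'le Hs; rewrite n2 pq !mulrDr E1.
  have -> : C * ((k1 + 1) * h * m ^+ 2) = C * (k1 * h * m ^+ 2) + C * (h * m ^+ 2) by ring.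
  move: s1; move: (lag F _ _) (lag F _ _) (C * _) (C * _) (C * _) (C * _) (C * _).
  by move: (pairing _ _) (pairing _ _) (pairing _ _) ; goal_lra.
- apply: le_trans (_ : `|Fk (x, p) - Fk (x1, q1)| + `|Fk (x1, p2) - Fk (y, q)| <= _).
    by rewrite pq; apply: le_trans (ler_normD _ _); rewrite addrA subrK.
  rewrite -[in X in _ <= X]natr1 mulrDl mul1r addrC; apply: lerD => //; exact: kf.
Qed.

End dp.
End discrete_dynamics.

(** * Changes of charts and their action on vectors, covectors and one-sided gradients *)

Section chart_calculus.
Context {R : realType} {n : nat} {M : topologicalType} (X : C2_manifold R n M).
Local Notation V := 'rV[R]_n.
Implicit Types (c : chart R n M) (x : M) (y q v w p : V).

Lemma chart_inv_dom c y : chart_cod c y -> chart_dom c (chart_inv c y).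
Proof. by move=> [x xd <-]; rewrite chart_mapK. Qed.

Lemma chart_invK c y : chart_cod c y -> c (chart_inv c y) = y.
Proof. by move=> [x xd <-]; rewrite chart_mapK. Qed.

Lemma chart_map_cod c x : chart_dom c x -> chart_cod c (c x).
Proof. by exists x. Qed.

Lemma chart_map_cvg c x : chart_dom c x -> {for x, continuous c}.
Proof.
move=> xd; have := @chart_map_continuous _ _ _ c.
by rewrite (continuous_open_subspace _ (open_chart_dom c)); apply; exact/mem_set.
Qed.

Lemma chart_inv_cvg c y : chart_cod c y -> {for y, continuous (chart_inv c)}.
Proof.
move=> yc; have := @chart_inv_continuous _ _ _ c.
have oc : open (chart_cod c) by exact: (@open_chart_cod _ _ _ c).
by rewrite -/(chart_cod c) (continuous_open_subspace _ oc); apply; exact/mem_set.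
Qed.

Lemma near_chart_inv c x (U : set M) : chart_dom c x -> open U -> U x ->
  \forall y \near (c x), chart_cod c y /\ U (chart_inv c y).
Proof.
move=> xd oU Ux.
have cy : \forall y \near (c x), chart_cod c y.
  have oc : open (chart_cod c) by exact: (@open_chart_cod _ _ _ c).
  by have := chart_map_cod xd; exact: oc.
have Uy : \forall y \near (c x), U (chart_inv c y).
  apply: (chart_inv_cvg (chart_map_cod xd)).
  by rewrite chart_mapK//; apply: open_nbhs_nbhs.
by near=> y; split; near: y.
Unshelve. all: by end_near. Qed.

(* Locked so that unification does not unfold the jacobian. *)
Definition trans c c' x : 'M[R]_n := locked ('J (c' \o chart_inv c) (c x)).

Lemma trans_differentiable c c' x : atlas X c -> atlas X c' ->
  chart_dom c x -> chart_dom c' x -> differentiable (c' \o chart_inv c) (c x).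
Proof. by move=> ac ac' xc xc'; apply: (atlas_C2 ac ac').1; exists x. Qed.

Lemma trans_derive c c' x v : atlas X c -> atlas X c' ->
  chart_dom c x -> chart_dom c' x -> 'D_v (c' \o chart_inv c) (c x) = v *m trans c c' x.
Proof. by move=> *; rewrite /trans -lock deriveEjacobian//; exact: trans_differentiable. Qed.

Lemma trans_diff c c' x v : atlas X c -> atlas X c' ->
  chart_dom c x -> chart_dom c' x -> 'd (c' \o chart_inv c) (c x) v = v *m trans c c' x.
Proof.
move=> ac ac' xc xc'.
by rewrite -(deriveE v (trans_differentiable ac ac' xc xc')) trans_derive.
Qed.

Lemma mulmx_row_eq (A B : 'M[R]_n) : (forall v : V, v *m A = v *m B) -> A = B.
Proof. by move=> H; apply/row_matrixP => i; rewrite !rowE. Qed.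

(** The chain rule; vectors being rows, the composition reads from left to right. *)
Lemma trans_comp c c' c'' x : atlas X c -> atlas X c' -> atlas X c'' ->
  chart_dom c x -> chart_dom c' x -> chart_dom c'' x ->
  trans c c' x *m trans c' c'' x = trans c c'' x.
Proof.
move=> ac ac' ac'' xc xc' xc''; apply: mulmx_row_eq => v.
rewrite -(trans_derive v ac ac'')// mulmxA.
have near_eq : \forall y \near (c x), ((c'' \o chart_inv c') \o (c' \o chart_inv c)) y
    = (c'' \o chart_inv c) y.
  apply: filterS (near_chart_inv xc (open_chart_dom c') xc') => y [yc yc'] /=.
  by rewrite chart_mapK.
rewrite -(near_eq_derive v near_eq).
have e : (c' \o chart_inv c) (c x) = c' x by rewrite /= chart_mapK.
have d1 := trans_differentiable ac ac' xc xc'.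
have d2 : differentiable (c'' \o chart_inv c') ((c' \o chart_inv c) (c x)).
  by rewrite e; exact: trans_differentiable.
rewrite (deriveE v (differentiable_comp d1 d2)) (diff_comp d1 d2) /=.
rewrite -(trans_diff v ac ac' xc xc').
have -> : c' (chart_inv c (c x)) = c' x by rewrite chart_mapK.
exact/esym/trans_diff.
Qed.

Lemma trans_id c x : atlas X c -> chart_dom c x -> trans c c x = 1%:M.
Proof.
move=> ac xc; apply: mulmx_row_eq => v; rewrite -(trans_derive v ac ac)// mulmx1.
have near_eq : \forall y \near (c x), (c \o chart_inv c) y = id y.
  apply: filterS (near_chart_inv xc (open_chart_dom c) xc) => y [yc _] /=.
  by rewrite chart_invK.
by rewrite (near_eq_derive v near_eq) derive_id.
Qed.

Lemma trans_inv c c' x : atlas X c -> atlas X c' -> chart_dom c x -> chart_dom c' x ->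
  trans c c' x *m trans c' c x = 1%:M.
Proof. by move=> *; rewrite trans_comp// trans_id. Qed.

Lemma pairing_mul q v (B : 'M[R]_n) : pairing (q *m B^T) v = pairing q (v *m B).
Proof.
have E (s t : V) : pairing s t = (s *m t^T) 0 0.
  by rewrite mxE; apply: eq_bigr => i _; rewrite mxE.
by rewrite !E -mulmxA trmx_mul.
Qed.

Lemma in_chartE (H : cotangent_bundle X -> R) c x q : chart_dom c x ->
  in_chart H c (c x, q) = H (x, q *m (trans (chart_at X x) c x)^T).
Proof. by move=> xc; rewrite /in_chart /cotangent_of_chart/= chart_mapK// /trans -lock. Qed.

Lemma in_chart_trans (H : cotangent_bundle X -> R) c c' x q :
  atlas X c -> atlas X c' -> chart_dom c x -> chart_dom c' x ->
  in_chart H c (c x, q) = in_chart H c' (c' x, q *m (trans c' c x)^T).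
Proof.
move=> ac ac' xc xc'; rewrite (in_chartE H q xc) (in_chartE H _ xc') -mulmxA -trmx_mul.
by rewrite (trans_comp (chart_at_atlas X x) ac' ac (chart_at_dom X x) xc' xc).
Qed.

(** Vectors and covectors transform contragrediently, so the pairing is invariant and the change of
    chart merely reindexes the supremum. *)
Lemma lagrangian_in_chart (H : cotangent_bundle X -> R) c x w : atlas X c -> chart_dom c x ->
  lag (in_chart H c) (c x) w = lagrangian H (x, w *m trans c (chart_at X x) x).
Proof.
move=> ac xc; rewrite /lag /lagrangian; congr sup; apply/seteqP.
have a0 := chart_at_atlas X x; have d0 := chart_at_dom X x.
set c0 := chart_at X x in a0 d0 *.
split=> _ [q _ <-] /=.
  exists (q *m (trans c0 c x)^T); first exact: I.
  by rewrite pairing_mul -mulmxA (trans_inv ac a0 xc d0) mulmx1 (in_chartE H q xc).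
exists (q *m (trans c c0 x)^T); first exact: I.
rewrite pairing_mul (in_chartE H _ xc); congr (_ - H (_, _)).
by rewrite -mulmxA -trmx_mul (trans_inv a0 ac d0 xc) trmx1 mulmx1.
Qed.

Lemma velocity_in_chart (gamma : R -> M) (t : R) c w : atlas X c ->
  {for t, continuous gamma} -> chart_dom c (gamma t) ->
  is_derive t 1 (c \o gamma : R -> V) w ->
  velocity X gamma t = w *m trans c (chart_at X (gamma t)) (gamma t).
Proof.
move=> ac cg xc dg; rewrite /velocity.
have a0 := chart_at_atlas X (gamma t); have d0 := chart_at_dom X (gamma t).
set c0 := chart_at X (gamma t) in a0 d0 *.
have near_eq : \forall s \near t, ((c0 \o chart_inv c) \o (c \o gamma)) s = (c0 \o gamma) s.
  have : \forall s \near t, chart_dom c (gamma s).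
    by apply: cg; apply: open_nbhs_nbhs; split=> //; exact: open_chart_dom.
  by apply: filterS => s sc /=; rewrite chart_mapK.
rewrite derive1E -(near_eq_derive (1 : R) near_eq).
have d1 : differentiable (c \o gamma : R -> V) t.
  by apply/derivable1_diffP; case: dg.
have d2 : differentiable (c0 \o chart_inv c) ((c \o gamma) t).
  exact: trans_differentiable.
rewrite (deriveE (1 : R) (differentiable_comp d1 d2)) (diff_comp d1 d2) /=.
have -> : 'd (c \o gamma : R -> V) t 1 = w by rewrite -deriveE//; case: dg.
by rewrite (trans_diff _ ac a0 xc d0).
Qed.

Lemma lagrangian_velocity (H : cotangent_bundle X -> R) (gamma : R -> M) (t : R) c w :
  atlas X c -> {for t, continuous gamma} -> chart_dom c (gamma t) ->
  is_derive t 1 (c \o gamma : R -> V) w ->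
  lagrangian H (gamma t, velocity X gamma t) = lag (in_chart H c) (c (gamma t)) w.
Proof.
by move=> ac cg xc dg; rewrite (velocity_in_chart ac cg xc dg) lagrangian_in_chart.
Qed.

(* A subgradient read in one chart and a supergradient read in another one are
   the same covector. *)
Lemma sub_super_gradient (v : M -> R) c c' x q p (C e : R) :
  atlas X c -> atlas X c' -> chart_dom c x -> chart_dom c' x -> 0 < e ->
  (forall z, `|z| <= e -> v x + pairing q z - C * `|z| ^+ 2 <= v (chart_inv c (c x + z))) ->
  (forall z, `|z| <= e -> v (chart_inv c' (c' x + z)) <= v x + pairing p z + C * `|z| ^+ 2) ->
  p = q *m (trans c' c x)^T.
Proof.
move=> ac ac' xc xc' e0 sub sup.
have key w : pairing (q *m (trans c' c x)^T - p) w <= 0.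
  rewrite pairingBl pairing_mul.
  have dt := trans_differentiable ac' ac xc' xc.
  have /cvg_ex[/= l lim] := diff_derivable (v := w) dt.
  have lE : l = w *m trans c' c x.
    by rewrite -trans_derive//; apply/esym; apply: cvg_lim lim.
  have e0' : (c \o chart_inv c') (c' x) = c x by rewrite /= chart_mapK.
  rewrite /= chart_mapK// in lim.
  rewrite leNgt; apply/negP => pos; set D := pairing q _ - _ in pos.
  (* [Z t] is the displacement seen in [c] when the point moves by [t *: w] in [c']; it is [t *: l]
     up to [o(t)]. Comparing the two bounds on [v] at this point and dividing by [t] contradicts
     [D > 0]. *)
  pose Z (t : R) : V := c (chart_inv c' (t *: w + c' x)) - c x.
  have limZ : (fun t => t^-1 *: Z t) @ 0^' --> l by [].
  pose B := `|l| + 1.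
  have B0 : 0 < B by rewrite ltr_pwDr.
  pose eta := Num.min 1 (D / (4 * (n%:R * `|q| + 1))).
  have nq0 : 0 < n%:R * `|q| + 1 by rewrite ltr_pwDr// mulr_ge0.
  have eta0 : 0 < eta by rewrite lt_min ltr01 divr_gt0// mulr_gt0.
  pose C' := `|C| + 1; have C'0 : 0 < C' by rewrite ltr_pwDr.
  pose S := C' * (B ^+ 2 + `|w| ^+ 2) + 1.
  have S0 : 0 < S by rewrite ltr_pwDr// mulr_ge0 ?(ltW C'0)// addr_ge0 ?sqr_ge0.
  have lim' := cvg_dnbhs_at_right limZ.
  have ptc : \forall t \near (0 : R)^'+, chart_dom c (chart_inv c' (t *: w + c' x)).
    have limt : (fun t : R => t *: w + c' x) @ (0:R)^'+ --> c' x.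
      rewrite -[X in _ --> X]add0r -(scale0r w); apply: cvg_at_right_filter.
      by apply: cvgD; [apply: cvgZr_tmp; exact: cvg_id|exact: cvg_cst].
    have nb := near_chart_inv xc' (@open_chart_dom _ _ _ c) xc.
    have h : \forall t \near (0 : R)^'+, chart_cod c' (t *: w + c' x) /\
      chart_dom c (chart_inv c' (t *: w + c' x)) by exact: limt _ nb.
    by apply: filterS h => t [].
  near (0 : R)^'+ => t.
  have t0 : 0 < t by near: t; exact: nbhs_right_gt.
  have tS : t * S <= D / 2.
    rewrite -ler_pdivlMr//; near: t; apply: nbhs_right_le; rewrite !divr_gt0//.
  have tB : t * B <= e.
    by rewrite -ler_pdivlMr//; near: t; apply: nbhs_right_le; rewrite divr_gt0.
  have tw : t * `|w| <= e.
    apply: (@le_trans _ _ (t * (`|w| + 1))); first by rewrite ler_wpM2l ?(ltW t0)// lerDl.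
    by rewrite -ler_pdivlMr ?ltr_pwDr//; near: t; apply: nbhs_right_le; rewrite divr_gt0// ltr_pwDr.
  have Zt1 : `|l - t^-1 *: Z t| <= eta.
    by near: t; exact: cvgr_dist_le lim' _ eta0.
  have pt : chart_dom c (chart_inv c' (t *: w + c' x)) by near: t.
  have tn : t != 0 by rewrite gt_eqF.
  have ptE : chart_inv c (c x + Z t) = chart_inv c' (c' x + t *: w).
    by rewrite /Z addrC subrK chart_mapK// addrC.
  have Zle : `|t^-1 *: Z t| <= B.
    rewrite -[t^-1 *: Z t](subKr l); apply: le_trans (ler_normB _ _) _.
    by rewrite lerD2l (le_trans Zt1)// ge_min lexx.
  have ZE : Z t = t *: (t^-1 *: Z t) by rewrite scalerA divff// scale1r.
  have Ztb : `|Z t| <= t * B by rewrite ZE normrZ gtr0_norm// ler_wpM2l// ltW.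
  have h1 := sub (Z t) (le_trans Ztb tB).
  have h2 := sup (t *: w); rewrite normrZ gtr0_norm// in h2.
  have {}h2 := h2 tw; rewrite ptE in h1; have {h1 h2} := le_trans h1 h2.
  rewrite pairingZr {1}ZE pairingZr.
  have h3 : pairing q l - n%:R * `|q| * eta <= pairing q (t^-1 *: Z t).
    have -> : t^-1 *: Z t = l - (l - t^-1 *: Z t) by rewrite subKr.
    rewrite pairingBr lerD2l lerN2; apply: le_trans (pairing_ler _ _) _.
    by rewrite ler_wpM2l// mulr_ge0.
  have h4 : n%:R * `|q| * eta <= D / 4.
    apply: (@le_trans _ _ ((n%:R * `|q| + 1) * (D / (4 * (n%:R * `|q| + 1))))).
      apply: ler_pM; rewrite ?mulr_ge0 ?(ltW eta0)//; first by rewrite lerDl.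
      by rewrite ge_min lexx orbT.
    by rewrite le_eqVlt; apply/orP; left; apply/eqP; field; rewrite gt_eqF.
  have h5 : C * `|Z t| ^+ 2 <= t * (t * (C' * B ^+ 2)).
    apply: (@le_trans _ _ (C' * (t * B) ^+ 2)); last by rewrite exprMn !expr2; goal_lra.
    apply: (@le_trans _ _ (C' * `|Z t| ^+ 2)).
      by rewrite ler_wpM2r ?sqr_ge0// /C' ler_wpDr// ler_norm.
    by rewrite ler_wpM2l ?(ltW C'0)// lerXn2r ?nnegrE// (le_trans _ Ztb).
  have h6 : C * (t * `|w|) ^+ 2 <= t * (t * (C' * `|w| ^+ 2)).
    apply: (@le_trans _ _ (C' * (t * `|w|) ^+ 2)); last by rewrite exprMn !expr2; goal_lra.
    by rewrite ler_wpM2r ?sqr_ge0// /C' ler_wpDr// ler_norm.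
  have h7 : t * (C' * B ^+ 2 + C' * `|w| ^+ 2) <= D / 2.
    apply: le_trans tS; rewrite ler_wpM2l ?(ltW t0)// /S -mulrDr lerDl//.
  have DE : D = pairing q l - pairing p w by rewrite /D lE.
  move=> h8.
  have : t * (pairing q l - n%:R * `|q| * eta - pairing p w - t * (C' * B ^+ 2 + C' * `|w| ^+ 2)) <= 0.
    have : t * (pairing q l - n%:R * `|q| * eta) <= t * pairing q (t^-1 *: Z t).
      by rewrite ler_wpM2l// ltW.
    move: h8 h5 h6; move: (C * _) (C * _) (pairing q (_ *: _)) (v x) (pairing p w).
    move: (n%:R * _ * _) (C' * _) (C' * _) ; goal_lra.
  by rewrite pmulr_rle0//; move: h4 h7; lra.
apply/esym/eqP; rewrite -subr_eq0; apply/eqP; apply: pairing_eq => w.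
by apply/eqP; rewrite pairing0l eq_le key/= -oppr_le0 -pairingNr key.
Unshelve. all: by end_near. Qed.

End chart_calculus.

(** * Tonelli Hamiltonians, the metric and the Poisson bracket in charts *)

Section tonelli_in_charts.
Context {R : realType} {n : nat} {M : topologicalType} (X : C2_manifold R n M).
Context (g : riemannian_metric X).
Local Notation V := 'rV[R]_n.
Implicit Types (c : chart R n M) (x : M) (y q v w p : V).

Lemma sphere_compact : compact [set v : V | `|v| = 1].
Proof.
apply: (@subclosed_compact _ _ (cball 0 1)); last 2 first.
- exact: cball_compact.
- by move=> q; rewrite /cball/= subr0 => ->.
rewrite (_ : [set v | _] = (fun y : V => `|y|) @^-1` [set 1])//.
apply: closed_comp; last exact: closed_eq.
by move=> y _; exact: (@norm_continuous R V).
Qed.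

Lemma metric0 x w : g x 0 w = 0.
Proof.
by have := metric_linear g x 1 0 0 w; rewrite scaler0 addr0 mul1r; lra.
Qed.

Lemma metricZ x a v w : g x (a *: v) w = a * g x v w.
Proof. by rewrite -[a *: v]addr0 metric_linear metric0 addr0. Qed.

Lemma metric_sum x (I : finType) (f : I -> V) w : g x (\sum_i f i) w = \sum_i g x (f i) w.
Proof.
elim/big_rec2 : _ => [|i y1 y2 _ <-]; first exact: metric0.
by rewrite -[f i]scale1r metric_linear mul1r scale1r.
Qed.

Lemma metric_expand x (f : V -> V) v : (forall a u w, f (a *: u + w) = a *: f u + f w) ->
  g x (f v) (f v) = \sum_i \sum_j v 0 i * v 0 j * g x (f (delta_mx 0 i)) (f (delta_mx 0 j)).
Proof.
move=> lf; have f0 : f 0 = 0.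
  by have := lf (-1) 0 0; rewrite scaler0 addr0 scaleN1r addNr.
have fs : f v = \sum_i v 0 i *: f (delta_mx 0 i).
  rewrite {1}(row_sum_delta v).
  elim/big_rec2 : _ => // i y1 y2 _ <-; exact: lf.
rewrite {1}fs metric_sum; apply: eq_bigr => i _.
rewrite metricZ metric_sym fs metric_sum mulr_sumr; apply: eq_bigr => j _.
by rewrite metricZ metric_sym mulrA.
Qed.

Lemma metric_lower x : exists2 m : R, 0 < m & forall v, m * `|v| ^+ 2 <= g x v v.
Proof.
have [v vS|v vS|m m0 mP] := compact_pos_lower (f := fun v => g x v v) sphere_compact.
- rewrite (_ : (fun v => g x v v) = (fun v => \sum_i \sum_j v 0 i * v 0 j
      * g x (delta_mx 0 i) (delta_mx 0 j))); last first.
    by apply/funext => w; rewrite (@metric_expand x id).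
  apply: cont_sum => i; apply: cont_sum => j.
  apply: continuousM; last exact: cst_continuous.
  by apply: continuousM; exact: coord_continuous.
- by apply: metric_pos; rewrite -normr_eq0 vS oner_eq0.
exists m => // v; have [->|v0] := eqVneq v 0; first by rewrite normr0 expr0n mulr0 metric0.
have nv : 0 < `|v| by rewrite normr_gt0.
have := mP (`|v|^-1 *: v); rewrite /= normrZ normfV normr_id mulVf ?gt_eqF// => /(_ erefl).
rewrite metricZ metric_sym metricZ => h.
have -> : g x v v = `|v| ^+ 2 * (`|v|^-1 * (`|v|^-1 * g x v v)) by field; rewrite gt_eqF.
by rewrite mulrC ler_wpM2l// sqr_ge0.
Qed.

(** The supremum defining the dual norm has to be finite; positive definiteness of the metric at the
    base point, in the form of [metric_lower], bounds the unit ball. *)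
Lemma cotangent_norm_ge (z : cotangent_bundle X) v : tangent_norm g (z.1, v) <= 1 ->
  pairing z.2 v <= cotangent_norm g z.
Proof.
move=> tv; apply: sup_upper_bound; last by exists v.
split; first by exists (pairing z.2 v), v.
have [m m0 mP] := metric_lower z.1; have sm : 0 < Num.sqrt m by rewrite sqrtr_gt0.
exists (n%:R * `|z.2| / Num.sqrt m) => _ [w /= tw <-].
rewrite ler_pdivlMr//; apply: le_trans (_ : n%:R * `|z.2| * `|w| * Num.sqrt m <= _).
  by rewrite ler_wpM2r ?(ltW sm)// pairing_ler.
rewrite -mulrA ler_piMr ?mulr_ge0//.
apply: le_trans tw; rewrite /tangent_norm/=.
rewrite -[`|w|]ger0_norm// -sqrtr_sqr -sqrtrM ?sqr_ge0// ler_sqrt.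
  by rewrite mulrC mP.
by apply: le_trans (mP w); rewrite mulr_ge0 ?sqr_ge0// ltW.
Qed.

Lemma tangent_of_chart_trans c y w : atlas X c -> chart_cod c y ->
  (tangent_of_chart X c (y, w)).2
    = w *m trans c (chart_at X (chart_inv c y)) (chart_inv c y).
Proof.
move=> ac [x xc <-]; rewrite /tangent_of_chart/= chart_mapK//.
exact: (trans_diff w ac (chart_at_atlas X x) xc (chart_at_dom X x)).
Qed.

Lemma cotangent_of_chart_trans c y q : atlas X c -> chart_cod c y ->
  cotangent_of_chart X c (y, q) = (chart_inv c y,
    q *m (trans (chart_at X (chart_inv c y)) c (chart_inv c y))^T).
Proof. by move=> ac yc; rewrite /cotangent_of_chart /trans -lock. Qed.

(** The metric coefficients are bounded on the ball, so vectors of small coordinate norm [k] have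
    Riemannian norm at most 1 and compete in the dual norm; one of them is aligned with [q]. *)
Lemma cotangent_norm_lower c a rho : atlas X c -> cball a rho `<=` chart_cod c ->
  exists2 k : R, 0 < k & forall y q, cball a rho y ->
    k * `|q| <= cotangent_norm g (cotangent_of_chart X c (y, q)).
Proof.
move=> ac sub; pose tg y w := (tangent_of_chart X c (y, w)).2.
pose G i j y := g (chart_inv c y) (tg y (delta_mx 0 i)) (tg y (delta_mx 0 j)).
have [|i|B B0 BP] := @finite_max R n (fun i B => forall j y, cball a rho y -> `|G i j y| <= B).
- by move=> i u v uv h j y yb; exact: le_trans (h j y yb) uv.
- have [|j|B B0 BP] := @finite_max R n (fun j B => forall y, cball a rho y -> `|G i j y| <= B).
  + by move=> j u v uv h y yb; exact: le_trans (h y yb) uv.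
  + have [y yb|B B0 BP] := compact_bounded (f := G i j) (@cball_compact R n a rho).
      have [dG _] := metric_C1 g ac (delta_mx 0 i) (delta_mx 0 j).
      by apply: differentiable_continuous; apply: dG; exact: sub.
    by exists B.
  + by exists B.
pose k := (n%:R * n%:R * B + 1)^-1.
have k0 : 0 < k by rewrite invr_gt0 ltr_pwDr// !mulr_ge0.
have k1 : k <= 1 by rewrite invf_le1 ?ltr_pwDr ?mulr_ge0// lerDr !mulr_ge0.
exists k => // y q yb; have yc := sub _ yb.
have [w wk wq] := exists_aligned q (ltW k0).
set z := cotangent_of_chart X c (y, q).
apply: le_trans wq _; rewrite pairingC.
have -> : pairing q w = pairing z.2 (tg y w).
  rewrite /z cotangent_of_chart_trans//= /tg tangent_of_chart_trans//.
  set x := chart_inv c y; have xc : chart_dom c x by exact: chart_inv_dom.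
  by rewrite pairing_mul -mulmxA
    (trans_inv ac (chart_at_atlas X x) xc (chart_at_dom X x)) mulmx1.
apply: cotangent_norm_ge; rewrite /tangent_norm/=.
rewrite -[leRHS](@sqrtr1 R) ler_sqrt//.
have -> : g (chart_inv c y) (tg y w) (tg y w) =
    \sum_i \sum_j w 0 i * w 0 j * G i j y.
  by apply: metric_expand => s u v; rewrite /tg/= linearP.
apply: le_trans (ler_norm _) _; apply: le_trans (ler_norm_sum _ _ _) _.
apply: (@le_trans _ _ (\sum_(i < n) \sum_(j < n) k * k * B)).
  apply: ler_sum => i _; apply: le_trans (ler_norm_sum _ _ _) _.
  apply: ler_sum => j _; rewrite !normrM ler_pM ?mulr_ge0 ?BP// ler_pM//.
    by apply: le_trans wk; exact: coord_le_norm.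
  by apply: le_trans wk; exact: coord_le_norm.
rewrite !sumr_const card_ord -[X in X <= _]mulr_natl -[X in _ * X <= _]mulr_natl.
have -> : n%:R * (n%:R * (k * k * B)) = k * (k * (n%:R * n%:R * B)) by ring.
have h : k * (n%:R * n%:R * B) <= 1.
  by rewrite /k mulrC ler_pdivrMr ?ltr_pwDr ?mulr_ge0// mul1r lerDl.
by apply: mulr_ile1 => //; rewrite ?(ltW k0)// !mulr_ge0// ltW.
Qed.

(** A directional derivative depends on the values along one line only. This compares [H (x, _)],
    defined on a fiber, with the chart expression of [H], defined on phase space. *)
Lemma derive_eq (V1 V2 : normedModType R) (f1 : V1 -> R^o) (f2 : V2 -> R^o)
  (a1 v1 : V1) (a2 v2 : V2) :
  (forall h : R, f1 (h *: v1 + a1) = f2 (h *: v2 + a2)) -> 'D_v1 f1 a1 = 'D_v2 f2 a2.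
Proof.
move=> H; have := H 0; rewrite !scale0r !add0r => H0; rewrite /derive.
rewrite (_ : (fun h => h^-1 *: (f1 (h *: v1 + a1) - f1 a1)) =
  (fun h => h^-1 *: (f2 (h *: v2 + a2) - f2 a2)))//.
by apply/funext => h; rewrite H H0.
Qed.

Lemma in_chart_nice (H : cotangent_bundle X -> R) c a rho : tonelli g H -> atlas X c ->
  cball a rho `<=` chart_cod c -> nice_ham (in_chart H c) a rho.
Proof.
move=> tH ac sub; have CF := tonelli_C2 tH ac.
have [k k0 kP] := cotangent_norm_lower ac sub.
apply: (Ck2_nice_ham CF).
- by move=> y q yb; exact: sub.
- move=> K; have K0 : 0 < (`|K| + 1) / k by rewrite divr_gt0// ltr_pwDr.
  have [C CP] := tonelli_superlinear tH K0; exists C => y q yb.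
  apply: le_trans (CP _); rewrite lerD2r.
  apply: (@le_trans _ _ ((`|K| + 1) / k * (k * `|q|))); last first.
    by rewrite ler_wpM2l ?(ltW K0)//; exact: kP.
  rewrite mulrA divfK ?gt_eqF// ler_wpM2r//.
  by rewrite (le_trans (ler_norm K))// lerDl.
move=> y q w yb w0; have yc := sub _ yb.
set x := chart_inv c y; have xc : chart_dom c x by exact: chart_inv_dom.
set B := (trans (chart_at X x) c x)^T.
have HE q' : in_chart H c (y, q') = H (x, q' *m B).
  by rewrite /in_chart cotangent_of_chart_trans.
have w'0 : w *m B != 0.
  apply: contra w0 => /eqP wB.
  have : w *m B *m (trans c (chart_at X x) x)^T = 0 by rewrite wB mul0mx.
  rewrite -mulmxA -trmx_mul (trans_inv ac (chart_at_atlas X x) xc (chart_at_dom X x)).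
  by rewrite trmx1 mulmx1 => ->.
have := tonelli_convex tH x (q *m B) w'0.
have eh (h : R) q' : h *: ((0, w) : V * V) + (y, q') = (y, h *: w + q').
  by rewrite [LHS]surjective_pairing/= scaler0 add0r.
have eB (h : R) q' : h *: (w *m B) + q' *m B = (h *: w + q') *m B.
  by rewrite mulmxDl scalemxAl.
have D1 q' : 'D_(w *m B) (fun p' : V => H (x, p') : R^o) (q' *m B)
    = 'd (in_chart H c : V * V -> R^o) (y, q') (0, w).
  rewrite -deriveE; last by case: CF => + _; apply; exact: yc.
  by apply: derive_eq => h; rewrite eh eB HE.
rewrite -deriveE; last by case: CF => _ /(_ (0, w)) [+ _]; apply; exact: yc.
rewrite [X in _ < X -> _](_ : _ = 'D_(0, w) (fun z : V * V => 'd (in_chart H c : V * V -> R^o) z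
  (0, w) : R^o) (y, q))//.
by apply: derive_eq => h; rewrite eh eB D1.
Qed.

Lemma cont_pairing (p : V) (f : V * V -> V) z : {for z, continuous f} ->
  {for z, continuous (fun u => pairing p (f u) : R^o)}.
Proof.
move=> cf; apply: cont_sum => i; apply: continuousM; first exact: cst_continuous.
apply: (@continuous_comp _ _ _ f (fun x : V => x 0 i : R^o)) => //.
exact: coord_continuous.
Qed.

Lemma diff_liouville (z xi eta : V * V) :
  'd (@liouville_form R n ^~ eta) z xi = pairing xi.2 eta.1.
Proof.
have lin : linear (@liouville_form R n ^~ eta).
  by move=> s u v; rewrite /liouville_form/= pairingDl pairingZl.
pose L : {linear (V * V)%type -> R^o} := HB.pack (@liouville_form R n ^~ eta)
  (GRing.isLinear.Build _ _ _ _ _ lin).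
have cL : continuous (L : V * V -> R^o).
  move=> u; rewrite (_ : (L : V * V -> R^o) = fun u : V * V => pairing eta.1 u.2).
    by apply: cont_pairing; exact: cvg_snd.
  by apply/funext => u'; rewrite pairingC.
by have -> : @liouville_form R n ^~ eta = L by []; rewrite diff_lin.
Qed.

Lemma symplectic_formE (z xi eta : V * V) :
  symplectic_form z xi eta = pairing eta.2 xi.1 - pairing xi.2 eta.1.
Proof. by rewrite /symplectic_form (diff_liouville z xi eta) (diff_liouville z eta xi) opprB. Qed.

(** Hamilton's equations for the sign conventions in force; nondegeneracy of the form makes the
    vector selected by [xget] unique. *)
Lemma hamiltonian_fieldE (F : V * V -> R) z :
  hamiltonian_field F z = (gradp F z, - gradx F z).
Proof.
rewrite /hamiltonian_field; case: xgetP => [xi _ /= H|/(_ (gradp F z, - gradx F z)) []]; last first.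
  by move=> [y q]; rewrite symplectic_formE/= pairingNl opprK diff_grad addrC (pairingC q).
rewrite [xi]surjective_pairing; congr pair.
  apply: pairing_eq => v; have := H (0, v).
  by rewrite symplectic_formE/= pairing0r subr0 diff_grad pairing0r add0r pairingC.
apply: pairing_eq => v; have := H (v, 0).
rewrite symplectic_formE/= pairing0l sub0r diff_grad pairing0r addr0 pairingNl => <-.
by rewrite opprK.
Qed.

Lemma symplectic_fields (F K : V * V -> R) z :
  symplectic_form z (hamiltonian_field F z) (hamiltonian_field K z) =
  pairing (gradx F z) (gradp K z) - pairing (gradp F z) (gradx K z).
Proof.
rewrite (hamiltonian_fieldE F z) (hamiltonian_fieldE K z) symplectic_formE/=.
move: (gradx F z) (gradx K z) (gradp F z) (gradp K z) => a1 a2 b1 b2.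
by rewrite !pairingNl opprK addrC (pairingC a2).
Qed.

Lemma poisson_grad (G H : cotangent_bundle X -> R) c y q : poisson_commute G H ->
  atlas X c -> chart_cod c y ->
  pairing (gradx (in_chart G c) (y, q)) (gradp (in_chart H c) (y, q)) =
  pairing (gradp (in_chart G c) (y, q)) (gradx (in_chart H c) (y, q)).
Proof.
move=> pc ac yc; have := pc c ac (y, q) yc.
by rewrite (symplectic_fields (in_chart G c) (in_chart H c)) => /subr0_eq.
Qed.

Lemma poisson_gradC (G H : cotangent_bundle X -> R) c y q : poisson_commute G H ->
  atlas X c -> chart_cod c y ->
  pairing (gradx (in_chart H c) (y, q)) (gradp (in_chart G c) (y, q)) =
  pairing (gradp (in_chart H c) (y, q)) (gradx (in_chart G c) (y, q)).
Proof.
move=> pc ac yc; have := poisson_grad q pc ac yc.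
move: (gradx _ _) (gradx _ _) (gradp _ _) (gradp _ _) => a1 a2 b1 b2.
by rewrite (pairingC a1) (pairingC b2).
Qed.

End tonelli_in_charts.

(** * Comparison of integrals when one integrand may fail to be measurable *)

Section integral_comparison.
Context d (T : measurableType d) (R : realType) (mu : {measure set T -> \bar R}).

(** The integral is the difference of two suprema over simple functions, below the positive and the
    negative part; each is monotone for arbitrary functions. *)
Lemma le_integral_pointwise (D : set T) (f g : T -> \bar R) :
  (forall x, D x -> (f x <= g x)%E) -> (\int[mu]_(x in D) f x <= \int[mu]_(x in D) g x)%E.
Proof.
move=> fg; have FG x : ((f \_ D) x <= (g \_ D) x)%E.
  by rewrite /patch; case: ifPn => // /set_mem; exact: fg.
rewrite /integral; apply: leeB; apply: ereal_sup_le => _ [h /= hf <-]; exists h => //= x.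
- apply: le_trans (hf x) _; apply: (@funepos_le _ _ setT) => [y _|]; [exact: FG|exact: in_setT].
- apply: le_trans (hf x) _; apply: (@funeneg_le _ _ setT) => [y _|]; [exact: FG|exact: in_setT].
Qed.

(** The measurable side is changed to [-oo] on a null set, which keeps its integral and makes the
    inequality hold everywhere. The other side will be the integrand of the action. *)
Lemma ae_le_integral_left (D : set T) (f g : T -> \bar R) : measurable D -> measurable_fun D f ->
  {ae mu, forall x, D x -> (f x <= g x)%E} ->
  (\int[mu]_(x in D) f x <= \int[mu]_(x in D) g x)%E.
Proof.
move=> mD mf [N [mN N0 NP]].
have -> : (\int[mu]_(x in D) f x = \int[mu]_(x in D) (if x \in N then -oo else f x))%E.
  apply: ae_eq_integral => //.
    apply: measurable_fun_if => //.
    - apply: (measurable_fun_bool true) => //.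
      rewrite (_ : _ @^-1` _ = N); first exact: measurableI.
      by apply/seteqP; split => x /=; [exact: set_mem|exact: mem_set].
    - exact: measurable_funS mf.
  exists N; split => // x /= H; apply: contrapT => xN; apply: H => Dx.
  by rewrite memNset.
apply: le_integral_pointwise => x Dx; case: ifPn; first by rewrite leNye.
rewrite notin_setE => xN; apply: contrapT => H; apply: xN; apply: NP => /= h.
by apply: H; exact: h.
Qed.

Lemma ae_le_integral_right (D : set T) (f g : T -> \bar R) : measurable D -> measurable_fun D g ->
  {ae mu, forall x, D x -> (f x <= g x)%E} ->
  (\int[mu]_(x in D) f x <= \int[mu]_(x in D) g x)%E.
Proof.
move=> mD mg [N [mN N0 NP]].
have -> : (\int[mu]_(x in D) g x = \int[mu]_(x in D) (if x \in N then +oo else g x))%E.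
  apply: ae_eq_integral => //.
    apply: measurable_fun_if => //.
    - apply: (measurable_fun_bool true) => //.
      rewrite (_ : _ @^-1` _ = N); first exact: measurableI.
      by apply/seteqP; split => x /=; [exact: set_mem|exact: mem_set].
    - exact: measurable_funS mg.
  exists N; split => // x /= H; apply: contrapT => xN; apply: H => Dx.
  by rewrite memNset.
apply: le_integral_pointwise => x Dx; case: ifPn; first by rewrite leey.
rewrite notin_setE => xN; apply: contrapT => H; apply: xN; apply: NP => /= h.
by apply: H; exact: h.
Qed.

End integral_comparison.

(** * Integrable functions supported in a time interval *)

Section supported_functions.
Context {R : realType}.
Local Notation mu := (@lebesgue_measure R).
Local Notation T := (measurableTypeR R).

(** With functions on the whole line that vanish outside their interval, concatenation is
    addition. *)
Definition supported_on (s t : R) (f : R -> R) := forall x, ~~ (s < x < t) -> f x = 0.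

Definition integrableR (f : R -> R) : Prop := mu.-integrable setT (EFin \o f : T -> \bar R).

Definition integralR (f : R -> R) : \bar R := (\int[mu]_x (f x)%:E)%E.

Lemma supported_glue (s m t : R) (f g : R -> R) : s <= m -> m <= t ->
  integrableR f -> integrableR g -> supported_on s m f -> supported_on m t g ->
  [/\ integrableR (f \+ g), supported_on s t (f \+ g),
     integralR (f \+ g) = (integralR f + integralR g)%E,
     forall x, x < m -> (f \+ g) x = f x & forall x, m < x -> (f \+ g) x = g x].
Proof.
move=> sm mt fi gi sf sg; split.
- have := integrableD measurableT fi gi; apply: eq_integrable => //.
- move=> x xst; rewrite /= sf ?sg ?addr0//.
    by apply: contra xst => /andP[h1 h2]; rewrite h2 (le_lt_trans sm h1).
  by apply: contra xst => /andP[h1 h2]; rewrite h1 (lt_le_trans h2 mt).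
- rewrite /integralR -integralD//.
- by move=> x xm; rewrite /= sg ?addr0// negb_and -!leNgt ltW.
- by move=> x xm; rewrite /= sf ?add0r// negb_and -!leNgt (ltW xm) orbT.
Qed.

Lemma ae_neq (m : R) : {ae mu, forall x : T, x != m}.
Proof.
exists [set m]; split; [exact: measurable_set1|exact: lebesgue_measure_set1|].
by move=> x /= /negP/negPn/eqP.
Qed.

Lemma supported_patch (s t : R) (f : R -> R) :
  mu.-integrable (`]s, t[ : set T) (EFin \o f) ->
  let g := fun x => if s < x < t then f x else 0 in
  [/\ integrableR g, supported_on s t g, (forall x, s < x < t -> g x = f x) &
    integralR g = (\int[mu]_(x in `]s, t[) (f x)%:E)%E].
Proof.
move=> fi g; have gE : EFin \o g = ((EFin \o f) \_ (`]s, t[%classic : set R) : R -> \bar R).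
  apply/funext => x; rewrite /patch /g /=.
  have -> : (x \in (`]s, t[%classic : set R)) = (s < x < t).
    by apply/idP/idP => [/set_mem|h]; [|apply/mem_set]; rewrite /= in_itv.
  by case: ifP.
split.
- rewrite /integrableR gE.
  have mD : measurable (`]s, t[%classic : set T) by exact: measurable_itv.
  exact: (integrable_mkcond (EFin \o f : T -> \bar R) mD).1 fi.
- by move=> x /negbTE h; rewrite /g h.
- by move=> x h; rewrite /g h.
- rewrite /integralR (_ : (fun x => (g x)%:E) = EFin \o g)// gE -integral_mkcond//.
Qed.

End supported_functions.

(** * Certified bounds on the action of pieces of curves *)

Section curve_pieces.
Context {R : realType} {n : nat} {M : topologicalType} (X : C2_manifold R n M).
Local Notation V := 'rV[R]_n.
Local Notation mu := (@lebesgue_measure R).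
Implicit Types (H : cotangent_bundle X -> R) (gamma : R -> M) (c : chart R n M).

Definition speed_lagrangian H gamma (x : R) : R :=
  lagrangian H (gamma x, velocity X gamma x).

(** The bound is certified by an integrable minorant, so that bounds of consecutive pieces add up
    without any measurability of [speed_lagrangian]. *)
Definition lower_action H gamma (s t b : R) := exists f : R -> R,
  [/\ integrableR f, supported_on s t f,
   {ae mu, forall x : R, s < x < t -> f x <= speed_lagrangian H gamma x} &
   (b%:E <= integralR f)%E].

Definition upper_action H gamma (s t b : R) := exists f : R -> R,
  [/\ integrableR f, supported_on s t f,
   {ae mu, forall x : R, s < x < t -> speed_lagrangian H gamma x <= f x} &
   (integralR f <= b%:E)%E].

Lemma integrableR0 : integrableR (fun=> 0 : R).
Proof. exact: integrable0. Qed.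

Lemma lower_action_refl H gamma s : lower_action H gamma s s 0.
Proof.
exists (fun=> 0); split => //; first exact: integrableR0.
  by apply: aeW => x /andP[h1 h2]; have := lt_trans h1 h2; rewrite ltxx.
by rewrite /integralR integral0.
Qed.

Lemma lower_action_le H gamma s t b b' : b' <= b ->
  lower_action H gamma s t b -> lower_action H gamma s t b'.
Proof.
move=> bb [f [h1 h2 h3 h4]]; exists f; split => //.
by apply: le_trans h4; rewrite lee_fin.
Qed.

Lemma lower_action_glue H gamma s m t b b' : s <= m -> m <= t ->
  lower_action H gamma s m b -> lower_action H gamma m t b' ->
  lower_action H gamma s t (b + b').
Proof.
move=> sm mt [f [fi fs fL fb]] [g [gi gs gL gb]].
have [hi hs hE hl hr] := supported_glue sm mt fi gi fs gs.
exists (f \+ g); split => //.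
  move: fL gL (ae_neq m); apply: filterS3; first exact: (ae_filter_ringOfSetsType mu).
  move=> x fL gL xm /andP[sx xt]; have [xlt|xgt|xe] := ltgtP x m.
  - by rewrite hl//; apply: fL; rewrite sx.
  - by rewrite hr//; apply: gL; rewrite xt andbT.
  - by rewrite xe eqxx in xm.
by rewrite hE EFinD leeD.
Qed.

Lemma upper_action_refl H gamma s : upper_action H gamma s s 0.
Proof.
exists (fun=> 0); split => //; first exact: integrableR0.
  by apply: aeW => x /andP[h1 h2]; have := lt_trans h1 h2; rewrite ltxx.
by rewrite /integralR integral0.
Qed.

Lemma upper_action_le H gamma s t b b' : b <= b' ->
  upper_action H gamma s t b -> upper_action H gamma s t b'.
Proof.
move=> bb [f [h1 h2 h3 h4]]; exists f; split => //.
by apply: le_trans h4 _; rewrite lee_fin.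
Qed.

(** Velocities are local in time, hence the germ hypotheses on either side of [m]; the junction
    itself is a null set. *)
Lemma upper_action_glue H gamma gamma1 gamma2 s m t b b' : s <= m -> m <= t ->
  (forall x, x < m -> \forall y \near x, gamma y = gamma1 y) ->
  (forall x, m < x -> \forall y \near x, gamma y = gamma2 y) ->
  upper_action H gamma1 s m b -> upper_action H gamma2 m t b' ->
  upper_action H gamma s t (b + b').
Proof.
move=> sm mt e1 e2 [f [fi fs fL fb]] [g [gi gs gL gb]].
have [hi hs hE hl hr] := supported_glue sm mt fi gi fs gs.
have spE (x : R) gamma' : (\forall y \near x, gamma y = gamma' y) ->
    speed_lagrangian H gamma x = speed_lagrangian H gamma' x.
  move=> nx; have ex := nbhs_singleton nx; rewrite /speed_lagrangian /velocity ex.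
  congr (lagrangian H (_, _)); rewrite !derive1E; apply: near_eq_derive.
  by apply: filterS nx => y /= ->.
exists (f \+ g); split => //.
  move: fL gL (ae_neq m); apply: filterS3; first exact: (ae_filter_ringOfSetsType mu).
  move=> x fL gL xm /andP[sx xt]; have [xlt|xgt|xe] := ltgtP x m.
  - by rewrite hl// (spE _ gamma1 (e1 _ xlt)); apply: fL; rewrite sx.
  - by rewrite hr// (spE _ gamma2 (e2 _ xgt)); apply: gL; rewrite xt andbT.
  - by rewrite xe eqxx in xm.
by rewrite hE EFinD leeD.
Qed.

Lemma supported_integral (s t : R) (f : R -> R) : supported_on s t f -> integrableR f ->
  integralR f = (\int[mu]_(x in `[s, t]) (f x)%:E)%E.
Proof.
move=> fs fi; rewrite [RHS]integral_mkcond; apply: eq_integral => x _; rewrite /patch.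
case: ifPn => //; rewrite notin_setE /= in_itv/= => /negP h; rewrite fs//.
by apply: contra h => /andP[h1 h2]; rewrite !ltW.
Qed.

Lemma ae_closed_itv (s t : R) (P : R -> Prop) : {ae mu, forall x : R, s < x < t -> P x} ->
  {ae mu, forall x : R, (`[s, t]%classic : set R) x -> P x}.
Proof.
have FF : Filter (almost_everywhere mu) := ae_filter_ringOfSetsType mu.
move: (ae_neq s) (ae_neq t) => e1 e2 h; move: e1 e2 h; apply: filterS3.
move=> x xs xt h; rewrite /= in_itv/= => /andP[sx tx]; apply: h.
by rewrite !lt_neqAle sx tx xt eq_sym xs.
Qed.

Lemma lower_action_action H gamma t b : lower_action H gamma 0 t b ->
  (b%:E <= action H t gamma)%E.
Proof.
move=> [f [fi fs fL fb]]; apply: le_trans fb _; rewrite (supported_integral fs fi).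
apply: ae_le_integral_left; first exact: measurable_itv.
  have /measurable_int mf := fi; exact: measurable_funS mf.
have FF : Filter (almost_everywhere mu) := ae_filter_ringOfSetsType mu.
by apply: filterS (ae_closed_itv fL) => x h xst; rewrite lee_fin; exact: h.
Qed.

Lemma upper_action_action H gamma t b : upper_action H gamma 0 t b ->
  (action H t gamma <= b%:E)%E.
Proof.
move=> [f [fi fs fL fb]]; apply: le_trans fb; rewrite (supported_integral fs fi).
apply: ae_le_integral_right; first exact: measurable_itv.
  have /measurable_int mf := fi; exact: measurable_funS mf.
have FF : Filter (almost_everywhere mu) := ae_filter_ringOfSetsType mu.
by apply: filterS (ae_closed_itv fL) => x h xst; rewrite lee_fin; exact: h.
Qed.

End curve_pieces.

(** * Finite covers by coordinate balls and uniform continuity of curves *)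

Section chart_covers.
Context {R : realType} {n : nat} {M : topologicalType} (X : C2_manifold R n M).
Local Notation V := 'rV[R]_n.

Definition in_ball (c : chart R n M) (a : V) (s : R) : set M :=
  [set x | chart_dom c x /\ cball a s (c x)].

(** Points are located in the balls of radius [r], while constructions take place in the concentric
    balls of radius [8 * r], which leaves room for several displacements. *)
Record chart_cover N (c : 'I_N -> chart R n M) (a : 'I_N -> V) (r : 'I_N -> R) : Prop := {
  cover_atlas : forall j, atlas X (c j) ;
  cover_pos : forall j, 0 < r j ;
  cover_cod : forall j, cball (a j) (8 * r j) `<=` chart_cod (c j) ;
  cover_all : forall x, exists j, in_ball (c j) (a j) (r j) x }.

Lemma chart_ball (c : chart R n M) x : chart_dom c x ->
  exists2 r : R, 0 < r & cball (c x) (8 * r) `<=` chart_cod c.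
Proof.
move=> xd; have oc : open (chart_cod c) by exact: (@open_chart_cod _ _ _ c).
have : nbhs (c x) (chart_cod c) by apply: open_nbhs_nbhs; split => //; exact: chart_map_cod.
move=> /nbhs_ballP[e /= e0 eb]; exists (e / 16); first by rewrite divr_gt0.
move=> y; rewrite /cball/= => yr; apply: eb; rewrite -ball_normE/= distrC.
apply: le_lt_trans yr _; lra.
Qed.

Lemma in_ball_nbhs (c : chart R n M) x (r : R) : chart_dom c x -> 0 < r ->
  \forall y \near x, in_ball c (c x) r y.
Proof.
move=> xd r0; have h1 : \forall y \near x, chart_dom c y.
  by apply: open_nbhs_nbhs; split => //; exact: open_chart_dom.
have h2 : \forall y \near x, ball (c x) r (c y).
  by apply: (chart_map_cvg xd); exact: nbhsx_ballx.
move: h1 h2; apply: filterS2 => y yd; rewrite -ball_normE/= => yb; split => //.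
by rewrite /cball/= distrC ltW.
Qed.

Lemma chart_cover_exists : compact [set: M] -> exists N c a r, @chart_cover N c a r.
Proof.
move=> /compact_near_coveringP cM.
have /choice[rho rhoP] : forall x : M, exists rho : R, 0 < rho /\
    cball (chart_at X x x) (8 * rho) `<=` chart_cod (chart_at X x).
  by move=> x; have [rho h1 h2] := chart_ball (chart_at_dom X x); exists rho.
(* The filter generated by the finite lists containing a given one; compactness as near-covering
   then yields one list that serves all points. *)
pose F : set_system (seq M) := fun P => exists s0 : seq M, forall s : seq M, {subset s0 <= s} -> P s.
have FF : Filter F.
  split.
  - by exists [::].
  - move=> P Q [s hs] [t ht]; exists (s ++ t) => u uP; split; [apply: hs|apply: ht].
      by move=> x xs; apply: uP; rewrite mem_cat xs.
    by move=> x xs; apply: uP; rewrite mem_cat xs orbT.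
  - by move=> P Q PQ [s hs]; exists s => t st; apply: PQ; exact: hs.
have [|s sP] := cM _ F (fun s x => exists2 y, y \in s &
    in_ball (chart_at X y) (chart_at X y y) (rho y) x) FF.
  move=> x _; exists ([set y | in_ball (chart_at X x) (chart_at X x x) (rho x) y],
      [set s : seq M | x \in s]).
    split => /=; first by apply: in_ball_nbhs; [exact: chart_at_dom|exact: (rhoP x).1].
    by exists [:: x] => s /(_ x); apply; rewrite inE.
  by move=> [y s] /= [h1 h2]; exists x.
have {}sP := sP s (fun _ h => h).
pose y j := tnth (in_tuple s) j.
exists (size s), (fun j => chart_at X (y j)), (fun j => chart_at X (y j) (y j)),
  (fun j => rho (y j)); split.
- by move=> j; exact: chart_at_atlas.
- by move=> j; exact: (rhoP _).1.
- by move=> j; exact: (rhoP _).2.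
- move=> x; have [z zs hz] := sP x I.
  have : z \in in_tuple s by [].
  by move=> /tnthP[j zE]; exists j; rewrite /y -zE.
Qed.

Lemma in_ball_closed (c : chart R n M) a (s : R) : hausdorff_space M ->
  cball a s `<=` chart_cod c -> closed (in_ball c a s).
Proof.
move=> hM ac.
have -> : in_ball c a s = chart_inv c @` cball a s.
  apply/seteqP; split => x.
    by move=> [xd xa]; exists (c x) => //; rewrite chart_mapK.
  move=> [y ya <-]; split; first by apply: chart_inv_dom; exact: ac.
  by rewrite chart_invK//; exact: ac.
apply: compact_closed => //; apply: continuous_compact; last exact: cball_compact.
apply: continuous_in_subspaceT => y /set_mem ya.
by apply: chart_inv_cvg; exact: ac.
Qed.

(** Compactness of the time interval. Near a time [s0] whose point lies in the coordinate ball,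
    continuity in the chart applies; otherwise nearby points avoid the ball, which is closed because
    [M] is Hausdorff, and there is nothing to prove. *)
Lemma curve_modulus N c a r (gamma : R -> M) (t d : R) : @chart_cover N c a r ->
  {within `[0, t], continuous gamma} -> 0 < d ->
  exists2 eta : R, 0 < eta & forall j (s s' : R), 0 <= s <= t -> 0 <= s' <= t ->
    `|s - s'| <= eta -> in_ball (c j) (a j) (7 * r j) (gamma s) ->
    chart_dom (c j) (gamma s') /\ `|c j (gamma s') - c j (gamma s)| <= d.
Proof.
move=> hc cg d0; apply: finite_min; first by
  move=> j e1 e2 h1 h12 H s s' hs hs' ss; apply: H => //; exact: le_trans ss h12.
move=> j; have r0 := cover_pos hc j.
have cl : closed (in_ball (c j) (a j) (7 * r j)).
  apply: in_ball_closed (manifold_hausdorff X) _.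
  by apply: subset_trans (cover_cod hc (j:=j)) => y; rewrite /cball/= => h; lra.
have /compact_near_coveringP cI : compact (`[0, t]%classic : set R) by exact: segment_compact.
pose P (eta s : R) := forall s' : R, 0 <= s <= t -> 0 <= s' <= t -> `|s - s'| <= eta ->
  in_ball (c j) (a j) (7 * r j) (gamma s) ->
  chart_dom (c j) (gamma s') /\ `|c j (gamma s') - c j (gamma s)| <= d.
have FF : Filter (0^'+ : set_system R) by exact: _.
have [|eta /= e0 H] := cI R (0^'+) P _.
  move=> s0 s0t; move/subspace_continuousP: cg => /(_ _ s0t) cg.
  have [xin|xout] := pselect (in_ball (c j) (a j) (7 * r j) (gamma s0)); last first.
    have : \forall y \near gamma s0, ~ in_ball (c j) (a j) (7 * r j) y.
      by apply: open_nbhs_nbhs; split => //; exact: closed_openC.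
    move=> /cg; rewrite /within/= => /nbhs_ballP[e /= e0 eb].
    exists (ball s0 e, [set: R]) => /=; first by split; [exact: nbhsx_ballx|exact: filterT].
    move=> [s eta] /= [sb _] s' st _ _ /eb; move: sb => /[swap] h /h.
    by case; rewrite in_itv/=.
  have : \forall y \near gamma s0, chart_dom (c j) y /\ ball (c j (gamma s0)) (d / 2) (c j y).
    have xd := xin.1.
    have h1 : \forall y \near gamma s0, chart_dom (c j) y.
      by apply: open_nbhs_nbhs; split => //; exact: open_chart_dom.
    have h2 : \forall y \near gamma s0, ball (c j (gamma s0)) (d / 2) (c j y).
      by apply: (chart_map_cvg xd); apply: nbhsx_ballx; rewrite divr_gt0.
    by move: h1 h2; apply: filterS2.
  move=> /cg; rewrite /within/= => /nbhs_ballP[e /= e0 eb].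
  have e2 : 0 < e / 2 by rewrite divr_gt0.
  exists (ball s0 (e / 2), [set x | x < e / 2]) => /=.
    by split; [exact: nbhsx_ballx|exact: nbhs_right_lt].
  move=> [s eta] /= [sb etae] s' st s't ss' _.
  move: sb; rewrite -ball_normE/= => sb.
  have sb1 : ball (s0 : R) e s by rewrite -ball_normE/=; apply: lt_trans sb _; lra.
  have sb2 : ball (s0 : R) e s'.
    rewrite -ball_normE/= (_ : s0 - s' = (s0 - s) + (s - s')); last by ring.
    by apply: le_lt_trans (ler_normD _ _) _; lra.
  have [h1 h2] : chart_dom (c j) (gamma s) /\ ball (c j (gamma s0)) (d / 2) (c j (gamma s)).
    by apply: (eb s sb1); rewrite in_itv.
  have [h3 h4] : chart_dom (c j) (gamma s') /\ ball (c j (gamma s0)) (d / 2) (c j (gamma s')).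
    by apply: (eb s' sb2); rewrite in_itv.
  split => //; move: h2 h4; rewrite -!ball_normE/= => h2 h4.
  rewrite (_ : c j (gamma s') - c j (gamma s) =
    (c j (gamma s0) - c j (gamma s)) - (c j (gamma s0) - c j (gamma s'))); last by row_ring.
  apply: le_trans (ler_normB _ _) _; lra.
have e2 : 0 < eta / 2 by rewrite divr_gt0.
exists (eta / 2) => // s s' hs hs' ss'.
have := H (eta / 2) _ e2 s _ s' hs hs' ss'; apply.
  by rewrite /ball_/= sub0r normrN gtr0_norm//; lra.
by rewrite /= in_itv/=.
Qed.

End chart_covers.

(** * Auxiliary facts on absolutely continuous curves and constant integrands *)

Section abs_continuous_curves.
Context {R : realType}.

Lemma abs_continuous_on_le (V W : normedModType R) (f : R -> V) (g : R -> W) (a b L : R) :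
  0 <= L -> (forall x y : R, a <= x -> x <= y -> y <= b -> `|g y - g x| <= L * `|f y - f x|) ->
  abs_continuous_on a b f -> abs_continuous_on a b g.
Proof.
move=> L0 fg fab e e0; have L1 : 0 < L + 1 by rewrite ltr_wpDl.
have [|d d0 H] := fab (e / (L + 1)); first by rewrite divr_gt0.
exists d => // k l r lr dis lrd.
have sum_lt := H k l r lr dis lrd.
apply: (@le_lt_trans _ _ ((L + 1) * \sum_(i < k) `|f (r i) - f (l i)|)).
  rewrite mulr_sumr; apply: ler_sum => i _; have [h1 h2 h3] := lr i.
  apply: le_trans (fg _ _ h1 h2 h3) _; apply: ler_wpM2r => //; lra.
by rewrite mulrC -ltr_pdivlMr.
Qed.

Lemma abs_continuous_on_id (a b : R) : @abs_continuous_on R R^o a b id.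
Proof.
move=> e e0; exists e => // k l r lr _; apply: le_lt_trans.
by apply: ler_sum => i _; have [_ h _] := lr i; rewrite ger0_norm ?subr_ge0.
Qed.

Lemma within_itv_continuous (T : topologicalType) (gamma : R -> T) (s t x : R) :
  {within `[s, t], continuous gamma} -> s < x < t -> {for x, continuous gamma}.
Proof.
move=> /subspace_continuousP cg /andP[sx xt].
have xst : (`[s, t]%classic : set R) x by rewrite /= in_itv/= !ltW.
have := cg x xst; rewrite within_interior//.
have : x \in `]s, t[ by rewrite in_itv/= sx.
move=> /near_in_itvoo; apply: filterS => y; rewrite /= !in_itv/= => /andP[h1 h2].
by rewrite !ltW.
Qed.

Lemma cst_integrable_oo (s t B : R) :
  (@lebesgue_measure R).-integrable (`]s, t[%classic : set (measurableTypeR R)) (EFin \o (fun=> B)).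
Proof.
have mO : measurable (`]s, t[%classic : set (measurableTypeR R)) by exact: measurable_itv.
apply/integrableP; split; first exact/measurable_EFinP/measurable_cst.
have := @integral_cst _ _ R (@lebesgue_measure R) _ mO `|B|%:E.
rewrite /comp/= /cst => ->; rewrite lebesgue_measure_itv/=.
by case: ifP => _; rewrite ?mule0 ?ltry// -EFinB -EFinM ltry.
Qed.

Lemma integral_cst_oo (s t B : R) : s < t ->
  (\int[@lebesgue_measure R]_(x in `]s, t[) B%:E = ((t - s) * B)%:E)%E.
Proof.
move=> st.
have mO : measurable (`]s, t[%classic : set (measurableTypeR R)) by exact: measurable_itv.
have := @integral_cst _ _ R (@lebesgue_measure R) _ mO B%:E.
rewrite /cst => e; apply: etrans e _.
have mE : @lebesgue_measure R `]s, t[%classic = (t - s)%:E.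
  by rewrite lebesgue_measure_itv/= lte_fin st -EFinB.
by apply: etrans (congr1 (fun z => (B%:E * z)%E) mE) _; rewrite -EFinM mulrC.
Qed.

End abs_continuous_curves.

(** * Lower bound on the action of a piece of curve in one chart *)

Section lower_bounds.
Context {R : realType} {n : nat} {M : topologicalType} (X : C2_manifold R n M).
Local Notation V := 'rV[R]_n.
Local Notation mu := (@lebesgue_measure R).
Local Notation T := (measurableTypeR R).
Implicit Types (H : cotangent_bundle X -> R) (gamma : R -> M) (c : chart R n M).

Lemma pairing_delta (v : V) j : pairing (delta_mx 0 j) v = v 0 j.
Proof.
rewrite /pairing (bigD1 j)//= big1 ?addr0; first by rewrite mxE !eqxx mul1r.
by move=> i ij; rewrite mxE (negbTE ij) andbF mul0r.
Qed.

Lemma lower_piece H c a (rho : R) gamma (t s s' B : R) p : nice_ham (in_chart H c) a rho ->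
  atlas X c -> abs_continuous_curve X t gamma -> 0 <= s -> s <= s' -> s' <= t ->
  (forall x : R, s <= x <= s' -> in_ball c a rho (gamma x) /\
     in_chart H c (c (gamma x), p) <= B) ->
  lower_action H gamma s s' (pairing p (c (gamma s') - c (gamma s)) - (s' - s) * B).
Proof.
move=> hF ac [cg acg] s0; rewrite le_eqVlt => /orP[/eqP <- _ _|ss' s't inb].
  by rewrite !subrr pairing0r mul0r subrr; exact: lower_action_refl.
have acc : abs_continuous_on s s' (c \o gamma : R -> V).
  by apply: acg => // x; rewrite /= in_itv/= => /inb[[]].
have accoord q : @abs_continuous_on R R^o s s' (fun x => pairing q (c (gamma x))).
  apply: abs_continuous_on_le acc => [|x y _ _ _]; last first.
    by rewrite -pairingBr; exact: pairing_le.
  by rewrite mulr_ge0.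
have [h [hi hint hd]] := abs_continuous_FTC ss' (accoord p).
have hd' : {ae mu, forall x : T, s < x < s' ->
    derivable (c \o gamma : R -> V) x 1}.
  have FF : Filter (almost_everywhere mu) := ae_filter_ringOfSetsType mu.
  have : {ae mu, forall x : T, forall j : 'I_n, s < x < s' ->
      derivable (fun x => (c (gamma x)) 0 j : R^o) x 1}.
    apply: filter_forall => j.
    have [g [_ _]] := abs_continuous_FTC ss' (accoord (delta_mx 0 j)).
    apply: filterS => x gd sx; have [gd' _] := gd sx; move: gd'.
    rewrite (_ : (fun x0 : R => pairing _ _) = (fun x0 => (c (gamma x0)) 0 j))//.
    by apply/funext => y; exact: pairing_delta.
  apply: filterS => x gd sx; apply/derivable_mxP => i j; rewrite ord1.
  by apply: gd.
have mO : measurable (`]s, s'[%classic : set T) by exact: measurable_itv.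
have hiO : mu.-integrable (`]s, s'[ : set T) (EFin \o h).
  apply: integrableS hi => //.
  by apply: subset_itvW; rewrite ?bnd_simp.
have BiO : mu.-integrable (`]s, s'[ : set T) (EFin \o (fun=> B)).
  exact: cst_integrable_oo.
have hBi : mu.-integrable (`]s, s'[ : set T) (EFin \o (fun x => h x - B)).
  by have := integrableB mO hiO BiO; apply: eq_integrable => //.
have [f1 f2 f3 f4] := supported_patch hBi.
eexists; split; [exact: f1|exact: f2| |].
  have FF : Filter (almost_everywhere mu) := ae_filter_ringOfSetsType mu.
  move: hd hd'; apply: filterS2 => x hx hx' sx; rewrite sx.
  have /inb[[xd xa] xB] : s <= x <= s' by move: sx => /andP[h1 h2]; rewrite !ltW.
  have cx : {for x, continuous gamma}.
    apply: within_itv_continuous cg _; move: sx => /andP[h1 h2].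
    by rewrite (le_lt_trans s0 h1) (lt_le_trans h2 s't).
  have dw : is_derive x 1 (c \o gamma : R -> V) ('D_1 (c \o gamma : R -> V) x).
    by apply: DeriveDef => //; exact: hx'.
  rewrite /speed_lagrangian (lagrangian_velocity H ac cx xd dw).
  set w := 'D_1 _ x in dw *.
  have -> : h x = pairing p w.
    have [_ <-] := hx sx.
    have dj (j : 'I_n) : is_derive x 1 (fun y => (c (gamma y)) 0 j : R^o) (w 0 j).
      have /derivable_mxP dj := hx' sx; split; first exact: dj.
      by rewrite /w (derive_mx (hx' sx)) mxE.
    have : is_derive x 1 (\sum_(j < n) (fun y => p 0 j * (c (gamma y)) 0 j : R^o))
       (\sum_(j < n) p 0 j * w 0 j).
      by apply: is_derive_sum => j; have := is_deriveZ (p 0 j) (dj j).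
    move=> [_ e]; rewrite /pairing -e; congr ('D_1 _ x).
    by apply/funext => y; rewrite fct_sumE.
  by apply: le_trans _ (lag_ge hF w p xa); exact: lerB.
rewrite f4 integralB_EFin//.
have -> : (\int[mu]_(x in `]s, s'[) (h x)%:E = (pairing p (c (gamma s') - c (gamma s)))%:E)%E.
  rewrite pairingBr -hint; apply/esym; apply: integral_itv_bndoo.
  by have /measurable_int := hiO.
by rewrite integral_cst_oo// -EFinB.
Qed.

End lower_bounds.

(** * Construction of competitors by segments and concatenation *)

Section lipschitz_curves.
Context {R : realType} {n : nat} {M : topologicalType} (X : C2_manifold R n M).
Local Notation V := 'rV[R]_n.
Local Notation mu := (@lebesgue_measure R).
Local Notation T := (measurableTypeR R).
Implicit Types (H : cotangent_bundle X -> R) (gamma : R -> M) (c : chart R n M).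

(** All competitors are broken lines in charts. Being Lipschitz in every chart is stable under
    concatenation, the constants adding up, and implies absolute continuity. *)
Definition lip_curve (s t : R) gamma := {within `[s, t], continuous gamma} /\
  forall c, atlas X c -> forall a b : R, s <= a -> b <= t ->
    `[a, b] `<=` gamma @^-1` chart_dom c ->
    exists2 L : R, 0 <= L & forall x y : R, a <= x -> x <= y -> y <= b ->
      `|c (gamma y) - c (gamma x)| <= L * (y - x).

Definition reach H (s t : R) (y x : M) (b : R) := exists gamma,
  [/\ lip_curve s t gamma, gamma s = y, gamma t = x & upper_action H gamma s t b].

Lemma lip_abs_continuous_curve t gamma : lip_curve 0 t gamma -> abs_continuous_curve X t gamma.
Proof.
move=> [cg lg]; split => // c ac a b a0 bt ab; have [L L0 HL] := lg c ac a b a0 bt ab.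
apply: abs_continuous_on_le L0 _ (@abs_continuous_on_id R a b) => x y ax xy yb.
by rewrite [`|y - x|]ger0_norm ?subr_ge0//; exact: HL.
Qed.

Lemma lax_oleinik_reach H u (t : R) y x b : reach H 0 t y x b ->
  (lax_oleinik H t u x <= (u y + b)%:E)%E.
Proof.
move=> [gamma [lg g0 gt gb]]; apply: (@le_trans _ _ ((u (gamma 0))%:E + action H t gamma)%E).
  by apply: ereal_inf_lbound; exists gamma => //; split => //; exact: lip_abs_continuous_curve.
by rewrite g0 EFinD leeD2l//; exact: upper_action_action.
Qed.

Lemma reach_refl H s x : reach H s s x x 0.
Proof.
exists (fun=> x); split => //; last exact: upper_action_refl.
split; first by apply: continuous_subspaceT => y; exact: cvg_cst.
by move=> c ac a b _ _ _; exists 0 => // y z _ _ _; rewrite subrr normr0 mul0r.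
Qed.

Lemma reach_le H s t y x b b' : b <= b' -> reach H s t y x b -> reach H s t y x b'.
Proof. by move=> bb [gamma [? ? ? ?]]; exists gamma; split => //; exact: upper_action_le bb _. Qed.

Lemma reach_glue H s m t y z x b b' : s <= m -> m <= t ->
  reach H s m y z b -> reach H m t z x b' -> reach H s t y x (b + b').
Proof.
move=> sm mt [g1 [[c1 l1] g1s g1m u1]] [g2 [[c2 l2] g2m g2t u2]].
pose gamma := fun x : R => if x <= m then g1 x else g2 x.
have e1 (q : R) : q <= m -> gamma q = g1 q by rewrite /gamma => ->.
have e2 (q : R) : m <= q -> gamma q = g2 q.
  rewrite le_eqVlt => /orP[/eqP <-|mq]; first by rewrite e1// g1m g2m.
  by rewrite /gamma leNgt mq.
exists gamma; split; [split| | |].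
- rewrite (_ : (`[s, t]%classic : set R) = `[s, m] `|` `[m, t]).
    apply: withinU_continuous; [exact: itv_closed|exact: itv_closed| |].
      apply: subspace_eq_continuous c1 => q /set_mem; rewrite /= in_itv/= => /andP[_ qm].
      rewrite /from_subspace; exact/esym/e1.
    apply: subspace_eq_continuous c2 => q /set_mem; rewrite /= in_itv/= => /andP[qm _].
    by rewrite /from_subspace; exact/esym/e2.
  apply/seteqP; split => q; rewrite /= !in_itv/=.
    by move=> /andP[h1 h2]; rewrite h1 h2/= andbT; exact/orP/le_total.
  move=> [/andP[h1 h2]|/andP[h1 h2]]; first by rewrite h1 (le_trans h2).
  by rewrite h2 (le_trans _ h1).
- move=> c ac a1 b1 sa bt sub.
  have b1m : Num.min b1 m <= m by rewrite ge_min lexx orbT.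
  have a1m : m <= Num.max a1 m by rewrite le_max lexx orbT.
  have [|L1 L10 H1] := l1 c ac a1 (Num.min b1 m) sa b1m.
    move=> q; rewrite /= in_itv/= le_min => /and3P[h1 h2 h3]; rewrite -e1//.
    by apply: sub; rewrite /= in_itv/= h1.
  have [|L2 L20 H2] := l2 c ac (Num.max a1 m) b1 a1m bt.
    move=> q; rewrite /= in_itv/= ge_max => /andP[/andP[h1 h2] h3]; rewrite -e2//.
    by apply: sub; rewrite /= in_itv/= h1.
  exists (L1 + L2); first exact: addr_ge0.
  move=> p q ap pq qb.
  have pq0 : 0 <= q - p by rewrite subr_ge0.
  have [qm|mq] := leP q m.
    rewrite (e1 q qm) (e1 p (le_trans pq qm)).
    have := H1 p q ap pq; rewrite le_min qb qm => /(_ isT) /le_trans; apply.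
    by apply: ler_wpM2r => //; rewrite lerDl.
  have [mp|pm] := leP m p.
    rewrite (e2 q (ltW mq)) (e2 p mp).
    have := H2 p q; rewrite ge_max ap mp => /(_ isT pq qb) /le_trans; apply.
    by apply: ler_wpM2r => //; rewrite lerDr.
  have h1 := H1 p m ap (ltW pm); rewrite le_min lexx (le_trans (ltW mq) qb) in h1.
  have h2 := H2 m q; rewrite ge_max lexx (le_trans ap (ltW pm)) in h2.
  have {}h1 := h1 isT; have {}h2 := h2 isT (ltW mq) qb.
  rewrite (e2 q (ltW mq)) (e1 p (ltW pm)).
  have -> : c (g2 q) - c (g1 p) = (c (g2 q) - c (g2 m)) + (c (g1 m) - c (g1 p)).
    by rewrite g1m g2m; row_ring.
  apply: le_trans (ler_normD _ _) _.
  have k1 : L2 * (q - m) <= L2 * (q - p) by apply: ler_wpM2l => //; rewrite lerB// ltW.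
  have k2 : L1 * (m - p) <= L1 * (q - p) by apply: ler_wpM2l => //; rewrite lerB// ltW.
  rewrite mulrDl addrC; apply: lerD; exact: le_trans k1 || exact: le_trans k2.
- by rewrite e1.
- by rewrite e2.
- apply: (upper_action_glue sm mt _ _ u1 u2) => q qm.
    by apply: filterS (lt_nbhsl qm) => q' /ltW; exact: e1.
  by apply: filterS (lt_nbhsr qm) => q' /ltW; exact: e2.
Qed.

(** The chart change is continuously differentiable, so its derivative along the compact segment is
    bounded; the mean value theorem is applied to each coordinate. *)
Lemma line_chart_lipschitz c c' (y w : V) (s a b : R) : atlas X c -> atlas X c' ->
  (forall x : R, a <= x <= b -> chart_cod c (y + (x - s) *: w) /\
    chart_dom c' (chart_inv c (y + (x - s) *: w))) ->
  exists2 L : R, 0 <= L & forall x x' : R, a <= x -> x <= x' -> x' <= b ->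
    `|c' (chart_inv c (y + (x' - s) *: w)) - c' (chart_inv c (y + (x - s) *: w))|
       <= L * (x' - x).
Proof.
move=> ac ac' dom.
pose f := c' \o chart_inv c; pose l (x : R) : V := y + (x - s) *: w.
have lE x : l x = (y - s *: w) + x *: w by rewrite /l; row_ring.
have [C1 C2] := atlas_C2 ac ac'.
have lD (x : R) : a <= x <= b -> (c @` (chart_dom c `&` chart_dom c')) (l x).
  move=> /dom[h1 h2]; exists (chart_inv c (l x)); first by split => //; exact: chart_inv_dom.
  exact: chart_invK.
have dl (x : R) : a <= x <= b -> is_derive x 1 (fun x : R => f (l x)) ('d f (l x) w).
  move=> /lD xd; have := C1 _ xd; rewrite lE => /line_is_derive.
  by rewrite (_ : (fun s0 : R => f _) = (fun x : R => f (l x)))//; apply/funext => q; rewrite lE.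
have cl : continuous (l : R -> V).
  move=> x; apply: cvgD; first exact: cvg_cst.
  apply: cvgZr_tmp; apply: cvgB; [exact: cvg_id|exact: cvg_cst].
have cd (x : R) : a <= x <= b -> {for x, continuous (fun x : R => `|'d f (l x) w| : R^o)}.
  move=> /lD xd; have [C3 _] := C2 w.
  have h1 := differentiable_continuous (C3 _ xd).
  apply: continuous_comp; last exact: norm_continuous.
  by apply: (@continuous_comp _ _ _ l (fun z => 'd f z w)) => //; exact: cl.
have [L L0 HL] := @compact_bounded R _ (`[a, b]%classic : set R) (fun x : R => `|'d f (l x) w|)
  (segment_compact (a := a) (b := b)) (fun x xab => cd x ltac:(by rewrite /= in_itv/= in xab)).
exists L => // x x' ax xx' x'b; apply: norm_le_coord.
  by rewrite mulr_ge0 ?subr_ge0.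
move=> i; rewrite !mxE.
have dj (q : R) : x <= q <= x' ->
    is_derive q 1 (fun z : R => (f (l z)) 0 i : R^o) (('d f (l q) w) 0 i).
  move=> /andP[xq qx].
  have qab : a <= q <= b by rewrite (le_trans ax xq) (le_trans qx x'b).
  have [d1 d2] := dl q qab; have /derivable_mxP dm := d1; split; first exact: dm.
  by rewrite -d2 (derive_mx d1) mxE.
have [q|q|q] := @MVT_segment R (fun z : R => (f (l z)) 0 i) (fun q => ('d f (l q) w) 0 i) x x' xx'.
- by rewrite in_itv/= => /andP[h1 h2]; apply: dj; rewrite !ltW.
- apply: continuous_in_subspaceT => q1 /set_mem; rewrite /= in_itv/= => /dj [h _].
  exact/differentiable_continuous/derivable1_diffP.
rewrite in_itv/= => /andP[xq qx] -> ; rewrite normrM [`|x' - x|]ger0_norm ?subr_ge0//.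
apply: ler_wpM2r; first by rewrite subr_ge0.
apply: le_trans (coord_le_norm _ _) _.
have := HL q; rewrite normr_id; apply; rewrite /= in_itv/=.
by rewrite (le_trans ax xq) (le_trans qx x'b).
Qed.

Lemma segment_reach H c a (rho s t B : R) y x : atlas X c -> cball a rho `<=` chart_cod c ->
  s < t -> cball a rho y -> cball a rho x ->
  (forall q : R, 0 <= q <= 1 ->
     lag (in_chart H c) (y + q *: (x - y)) ((t - s)^-1 *: (x - y)) <= B) ->
  reach H s t (chart_inv c y) (chart_inv c x) ((t - s) * B).
Proof.
move=> ac sub st ya xa HB; set w := (t - s)^-1 *: (x - y) in HB *.
have ts0 : 0 < t - s by rewrite subr_gt0.
have ts1 : t - s != 0 by rewrite gt_eqF.
have w_seg (z : R) : (z - s) *: w = ((z - s) / (t - s)) *: (x - y) by rewrite /w scalerA.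
have frac (z : R) : s <= z <= t -> 0 <= (z - s) / (t - s) <= 1.
  move=> /andP[sz zt]; rewrite divr_ge0 ?subr_ge0 ?(ltW st)//= ler_pdivrMr// mul1r.
  by rewrite lerB.
have inc (z : R) : s <= z <= t -> cball a rho (y + (z - s) *: w).
  by move=> /frac zf; rewrite w_seg; exact: cball_segment.
pose gamma := fun z : R => chart_inv c (y + (z - s) *: w).
have cl : continuous (fun z : R => y + (z - s) *: w : V).
  move=> z; apply: cvgD; first exact: cvg_cst.
  apply: cvgZr_tmp; apply: cvgB; [exact: cvg_id|exact: cvg_cst].
have cg (z : R) : s <= z <= t -> {for z, continuous gamma}.
  move=> /inc /sub zc.
  apply: (@continuous_comp _ _ _ (fun z : R => y + (z - s) *: w : V) (chart_inv c)).
    exact: cl.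
  exact: chart_inv_cvg.
exists gamma; split; [split| | |].
- by apply: continuous_in_subspaceT => z /set_mem; rewrite /= in_itv/=; exact: cg.
- move=> c' ac' a1 b1 sa bt dom; apply: line_chart_lipschitz => // z /andP[az zb].
  split; last by apply: (dom z); rewrite /= in_itv/= az.
  by apply: sub; apply: inc; rewrite (le_trans sa az) (le_trans zb bt).
- by rewrite /gamma subrr scale0r addr0.
- by rewrite /gamma w_seg divff// scale1r addrC subrK.
have mO : measurable (`]s, t[%classic : set T) by exact: measurable_itv.
have BiO : mu.-integrable (`]s, t[ : set T) (EFin \o (fun=> B)).
  exact: cst_integrable_oo.
have [f1 f2 f3 f4] := supported_patch BiO.
eexists; split; [exact: f1|exact: f2| |].
  apply: aeW => z sz; rewrite sz.
  have szt : s <= z <= t by move: sz => /andP[h1 h2]; rewrite !ltW.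
  have zc : chart_cod c (y + (z - s) *: w) by apply: sub; exact: inc.
  have nc : \forall q \near z, (c \o gamma) q = y + (q - s) *: w.
    have : z \in `]s, t[ by rewrite in_itv/=.
    move=> /near_in_itvoo; apply: filterS => q; rewrite /= in_itv/= => /andP[h1 h2].
    by rewrite chart_invK//; apply: sub; apply: inc; rewrite !ltW.
  have dw : is_derive z 1 (c \o gamma : R -> V) w.
    have ne : \near z, (fun q : R => y + (q - s) *: w) z = (c \o gamma) z.
      by apply: filterS nc => q ->.
    apply: (near_eq_is_derive ne); have := @line_is_derive R V V id (y - s *: w) w z.
    rewrite diff_val => H1; rewrite (_ : (fun q : R => _) = (fun q => id (y - s *: w + q *: w))).
      exact: H1.
    by apply/funext => q /=; row_ring.
  rewrite /speed_lagrangian (lagrangian_velocity H ac (cg z szt) (chart_inv_dom zc) dw).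
  by rewrite chart_invK// w_seg; apply: HB; exact: frac.
by rewrite f4 integral_cst_oo.
Qed.

(** The chain becomes a broken line. Its discrete cost uses the Lagrangian at the origin of each
    step; along the segment this is off by at most [L * (A * h)], which vanishes with [h]. *)
Lemma chain_reach H c a (r K A C0 C1 R0 C L h s : R) k y x b :
  atlas X c -> cball a (8 * r) `<=` chart_cod c ->
  dp_constants (in_chart H c) a r K A C0 C1 R0 C L -> 0 < h ->
  cball a (8 * r) y -> chain (in_chart H c) a r A h k y x b ->
  reach H s (s + k%:R * h) (chart_inv c y) (chart_inv c x) (b + k%:R * h * (L * (A * h))).
Proof.
move=> ac sub dp h0 ya; elim: k x b => [|k IH] x b.
  by move=> [<- ->]; rewrite !mul0r !addr0; exact: reach_refl.
move=> [x1 [b1 [/IH h1 x1a xa xx1 ->]]].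
have [_ _ _ _ [_ L0]] := dp_pos dp.
have sk : s + k.+1%:R * h = (s + k%:R * h) + h by rewrite -natr1; ring.
rewrite sk; have := @segment_reach H c a (8 * r) (s + k%:R * h) (s + k%:R * h + h)
  (lag (in_chart H c) x1 (h^-1 *: (x - x1)) + L * (A * h)) x1 x ac sub.
rewrite (_ : s + k%:R * h + h - (s + k%:R * h) = h); last (by ring); move=> h2.
have wA : `|h^-1 *: (x - x1)| <= A.
  by rewrite (speed_le h0).
have {}h2 : reach H (s + k%:R * h) (s + k%:R * h + h) (chart_inv c x1) (chart_inv c x)
    (h * (lag (in_chart H c) x1 (h^-1 *: (x - x1)) + L * (A * h))).
  apply: h2 => //; first by rewrite ltrDl.
  move=> q q01; have xqa : cball a (8 * r) (x1 + q *: (x - x1)) by exact: cball_segment.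
  have := le_trans (ler_norm _) (dp_lipschitz dp x1a wA xqa wA).
  have -> : h^-1 *: (x - x1) - h^-1 *: (x - x1) = 0 by exact: subrr.
  have -> : x1 + q *: (x - x1) - x1 = q *: (x - x1) by row_ring.
  move: (lag _ _ _) (lag _ _ _) => l1 l2; rewrite normr0 addr0 lerBlDl => /le_trans; apply.
  apply: lerD => //; apply: ler_wpM2l => //.
  rewrite normrZ; move: q01 => /andP[q0 q1]; rewrite ger0_norm//; apply: le_trans xx1.
  by rewrite -[leRHS]mul1r; apply: ler_wpM2r.
have kh0 : 0 <= k%:R * h by rewrite mulr_ge0// ltW.
have := reach_glue _ _ h1 h2; rewrite !lerDl kh0 (ltW h0) => /(_ isT isT).
by apply: reach_le; rewrite le_eqVlt; apply/orP; left; apply/eqP; rewrite -natr1; ring.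
Qed.

End lipschitz_curves.

Lemma lee_addgt0_mul {R : realType} (x y : \bar R) (t : R) : 0 <= t ->
  (forall e : R, 0 < e -> (x <= y + (t * e)%:E)%E) -> (x <= y)%E.
Proof.
move=> t0 H; apply/lee_addgt0Pr => e e0; have t1 : 0 < t + 1 by rewrite ltr_wpDl.
apply: le_trans (H (e / (t + 1)) _) _; first by rewrite divr_gt0.
rewrite leeD2l// lee_fin mulrA ler_pdivrMr// mulrC; apply: ler_wpM2l; first exact: ltW.
by rewrite lerDl.
Qed.

(** * Supergradients on an energy level characterize evolution by a constant drift *)

Section weak_kam_criterion.
Context {R : realType} {n : nat} {M : topologicalType} (X : C2_manifold R n M).
Context (g : riemannian_metric X) (H : cotangent_bundle X -> R).
Hypothesis tH : tonelli g H.
Local Notation V := 'rV[R]_n.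
Context (N : nat) (c : 'I_N -> chart R n M) (a : 'I_N -> V) (r : 'I_N -> R).
Hypothesis hc : chart_cover X c a r.
Local Notation F j := (in_chart H (c j)).

Lemma cover_nice j : nice_ham (F j) (a j) (8 * r j).
Proof. by apply: in_chart_nice tH (cover_atlas hc j) (cover_cod hc (j:=j)). Qed.

Lemma cball_le (y : V) (s s' : R) x : s <= s' -> cball y s x -> cball y s' x.
Proof. by move=> ss h; apply: le_trans h ss. Qed.

Lemma cover_step j (k d : R) x z : cball (a j) (k * r j) x -> `|z| <= d -> d <= r j ->
  cball (a j) ((k + 1) * r j) (x + z).
Proof.
rewrite /cball/= => xa zd dr; rewrite (_ : x + z - a j = (x - a j) + z); last by row_ring.
by apply: le_trans (ler_normD _ _) _; rewrite mulrDl mul1r lerD// (le_trans zd).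
Qed.

Lemma partition_itv (t : R) (m k : nat) : 0 <= t -> (k <= m.+1)%N ->
  0 <= k%:R * (t / m.+1%:R) <= t.
Proof.
move=> t0 km; rewrite mulr_ge0 ?divr_ge0//= mulrA ler_pdivrMr// mulrC.
by rewrite ler_wpM2l// ler_nat.
Qed.

Lemma small_step (t d : R) : 0 <= t -> 0 < d -> exists m : nat, t / m.+1%:R <= d.
Proof.
move=> t0 d0; have [m hm] : exists m : nat, t / d < m.+1%:R.
  exists (Num.truncn (t / d)); have := truncn_itv (divr_ge0 t0 (ltW d0)).
  by move=> /andP[_].
by exists m; rewrite ler_pdivrMr// mulrC -ler_pdivrMr// ltW.
Qed.

(** A form of [H(x, dv) = c0] that asks for one suitable supergradient at each point, with constants
    uniform over the cover. It implies both inequalities between [v] and its evolution. *)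
Definition superdiff_level (c0 : R) (v : M -> R) (C R0 e0 : R) :=
  forall j x, cball (a j) (r j) x -> exists p, [/\ `|p| <= R0, F j (x, p) = c0 &
    forall z, `|z| <= e0 -> v (chart_inv (c j) (x + z)) <=
      v (chart_inv (c j) x) + pairing p z + C * `|z| ^+ 2].

Lemma min_radius : exists2 r0 : R, 0 < r0 & forall j, r0 <= r j.
Proof.
apply: finite_min => [j s s' _ ss h|j]; first exact: le_trans ss h.
by exists (r j) => //; exact: cover_pos hc j.
Qed.

(** The curve has no speed bound, so the errors [C * |D| ^ 2] of the steps cannot be summed
    directly. Tilting the supergradient [p] by a covector [q] of norm at most [C * d], aligned with
    the displacement [D], absorbs them since [|D| <= d], and changes [H] by at most [eps]. *)
Lemma subsolution_of_superdiff c0 v (C R0 e0 : R) : 0 <= C -> 0 < e0 ->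
  superdiff_level c0 v C R0 e0 -> forall t gamma, 0 < t -> abs_continuous_curve X t gamma ->
  ((v (gamma t) - t * c0)%:E <= (v (gamma 0))%:E + action H t gamma)%E.
Proof.
move=> C0 e00 sd t gamma t0 acg; apply: (@lee_addgt0_mul R _ _ t (ltW t0)) => eps eps0.
have [L L0 HL] : exists2 L : R, 0 <= L & forall j y q y' q', cball (a j) (8 * r j) y ->
    `|q| <= R0 + 1 -> cball (a j) (8 * r j) y' -> `|q'| <= R0 + 1 ->
    `|F j (y', q') - F j (y, q)| <= L * (`|y' - y| + `|q' - q|).
  apply: finite_max => [j s s' ss h y q y' q' h1 h2 h3 h4|j].
    by apply: le_trans (h _ _ _ _ h1 h2 h3 h4) _; apply: ler_wpM2r => //; rewrite addr_ge0.
  by have [L _ HL] := nice_lipschitz (cover_nice j) (R0 + 1); exists L.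
have [r0 r00 rj] := min_radius.
have [d [d0 de dC dr dL]] : exists d : R, [/\ 0 < d, d <= e0, C * d <= 1, d <= r0 &
    L * (d + C * d) <= eps].
  have C1 : 0 < C + 1 by rewrite ltr_wpDl.
  have L1 : 0 < (L + 1) * (C + 1) by rewrite mulr_gt0// ltr_wpDl.
  exists (Num.min (Num.min e0 (C + 1)^-1) (Num.min r0 (eps / ((L + 1) * (C + 1))))).
  set d := Num.min _ _.
  have d0 : 0 < d by rewrite !lt_min e00 r00 invr_gt0 C1 divr_gt0.
  have : d <= d by []; rewrite {2}/d !le_min => /andP[/andP[h1 h2] /andP[h3 h4]].
  split => //.
    rewrite -[1](mulfV (lt0r_neq0 C1)); apply: ler_pM => //; [exact: ltW|by rewrite lerDl].
  rewrite ler_pdivlMr// in h4; apply: le_trans h4.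
  have -> : L * (d + C * d) = d * (L * (C + 1)) by ring.
  by apply: ler_wpM2l (ltW d0) _ _ _; apply: ler_wpM2r (ltW C1) _ _ _; rewrite lerDl.
have [eta eta0 mod] := curve_modulus hc acg.1 d0.
have [m hm] := small_step (ltW t0) eta0.
pose h := t / m.+1%:R; have h0 : 0 < h by rewrite divr_gt0.
have step (k : nat) : (k <= m.+1)%N ->
    lower_action H gamma 0 (k%:R * h) (v (gamma (k%:R * h)) - v (gamma 0) - k%:R * h * (c0 + eps)).
  elim: k => [_|k IH km]; first by rewrite !mul0r !subrr; exact: lower_action_refl.
  have sk := partition_itv (ltW t0) (ltnW km); have sk1 := partition_itv (ltW t0) km.
  rewrite -/h in sk sk1; set s := k%:R * h in IH sk *; set s' := k.+1%:R * h in sk1 *.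
  have ss' : s' = s + h by rewrite /s' /s -natr1; ring.
  have {}IH := IH (ltnW km).
  have [j [xd xa]] := cover_all hc (gamma s).
  have r1 := cover_pos hc j.
  have near_s (q : R) : s <= q <= s' ->
      in_ball (c j) (a j) (8 * r j) (gamma q) /\ `|c j (gamma q) - c j (gamma s)| <= d.
    move=> /andP[sq qs].
    have qt : 0 <= q <= t.
      by move: sk sk1 => /andP[k1 _] /andP[_ k2]; rewrite (le_trans k1 sq) (le_trans qs k2).
    have sqe : `|s - q| <= eta by rewrite distrC ger0_norm ?subr_ge0//; rewrite -/h in hm; lra.
    have xa7 : in_ball (c j) (a j) (7 * r j) (gamma s).
      by split => //; apply: cball_le xa; move: r1; goal_lra.
    have [h1 h2] := mod j s q sk qt sqe xa7; split => //; split => //.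
    rewrite (_ : c j (gamma q) = c j (gamma s) + (c j (gamma q) - c j (gamma s))); last by row_ring.
    apply: cball_le (@cover_step j 1 d _ _ _ h2 (le_trans dr (rj j))); last by rewrite mul1r.
    lra.
  have [p [pR pc sup]] := sd j _ xa.
  set D := c j (gamma s') - c j (gamma s).
  have ss'le : s <= s' by rewrite ss' lerDl ltW.
  have [[s'd _]] : in_ball (c j) (a j) (8 * r j) (gamma s') /\ `|D| <= d.
    by apply: near_s; rewrite ss'le lexx.
  move=> Dd.
  have [q qC qD] := @exists_aligned R n (C * d) D (mulr_ge0 C0 (ltW d0)).
  have piece := @lower_piece R n M X H (c j) (a j) (8 * r j) gamma t s s' (c0 + eps) (p + q)
    (cover_nice j) (cover_atlas hc j) acg.
  have {}piece : lower_action H gamma s s' (pairing (p + q) D - (s' - s) * (c0 + eps)).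
    apply: piece => //; [by case/andP: sk|by case/andP: sk1|].
    move=> z /near_s[zb zd]; split => //.
    have pq : `|p + q| <= R0 + 1 by apply: le_trans (ler_normD _ _) _; apply: lerD => //;
      exact: le_trans qC dC.
    have pR1 : `|p| <= R0 + 1 by apply: le_trans pR _; rewrite lerDl.
    have x8 : cball (a j) (8 * r j) (c j (gamma s)) by apply: cball_le xa; move: r1; goal_lra.
    have := le_trans (ler_norm _) (HL j _ _ _ _ x8 pR1 zb.2 pq); rewrite pc lerBlDl => /le_trans; apply.
    rewrite lerD2l; apply: le_trans dL; apply: ler_wpM2l => //; apply: lerD => //.
    by rewrite addrAC subrr add0r.
  have s0 : 0 <= s by case/andP: sk.
  apply: lower_action_le (lower_action_glue s0 ss'le IH piece).
  have := sup D (le_trans Dd de).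
  have -> : c j (gamma s) + D = c j (gamma s') by rewrite /D addrC subrK.
  rewrite !chart_mapK// => sup'.
  have CD : C * `|D| ^+ 2 <= C * d * `|D|.
    by rewrite expr2 mulrA; apply: ler_wpM2r => //; exact: ler_wpM2l.
  have := pairingDl p q D; move: qD CD sup'.
  move: (pairing _ _) (pairing _ _) (pairing _ _) (v _) (v _) (C * _) (C * _ * _).
  by move=> p1 p2 p3 v1 v2 v3 v4 k1 k2 k3 k4; rewrite ss' mulrDl; lra.
have := step m.+1 (leqnn _); have -> : m.+1%:R * h = t by rewrite /h mulrC divfK.
move=> /lower_action_action le.
apply: (@le_trans _ _ ((v (gamma 0))%:E + (v (gamma t) - v (gamma 0) - t * (c0 + eps))%:E
   + (t * eps)%:E)%E).
  by rewrite -!EFinD lee_fin; goal_lra.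
by rewrite leeD2r// leeD2l.
Qed.

(** Equality case of Fenchel's inequality: by fiber convexity [p] maximizes the expression defining
    [lag] at the velocity [gradp G (y, p)]. *)
Lemma lag_gradp (G : V * V -> R) b (rho : R) y p : nice_ham G b rho -> cball b rho y ->
  lag G y (gradp G (y, p)) <= pairing p (gradp G (y, p)) - G (y, p).
Proof.
move=> hG yb; apply: (lag_le hG yb) => q.
have [l l0 [C C0 HC]] := nice_convex hG (Num.max `|p| `|q|).
have p1 : `|p| <= Num.max `|p| `|q| by rewrite le_max lexx.
have q1 : `|q| <= Num.max `|p| `|q| by rewrite le_max lexx orbT.
have := HC y p y q yb p1 yb q1; rewrite subrr pairing0r normr0 expr0n/= mulr0 subr0 addr0.
have lq : 0 <= l * `|q - p| ^+ 2 by apply: mulr_ge0 (ltW l0) (exprn_ge0 _ _).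
rewrite (pairingC _ (q - p)) pairingBl.
move: lq; move: (pairing _ _) (pairing _ _) (l * _) (G _) (G _) => a1 a2 a3 a4 a5 *; lra.
Qed.

(** A competitor is built backward from [x]: at each step a supergradient on the level is chosen
    anew, and its velocity [gradp] makes Fenchel's inequality an equality. A step of length [h]
    loses at most [h * eps], its error being of order [h ^ 2]. *)
Lemma supersolution_of_superdiff c0 v (C R0 e0 : R) : 0 <= C -> 0 <= R0 -> 0 < e0 ->
  superdiff_level c0 v C R0 e0 -> forall t x, 0 < t ->
  (lax_oleinik H t v x <= (v x - t * c0)%:E)%E.
Proof.
move=> C0 R00 e00 sd t x t0; apply: (@lee_addgt0_mul R _ _ t (ltW t0)) => eps eps0.
have [W W0 HW] : exists2 W : R, 0 <= W & forall j y q, cball (a j) (8 * r j) y ->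
    `|q| <= R0 -> `|gradp (F j) (y, q)| <= W.
  apply: finite_max => [j s s' ss h y q h1 h2|j]; first exact: le_trans (h _ _ h1 h2) ss.
  by have [W _ HW] := nice_bounded (cover_nice j) R0; exists W => y q h1 h2; have [] := HW y q h1 h2.
have [L L0 HL] : exists2 L : R, 0 <= L & forall j y v y' v', cball (a j) (8 * r j) y ->
    `|v| <= W -> cball (a j) (8 * r j) y' -> `|v'| <= W ->
    `|lag (F j) y' v' - lag (F j) y v| <= L * (`|y' - y| + `|v' - v|).
  apply: finite_max => [j s s' ss h y q y' q' h1 h2 h3 h4|j].
    by apply: le_trans (h _ _ _ _ h1 h2 h3 h4) _; apply: ler_wpM2r => //; rewrite addr_ge0.
  by have [L _ HL] := lag_lipschitz (cover_nice j) W; exists L.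
have [r0 r00 rj] := min_radius.
have W1 : 0 < W + 1 by rewrite ltr_wpDl.
have K1 : 0 < C * W ^+ 2 + L * W + 1.
  by rewrite ltr_wpDl// addr_ge0 ?mulr_ge0 ?exprn_ge0.
pose d := Num.min (eps / (C * W ^+ 2 + L * W + 1)) (Num.min (e0 / (W + 1)) (r0 / (W + 1))).
have d0 : 0 < d by rewrite !lt_min !divr_gt0.
have [m hm] := small_step (ltW t0) d0.
pose h := t / m.+1%:R; have h0 : 0 < h by rewrite divr_gt0.
move: hm; rewrite -/h /d !le_min !ler_pdivlMr// => /and3P[hK he hr].
have hWle : h * W <= h * (W + 1) by apply: ler_wpM2l (ltW h0) _ _ _; rewrite lerDl.
have hWe : h * W <= e0 := le_trans hWle he; have hWr : h * W <= r0 := le_trans hWle hr.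
have step (k : nat) : exists y b, reach H (t - k%:R * h) t y x b /\
    v y + b <= v x - k%:R * h * c0 + k%:R * h * eps.
  elim: k => [|k [y [b [yb le]]]].
    exists x, 0; rewrite mul0r subr0; split; first exact: reach_refl.
    by rewrite !mul0r subr0 !addr0.
  have [j [yd ya]] := cover_all hc y; have r1 := cover_pos hc j.
  have y8 : cball (a j) (8 * r j) (c j y) by apply: cball_le ya; move: r1; goal_lra.
  have [p [pR pc sup]] := sd j _ ya.
  set w := gradp (F j) (c j y, p).
  have wW : `|w| <= W by exact: HW.
  have hw : `|- (h *: w)| <= h * W.
    by rewrite normrN normrZ gtr0_norm//; apply: ler_wpM2l => //; exact: ltW.
  have y28 : cball (a j) (8 * r j) (c j y + - (h *: w)).
    apply: cball_le (@cover_step j 1 (h * W) _ _ _ hw (le_trans hWr (rj j))); first by move: r1; goal_lra.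
    by rewrite mul1r.
  have lw := lag_gradp p (cover_nice j) y8; rewrite -/w pc in lw.
  have := @segment_reach R n M X H (c j) (a j) (8 * r j) (t - k.+1%:R * h) (t - k%:R * h)
    (pairing p w - c0 + L * (h * W)) _ _ (cover_atlas hc j) (cover_cod hc (j:=j)) _ y28 y8.
  have -> : c j y - (c j y - h *: w) = h *: w by row_ring.
  have -> : t - k%:R * h - (t - k.+1%:R * h) = h by rewrite -natr1; ring.
  rewrite scalerA mulVf ?gt_eqF// scale1r chart_mapK// => sr.
  have {}sr := sr _ _; exists (chart_inv (c j) (c j y + - (h *: w))).
  exists (h * (pairing p w - c0 + L * (h * W)) + b); split.
    apply: reach_glue yb.
    - by rewrite lerD2l lerN2 (ler_pM2r h0) ler_nat.
    - by rewrite gerBl mulr_ge0// ltW.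
    apply: sr => [|q /andP[q0 q1]].
      by rewrite ltrD2l ltrN2 ltr_pM2r// ltr_nat.
    have hq : c j y + - (h *: w) + q *: (h *: w) = c j y + (1 - q) *: (- (h *: w)) by row_ring.
    have nq : `|(1 - q) *: (- (h *: w))| <= h * W.
      rewrite normrZ ger0_norm ?subr_ge0//; apply: le_trans hw.
      by rewrite -[leRHS]mul1r; apply: ler_wpM2r => //; rewrite gerBl.
    have z8 : cball (a j) (8 * r j) (c j y + (1 - q) *: (- (h *: w))).
      apply: cball_le (@cover_step j 1 (h * W) _ _ _ nq (le_trans hWr (rj j))); first by move: r1; goal_lra.
      by rewrite mul1r.
    rewrite hq; have := le_trans (ler_norm _) (HL j _ _ _ _ y8 wW z8 wW).
    have -> : w - w = 0 by exact: subrr.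
    have -> : c j y + (1 - q) *: (- (h *: w)) - c j y = (1 - q) *: (- (h *: w)) by row_ring.
    rewrite normr0 addr0 => le1.
    have le2 : L * `|(1 - q) *: (- (h *: w))| <= L * (h * W) by exact: ler_wpM2l.
    move: lw le1 le2; move: (lag _ _ _) (lag _ _ _) (pairing _ _) (L * _) (L * _).
    by move=> k1 k2 k3 k4 k5 *; lra.
  have := sup _ (le_trans hw hWe); rewrite chart_mapK// pairingNr pairingZr => sup'.
  have C2 : C * `|- (h *: w)| ^+ 2 <= C * (h * W) ^+ 2.
    by apply: ler_wpM2l => //; apply: lerXn2r => //; rewrite nnegrE ?mulr_ge0// ltW.
  have hKh : h * (h * (C * W ^+ 2 + L * W)) <= h * eps.
    apply: ler_wpM2l (ltW h0) _ _ _; apply: le_trans hK; apply: ler_wpM2l (ltW h0) _ _ _.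
    by rewrite lerDl.
  have e1 : h * (L * (h * W)) + C * (h * W) ^+ 2 = h * (h * (C * W ^+ 2 + L * W)) by ring.
  rewrite -e1 in hKh; rewrite -natr1 !(mulrDl _ 1) mul1r !(mulrDl (k%:R * h) h) (mulrDr h (_ - _))
    (mulrBr h).
  move: le sup' C2 hKh; move: (v _) (v y) (v x) (C * _) (C * _) (h * pairing p w).
  move: (h * (L * _)) (h * c0) (h * eps) (k%:R * h * c0) (k%:R * h * eps) ; goal_lra.
have [y [b [yb le]]] := step m.+1.
have e : m.+1%:R * h = t by rewrite /h mulrC divfK.
rewrite e subrr in yb le; apply: le_trans (lax_oleinik_reach v yb) _.
by rewrite -EFinD lee_fin.
Qed.

Lemma lax_oleinik_of_superdiff c0 v (C R0 e0 : R) : 0 <= C -> 0 <= R0 -> 0 < e0 ->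
  superdiff_level c0 v C R0 e0 -> forall t x, 0 < t ->
  lax_oleinik H t v x = (v x - t * c0)%:E.
Proof.
move=> C0 R00 e00 sd t x t0; apply/eqP; rewrite eq_le.
rewrite (supersolution_of_superdiff C0 R00 e00 sd)//=.
apply: le_ereal_inf_tmp => _ [gamma [acg <-] <-].
exact: (subsolution_of_superdiff C0 e00 sd).
Qed.

End weak_kam_criterion.

(** * One-step estimates for the discrete value *)

Lemma barrier_lipschitz {R : realType} (K b1 b2 D e1 e2 s : R) : 0 <= D ->
  b1 - b2 <= K * D -> e2 - e1 <= D ->
  b1 + Num.max 0 (s - e1) - (b2 + Num.max 0 (s - e2)) <= (K + 1) * D.
Proof.
by rewrite mulrDl mul1r; case: (leP 0 (s - e1)) => ?; case: (leP 0 (s - e2)) => ?; lra.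
Qed.

Lemma value_step_arith {R : realType} (t b0 b1 b2 b3 b4 b5 b6 b7 : R) : b1 - b2 <= b3 -> b3 <= b4 -
  t * b4 -> b5 <= b6 + (t * b4 - b7) -> b0 <= b1 + b5 -> b0 <= b2 + b4 - b7 + b6.
Proof. lra. Qed.

Lemma rough_arith {R : realType} (K C2 h b1 b2 b3 D b5 : R) : b1 - b2 <= K * D -> b1 - b3 - (b5 +
  h) * C2 <= b2 - b3 - b5 * C2 + (K * D - (b5 + h - b5) * C2).
Proof. lra. Qed.

Lemma barrier_arith {R : realType} (K C2 h b1 b2 b3 D b5 : R) : b1 - b2 <= (K + 1) * D -> b1 - b3 -
  (b5 + h) * C2 <= b2 - b3 - b5 * C2 + ((K + 1) * D - h * C2).
Proof. lra. Qed.

Lemma fine_arith {R : realType} (L L' d h b1 b2 b3 b4 b5 b6 b7 : R) : b1 <= b2 + b3 - h * b4 + b6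
  -> b6 <= h * (L * d) -> b1 - b5 - (b7 + h) * ((L' + L) * d) <= b2 - b5 - b7 * ((L' + L) * d) +
    (b3 - h * (b4 + L' * d)).
Proof. lra. Qed.

Section discrete_value.
Context {R : realType} {n : nat}.
Local Notation V := 'rV[R]_n.
Variables (F : V * V -> R) (a : V) (r K A C0 C1 R0 C L h tau : R) (u : V -> R).
Hypothesis dp : dp_constants F a r K A C0 C1 R0 C L.
Hypothesis hF : nice_ham F a (8 * r).
Hypothesis h0 : 0 < h.
Hypothesis r0 : 0 < r.
Hypothesis tauA : A * tau <= r / 2.
Hypothesis tauL : L * tau <= 1.
Hypothesis u_lip : forall x y, cball a (8 * r) x -> cball a (8 * r) y ->
  `|u x - u y| <= K * `|x - y|.
Local Notation dval := (dval F A h u).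

Lemma cball78 x : cball a (7 * r) x -> cball a (8 * r) x.
Proof. by have r0' := r0; apply: cball_le; lra. Qed.

(** Standing still costs at most [C0] per unit of time. *)
Lemma dval_rest k x : k%:R * h <= tau -> cball a (7 * r) x -> dval k x <= u x + k%:R * h * C0.
Proof.
move=> kh xa; have A2 : 2 <= A by rewrite (dp_A dp); have [_ ? ? _ _] := dp_pos dp; lra.
elim: k kh => [_|k IH kh]; first by rewrite !mul0r addr0.
have kh' : k%:R * h <= tau by apply: le_trans kh; apply: ler_wpM2r (ltW h0) _ _ _; rewrite ler_nat.
have xd : dom a r A h k.+1 x by exact: (dom_ball dp tauA).
have [_ /(_ x)] := dval_spec dp h0 r0 tauL u_lip kh xd.
rewrite subrr normr0 scaler0 => /(_ _)/le_trans; apply.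
  by apply: mulr_ge0; [exact: le_trans A2|exact: ltW].
have l0 := dp_rest dp (cball78 xa); have := ler_wpM2l (ltW h0) l0; have := IH kh'.
rewrite -natr1 !mulrDl mul1r; move: (k%:R * h * C0) (h * lag _ _ _) (h * C0) => *; lra.
Qed.

(* For a velocity larger than A the segment is followed at speed A only on its last part;
   as the Lagrangian grows at least with slope K + 2, this does not increase the value. *)
Lemma dval_step k y x : k.+1%:R * h <= tau -> cball a (7 * r) y -> cball a (7 * r) x ->
  exists2 p, `|p| <= R0 &
    dval k.+1 x <= dval k y + pairing p (x - y) - h * F (y, p) + h * (L * `|x - y|).
Proof.
move=> kh ya xa; have [K0 C00 C10 _ [_ L0]] := dp_pos dp.
have A2 : 2 <= A by rewrite (dp_A dp); lra.
have A0 : 0 < A by lra.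
have h1 : h != 0 by rewrite gt_eqF.
have kh' : k%:R * h <= tau by apply: le_trans kh; apply: ler_wpM2r (ltW h0) _ _ _; rewrite ler_nat.
have xd : dom a r A h k.+1 x by exact: (dom_ball dp tauA).
have [_ spec] := dval_spec dp h0 r0 tauL u_lip kh xd.
have hL0 : 0 <= h * (L * `|x - y|) by rewrite !mulr_ge0// ltW.
have [small|big] := leP `|x - y| (A * h).
  have wA : `|h^-1 *: (x - y)| <= A by rewrite (speed_le h0).
  have [p [pR lp _ _]] := dp_expand dp (cball78 ya) wA; exists p => //.
  have := spec y small; rewrite lp pairingZr mulrBr (mulrA h h^-1) mulfV// mul1r.
  move: hL0; move: (dval _ _) (dval _ _) (pairing _ _) (h * F _) (h * (L * _)) => *; lra.
have D0 : 0 < `|x - y| by apply: le_lt_trans big; rewrite mulr_ge0// ltW.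
set t := A * h / `|x - y|.
have t0 : 0 < t by rewrite divr_gt0// mulr_gt0.
have t1 : t <= 1 by rewrite ler_pdivrMr// mul1r ltW.
have tD : t * `|x - y| = A * h by rewrite /t divfK// gt_eqF.
set y' := y + (1 - t) *: (x - y).
have xy' : x - y' = t *: (x - y) by rewrite /y'; row_ring.
have y'y : y' - y = (1 - t) *: (x - y) by rewrite /y'; row_ring.
have y'a : cball a (7 * r) y' by apply: cball_segment => //; rewrite subr_ge0 t1/= gerBl ltW.
have xy'A : `|x - y'| = A * h by rewrite xy' normrZ gtr0_norm// tD.
have y'yD : `|y' - y| = (1 - t) * `|x - y| by rewrite y'y normrZ ger0_norm// subr_ge0.
set v := h^-1 *: (x - y').
have vA : `|v| <= A by rewrite (speed_le h0) xy'A.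
have vA' : `|v| = A by rewrite /v normrZ xy'A gtr0_norm ?invr_gt0// mulrCA mulVf ?mulr1.
have [p [pR lp _ _]] := dp_expand dp (cball78 ya) vA; exists p => //.
have pv : h * pairing p v = t * pairing p (x - y).
  by rewrite /v xy' !pairingZr (mulrA h h^-1) mulfV// mul1r.
have pD : (K + 1) * `|x - y| <= pairing p (x - y).
  have pvA : (K + 1) * A <= pairing p v.
    have e : (K + 2) * A = (K + 1) * A + (C0 + C1 + 2) by rewrite -(dp_A dp); ring.
    have := dp_superlinear dp v (cball78 ya); rewrite lp vA' e.
    have := lag_ge hF 0 p (cball78 ya); rewrite pairing0r sub0r.
    have := dp_rest dp (cball78 ya).
    move: (lag _ _ _) (F _) (pairing _ _) ((K + 1) * A) => b1 b2 b3 b4 *; lra.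
  have le1 := ler_wpM2l (ltW h0) pvA; rewrite pv in le1.
  rewrite -(ler_pM2l t0); apply: le_trans le1; rewrite le_eqVlt; apply/orP; left; apply/eqP.
  by rewrite [LHS]mulrCA tD; ring.
have l1 := le_trans (ler_norm _) (dp_lipschitz dp (cball78 ya) vA (cball78 y'a) vA).
rewrite (_ : v - v = 0) ?normr0 ?addr0 in l1; last exact: subrr.
have yd : dom a r A h k y by exact: (dom_ball dp tauA).
have y'd : dom a r A h k y' by exact: (dom_ball dp tauA).
have l2 := le_trans (ler_norm _) (dval_lipschitz dp h0 r0 tauL u_lip kh' y'd yd).
have := spec y'; rewrite xy'A lexx => /(_ isT); rewrite -/v.
have l3 : (K + k%:R * h * L) * `|y' - y| <= (1 - t) * pairing p (x - y).
  rewrite y'yD mulrCA; apply: ler_wpM2l; first by rewrite subr_ge0.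
  apply: le_trans pD; apply: ler_wpM2r => //; rewrite lerD2l; apply: le_trans tauL.
  by rewrite mulrC; apply: ler_wpM2l.
have l4 : h * lag F y' v <= h * (L * `|x - y|) + h * lag F y v.
  rewrite -mulrDr; apply: ler_wpM2l (ltW h0) _ _ _; rewrite -lerBlDr; apply: le_trans l1 _.
  apply: ler_wpM2l => //; rewrite y'yD -[leRHS]mul1r; apply: ler_wpM2r => //.
  by rewrite gerBl ltW.
rewrite lp mulrBr pv in l4; rewrite mulrBl mul1r in l3.
exact: value_step_arith l2 l3 l4.
Qed.

End discrete_value.

(** * The discrete value is almost below the action of every curve *)

Section value_along_curves.
Context {R : realType} {n : nat} {M : topologicalType} (X : C2_manifold R n M).
Context (g : riemannian_metric X) (H : cotangent_bundle X -> R).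
Hypothesis tH : tonelli g H.
Local Notation V := 'rV[R]_n.
Context (N : nat) (c : 'I_N -> chart R n M) (a : 'I_N -> V) (r : 'I_N -> R).
Hypothesis hc : chart_cover X c a r.
Local Notation F j := (in_chart H (c j)).

Definition tame (v : M -> R) (K : R) := forall j x y,
  cball (a j) (8 * r j) x -> cball (a j) (8 * r j) y ->
  `|v (chart_inv (c j) x) - v (chart_inv (c j) y)| <= K * `|x - y|.

Definition near_piece gamma i (s s' d : R) := forall q : R, s <= q <= s' ->
  in_ball (c i) (a i) (8 * r i) (gamma q) /\ `|c i (gamma q) - c i (gamma s)| <= d.

(** The covector is adapted to the piece, being aligned with its displacement, so the bound grows
    with the distance travelled and can pay for Lipschitz functions of the endpoint. *)
Lemma aligned_piece gamma i (t s s' d kappa B : R) : abs_continuous_curve X t gamma ->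
  0 <= s -> s <= s' -> s' <= t -> near_piece gamma i s s' d -> 0 <= kappa ->
  (forall y p, cball (a i) (8 * r i) y -> `|p| <= kappa -> F i (y, p) <= B) ->
  lower_action H gamma s s' (kappa * `|c i (gamma s') - c i (gamma s)| - (s' - s) * B).
Proof.
move=> acg s0 ss' s't np k0 HB.
have [p pk pD] := exists_aligned (c i (gamma s') - c i (gamma s)) k0.
have := lower_piece (p := p) (B := B) (cover_nice tH hc i) (cover_atlas hc i) acg s0 ss' s't.
have h : forall x : R, s <= x <= s' -> in_ball (c i) (a i) (8 * r i) (gamma x) /\
    F i (c i (gamma x), p) <= B.
  by move=> x /np [h1 _]; split => //; apply: HB => //; exact: h1.2.
by move=> /(_ h); apply: lower_action_le; rewrite lerD2r.
Qed.

Lemma nice_base_lipschitz (G : V * V -> R) b rho (R1 : R) : nice_ham G b rho ->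
  exists2 L : R, 0 <= L & forall y y' q, cball b rho y -> cball b rho y' -> `|q| <= R1 ->
    G (y', q) <= G (y, q) + L * `|y' - y|.
Proof.
move=> hG; have [L L0 HL] := nice_lipschitz hG R1; exists L => // y y' q yb y'b qR.
have := le_trans (ler_norm _) (HL y q y' q yb qR y'b qR).
have -> : q - q = 0 by exact: subrr.
by move: (G _) (G _) => a1 a2; rewrite normr0 addr0 lerBlDl.
Qed.

Section one_chart.
Variables (j : 'I_N) (K A C0 C1 R0 C L tau : R) (v : M -> R).
Hypothesis dp : dp_constants (F j) (a j) (r j) K A C0 C1 R0 C L.
Hypothesis tv : tame v K.
Hypothesis tau0 : 0 < tau.
Hypothesis tauA : A * tau <= r j / 2.
Hypothesis tauL : L * tau <= 1.
Variable C2 : R.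
Hypothesis HC2 : forall i y p, cball (a i) (8 * r i) y -> `|p| <= K + 1 -> F i (y, p) <= C2.
Hypothesis tauC : tau * (C0 + C2) <= r j / 2.

(** A competitor may leave the chart. While its grid points stay in the ball of radius [7 * r], the
    discrete value is compared with it step by step. After an excursion only the rough bound
    remains, raised on the way back by a barrier of height at least [r / 2] on the ball of radius
    [6 * r]; this exceeds the possible gain [tau * (C0 + C2)]. *)
Lemma dval_le_action gamma x (eps : R) : 0 < eps -> cball (a j) (6 * r j) x ->
  abs_continuous_curve X tau gamma -> gamma tau = chart_inv (c j) x ->
  exists m0 : nat, forall m : nat, (m0 <= m)%N ->
    ((dval (F j) A (tau / m.+1%:R) (v \o chart_inv (c j)) m.+1 x - eps)%:E <=
      (v (gamma 0%R))%:E + action H tau gamma)%E.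
Proof.
move=> eps0 xa acg gx; have [K0 C00 C10 R00 [_ L0]] := dp_pos dp.
have rj := cover_pos hc j.
have [L' L'0 HL'] := nice_base_lipschitz R0 (cover_nice tH hc j).
have [r0 r00 rmin] := min_radius hc.
have [d [d0 dr dL]] : exists d : R, [/\ 0 < d, d <= r0 / 2 & tau * ((L' + L) * d) <= eps].
  have k0 : 0 < tau * (L' + L + 1) by rewrite mulr_gt0// ltr_wpDl// addr_ge0.
  exists (Num.min (r0 / 2) (eps / (tau * (L' + L + 1)))); set d := Num.min _ _.
  have d0 : 0 < d by rewrite lt_min !divr_gt0.
  have : d <= d by []; rewrite {2}/d !le_min => /andP[h1 h2]; split => //.
  rewrite ler_pdivlMr// in h2; apply: le_trans h2.
  rewrite (_ : tau * _ = d * (tau * (L' + L))); last by ring.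
  by apply: ler_wpM2l (ltW d0) _ _ _; apply: ler_wpM2l (ltW tau0) _ _ _; rewrite lerDl.
have [eta eta0 mod] := curve_modulus hc acg.1 d0.
have [m0 hm0] := small_step (ltW tau0) eta0.
exists m0 => m m0m; set h := tau / m.+1%:R.
have h0 : 0 < h by rewrite divr_gt0.
have heta : h <= eta.
  apply: le_trans hm0; apply: ler_wpM2l (ltW tau0) _ _ _.
  by rewrite lef_pV2 ?posrE// ler_nat.
have mh : m.+1%:R * h = tau by rewrite /h mulrC divfK.
set u := v \o chart_inv (c j).
have ulip : forall x y, cball (a j) (8 * r j) x -> cball (a j) (8 * r j) y ->
    `|u x - u y| <= K * `|x - y| by exact: (tv (j := j)).
have fine k : (k <= m.+1)%N -> 0 <= k%:R * h <= tau by apply: partition_itv; exact: ltW.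
have adj k : k.+1%:R * h = k%:R * h + h by rewrite -natr1; ring.
have np i k : (k < m.+1)%N -> in_ball (c i) (a i) (7 * r i) (gamma (k%:R * h)) ->
    near_piece gamma i (k%:R * h) (k.+1%:R * h) d.
  move=> km ib q /andP[sq qs].
  have /andP[k1 k2] := fine _ (ltnW km); have /andP[k3 k4] := fine _ km.
  have qt : 0 <= q <= tau by rewrite (le_trans k1 sq) (le_trans qs k4).
  have sqe : `|k%:R * h - q| <= eta.
    by rewrite distrC ger0_norm ?subr_ge0//; rewrite adj in qs; apply: le_trans heta; rewrite lerBlDl.
  have k12 : 0 <= k%:R * h <= tau by rewrite k1.
  have [h1 h2] := mod i _ q k12 qt sqe ib; split => //; split => //.
  rewrite (_ : c i (gamma q) = c i (gamma (k%:R * h)) + (c i (gamma q) - c i (gamma (k%:R * h)))).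
    have ri := rmin i; have r1 := cover_pos hc i.
    have dri : d <= r i by lra.
    apply: cball_le (cover_step ib.2 h2 dri); goal_lra.
  by rewrite addrC subrK.
have stepK k : (k < m.+1)%N -> k%:R * h <= k.+1%:R * h by move=> _; rewrite adj lerDl ltW.
have rough (k : nat) : (k <= m.+1)%N ->
    lower_action H gamma 0 (k%:R * h) (v (gamma (k%:R * h)) - v (gamma 0) - k%:R * h * C2).
  elim: k => [_|k IH km]; first by rewrite !mul0r !subrr; exact: lower_action_refl.
  have [i ib] := cover_all hc (gamma (k%:R * h)); have r1 := cover_pos hc i.
  have ib7 : in_ball (c i) (a i) (7 * r i) (gamma (k%:R * h)).
    by case: ib => xd ix; split => //; apply: cball_le ix; move: r1; goal_lra.
  have npi := np i k km ib7.
  have /andP[k1 k2] := fine _ (ltnW km); have /andP[k3 k4] := fine _ km.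
  have KB : forall y p, cball (a i) (8 * r i) y -> `|p| <= K -> F i (y, p) <= C2.
    by move=> y p ya pK; apply: HC2 => //; apply: le_trans pK _; rewrite lerDl.
  have piece := aligned_piece acg k1 (stepK k km) k4 npi K0 KB.
  apply: lower_action_le (lower_action_glue k1 (stepK k km) (IH (ltnW km)) piece).
  have [|[d1 a1] _] := npi (k%:R * h); first by rewrite lexx stepK.
  have [|[d2 a2] _] := npi (k.+1%:R * h); first by rewrite lexx stepK.
  have := le_trans (ler_norm _) (tv a2 a1); rewrite !chart_mapK// adj.
  exact: rough_arith.
(* [beta] equals [u] beyond radius [13 / 2 * r], which is below [7 * r] by at least one grid
   displacement, and its slope [K + 1] is still covered by [C2]. *)
pose beta x := u x + Num.max 0 (13 / 2 * r j - `|x - a j|).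
have beta_lip x1 x2 : cball (a j) (8 * r j) x1 -> cball (a j) (8 * r j) x2 ->
    beta x1 - beta x2 <= (K + 1) * `|x1 - x2|.
  move=> a1 a2; have l1 := le_trans (ler_norm _) (ulip _ _ a1 a2).
  have l2 : `|x2 - a j| - `|x1 - a j| <= `|x1 - x2|.
    rewrite lerBlDr (_ : x2 - a j = (x1 - a j) - (x1 - x2)); last by row_ring.
    by apply: le_trans (ler_normB _ _) _; rewrite addrC.
  have l0 : 0 <= `|x1 - x2| by [].
  exact: barrier_lipschitz.
have fine_step (k : nat) : (k <= m.+1)%N -> in_ball (c j) (a j) (7 * r j) (gamma (k%:R * h)) ->
    lower_action H gamma 0 (k%:R * h) (dval (F j) A h u k (c j (gamma (k%:R * h))) - v (gamma 0)
        - k%:R * h * ((L' + L) * d)) \/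
    lower_action H gamma 0 (k%:R * h) (beta (c j (gamma (k%:R * h))) - v (gamma 0) - k%:R * h * C2).
  elim: k => [_|k IH km] xin.
    left; rewrite !mul0r /dval /= /u /= chart_mapK ?subrr; first exact: lower_action_refl.
    by rewrite mul0r in xin; exact: xin.1.
  have /andP[k1 k2] := fine _ (ltnW km); have /andP[k3 k4] := fine _ km.
  have e1 : k.+1%:R * h - k%:R * h = h by rewrite adj addrAC subrr add0r.
  have [yin|yout] := pselect (in_ball (c j) (a j) (7 * r j) (gamma (k%:R * h))); last first.
    right; apply: lower_action_le (rough _ km).
    rewrite /beta /u /= chart_mapK; last exact: xin.1.
    suff -> : Num.max 0 (13 / 2 * r j - `|c j (gamma (k.+1%:R * h)) - a j|) = 0.
      by rewrite addr0.
    apply/max_idPl; rewrite subr_le0 leNgt; apply/negP => small; apply: yout.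
    have se : `|k.+1%:R * h - k%:R * h| <= eta by rewrite e1 gtr0_norm.
    have k34 : 0 <= k.+1%:R * h <= tau by rewrite k3.
    have k12 : 0 <= k%:R * h <= tau by rewrite k1.
    have [h1 h2] := mod j _ _ k34 k12 se xin; split => //; rewrite /cball/=.
    rewrite (_ : c j (gamma (k%:R * h)) - a j = (c j (gamma (k.+1%:R * h)) - a j)
      + (c j (gamma (k%:R * h)) - c j (gamma (k.+1%:R * h)))); last by row_ring.
    apply: le_trans (ler_normD _ _) _; have rm := rmin j; move: small h2.
    by move: (`|_|) (`|_|) => b1 b2 *; lra.
  have npj := np j k km yin.
  have [|[xd x8] xyd] := npj (k.+1%:R * h); first by rewrite lexx stepK.
  have [yd y8] : in_ball (c j) (a j) (8 * r j) (gamma (k%:R * h)).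
    by case: yin => yd ya; split => //; apply: cball_le ya; move: rj; goal_lra.
  case: (IH (ltnW km) yin) => {}IH; last first.
    right; have K1 : 0 <= K + 1 by rewrite addr_ge0.
    have piece := aligned_piece acg k1 (stepK k km) k4 npj K1 (HC2 (i := j)).
    apply: lower_action_le (lower_action_glue k1 (stepK k km) IH piece).
    have := beta_lip _ _ x8 y8; rewrite e1 adj.
    exact: barrier_arith.
  left; set x1 := c j (gamma (k.+1%:R * h)) in xin x8 xyd *.
  set y1 := c j (gamma (k%:R * h)) in yin y8 xyd IH *.
  have [p pR step] := dval_step dp (cover_nice tH hc j) h0 rj tauA tauL ulip k4 yin.2 xin.2.
  have := lower_piece (p := p) (B := F j (y1, p) + L' * d) (cover_nice tH hc j)
    (cover_atlas hc j) acg k1 (stepK k km) k4.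
  have FB : forall q : R, k%:R * h <= q <= k.+1%:R * h ->
      in_ball (c j) (a j) (8 * r j) (gamma q) /\ F j (c j (gamma q), p) <= F j (y1, p) + L' * d.
    move=> q /npj [h1 h2]; split => //.
    apply: le_trans (HL' _ _ _ y8 h1.2 pR) _; rewrite lerD2l; exact: ler_wpM2l.
  move=> /(_ FB) piece.
  apply: lower_action_le (lower_action_glue k1 (stepK k km) IH piece).
  have hL : h * (L * `|x1 - y1|) <= h * (L * d).
    by apply: ler_wpM2l (ltW h0) _ _ _; exact: ler_wpM2l.
  rewrite e1 adj -/y1; have -> : c j (gamma (k%:R * h + h)) = x1 by rewrite /x1 adj.
  move: step hL; rewrite -/x1 -/y1.
  exact: fine_arith.
have mhx : c j (gamma (m.+1%:R * h)) = x.
  rewrite mh gx chart_invK//; apply: (cover_cod hc); apply: cball_le xa; move: rj; goal_lra.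
have xin : in_ball (c j) (a j) (7 * r j) (gamma (m.+1%:R * h)).
  split; last by rewrite mhx; apply: cball_le xa; move: rj; goal_lra.
  rewrite mh gx; apply: chart_inv_dom; apply: (cover_cod hc); apply: cball_le xa; move: rj; goal_lra.
have := fine_step m.+1 (leqnn _) xin; rewrite mhx mh.
have fin (b : R) : dval (F j) A h u m.+1 x - eps <= v (gamma 0) + b ->
    lower_action H gamma 0 tau b ->
    ((dval (F j) A h u m.+1 x - eps)%:E <= (v (gamma 0%R))%:E + action H tau gamma)%E.
  move=> le /lower_action_action lb; apply: (@le_trans _ _ ((v (gamma 0))%:E + b%:E)%E).
    by rewrite -EFinD lee_fin.
  by rewrite leeD2l.
case; apply: fin; first by rewrite addrCA; lra.
have x7 : cball (a j) (7 * r j) x by apply: cball_le xa; move: rj; goal_lra.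
have kh : m.+1%:R * h <= tau by rewrite mh.
have := dval_rest dp h0 rj tauA tauL ulip kh x7; rewrite mh /beta.
have : 13 / 2 * r j - `|x - a j| <= Num.max 0 (13 / 2 * r j - `|x - a j|).
  by rewrite le_max lexx orbT.
have xa' : `|x - a j| <= 6 * r j := xa.
have tc := tauC; rewrite mulrDr in tc; move: xa' tc.
have arith (e mx b1 b2 b3 b4 b5 : R) : e <= 6 * r j -> b4 + b5 <= r j / 2 ->
  13 / 2 * r j - e <= mx -> b1 <= b2 + b4 -> b1 - eps <= b3 + (b2 + mx - b3 - b5).
  by move: eps0; goal_lra.
exact: arith.
Qed.

End one_chart.
End value_along_curves.

(** * Passage to the limit in the time discretization *)

Lemma cluster_sequence {R : realType} {n : nat} (y p q : nat -> 'rV[R]_n) (b : nat -> R)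
    (y0 : 'rV[R]_n) (Y P Q B : R) :
  (forall m, cball y0 Y (y m)) -> (forall m, `|p m| <= P) -> (forall m, `|q m| <= Q) ->
  (forall m, `|b m| <= B) ->
  exists y' p' q' b', [/\ cball y0 Y y', `|p'| <= P, `|q'| <= Q &
    forall (e : R) (m0 : nat), 0 < e -> exists2 m : nat, (m0 <= m)%N &
      [/\ `|y m - y'| < e, `|p m - p'| < e, `|q m - q'| < e & `|b m - b'| < e]].
Proof.
move=> hy hp hq hb.
pose K := cball y0 Y `*` (cball (0 : 'rV[R]_n) P `*` (cball (0 : 'rV[R]_n) Q `*` (`[- B, B]%classic
  : set R))).
have cK : compact K.
  apply: compact_setX; first exact: cball_compact.
  apply: compact_setX; first exact: cball_compact.
  apply: compact_setX; first exact: cball_compact.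
  exact: segment_compact.
pose Z m := (y m, (p m, (q m, b m))).
have ZK m : K (Z m).
  split => //=; split; first by rewrite /cball/= subr0.
  split => /=; first by rewrite /cball/= subr0.
  by rewrite /= in_itv/= -ler_norml.
have [[y' [p' [q' b']]] [/= [Ky [Kp [Kq _]]] cl]] := cK (Z @ \oo) _ (filterE _ ZK).
exists y', p', q', b'; split => //; [by move: Kp; rewrite /cball/= subr0|by move: Kq;
  rewrite /cball/= subr0|].
move=> e m0 e0.
have n1 : nbhs (y', (p', (q', b'))) (ball y' e `*` (ball p' e `*` (ball q' e `*` ball (b' : R^o) e))).
  exists (ball y' e, ball p' e `*` (ball q' e `*` ball (b' : R^o) e)) => //.
  split; first exact: nbhsx_ballx.
  exists (ball p' e, ball q' e `*` ball (b' : R^o) e) => //.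
  split; first exact: nbhsx_ballx.
  exists (ball q' e, ball (b' : R^o) e) => //.
  by split; exact: nbhsx_ballx.
have n2 : (Z @ \oo) [set z | exists2 m, (m0 <= m)%N & z = Z m].
  by exists m0 => // m /= mm; exists m.
have [z [[m mm ->] [/= h1 [h2 [h3 h4]]]]] := cl _ _ n2 n1.
exists m => //; move: h1 h2 h3 h4; rewrite -!ball_normE/= => h1 h2 h3 h4.
by split; rewrite distrC.
Qed.

Lemma pairing_bound {R : realType} {n : nat} (p v : 'rV[R]_n) (P W : R) :
  `|p| <= P -> `|v| <= W -> pairing p v <= n%:R * P * W.
Proof.
move=> pP vW; apply: le_trans (pairing_ler _ _) _; apply: ler_pM;
  [exact: mulr_ge0|exact: normr_ge0|exact: ler_wpM2l|exact: vW].
Qed.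

Lemma add_halves {R : realType} (x y s : R) : x <= s / 2 -> y <= s / 2 -> x + y <= s.
Proof. lra. Qed.

Lemma add_quarters {R : realType} (x y s : R) : x <= s / 4 -> y <= s / 4 -> x + y <= s / 2.
Proof. lra. Qed.

Lemma norm_triangle3 {R : realType} (x y z t e1 e2 e3 : R) : `|y - x| <= e1 ->
  `|y - z| <= e2 -> `|z - t| <= e3 -> `|x - t| <= e1 + e2 + e3.
Proof.
move=> h1 h2 h3; rewrite (_ : x - t = - (y - x) + (y - z) + (z - t)); last by ring.
apply: le_trans (ler_normD _ _) _; apply: lerD h3.
by apply: le_trans (ler_normD _ _) _; rewrite normrN; exact: lerD.
Qed.

Lemma sqr_add_le {R : realType} (s d e : R) : 0 <= s -> s <= d + e -> 0 <= d -> 0 <= e ->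
  e <= 1 -> s ^+ 2 <= 2 * d ^+ 2 + 2 * e.
Proof.
move=> s0 sd d0 e0 e1; have l1 : s ^+ 2 <= (d + e) ^+ 2 by rewrite lerXn2r// nnegrE addr_ge0.
have l2 : e ^+ 2 <= e by rewrite expr2 -[leRHS]mul1r; apply: ler_wpM2r.
have l3 : 0 <= (d - e) ^+ 2 by rewrite exprn_even_ge0.
move: l1 l2 l3; rewrite sqrrD sqrrB; move: (s ^+ 2) (d ^+ 2) (e ^+ 2) (d * e) => *; lra.
Qed.

Lemma mul_le_half {R : realType} (S e e1 : R) : 0 < S -> e1 <= e / (2 * S) -> S * e1 <= e / 2.
Proof.
move=> S0; rewrite ler_pdivlMr ?mulr_gt0// => h.
by rewrite ler_pdivlMr// mulrC mulrA mulrC.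
Qed.

Section transport.
Context {R : realType} {n : nat} {M : topologicalType} (X : C2_manifold R n M).
Context (g : riemannian_metric X) (H G : cotangent_bundle X -> R).
Hypothesis tH : tonelli g H.
Hypothesis tG : tonelli g G.
Local Notation V := 'rV[R]_n.
Context (N : nat) (c : 'I_N -> chart R n M) (a : 'I_N -> V) (r : 'I_N -> R).
Hypothesis hc : chart_cover X c a r.
Variables (j : 'I_N) (K A C0 C1 R0 C L tau C2 : R) (v : M -> R).
Local Notation F := (in_chart H (c j)).
Local Notation Fk := (in_chart G (c j)).
Local Notation inv := (chart_inv (c j)).
Hypothesis poisson : forall y q, cball (a j) (8 * r j) y ->
  pairing (gradx Fk (y, q)) (gradp F (y, q)) = pairing (gradp Fk (y, q)) (gradx F (y, q)).
Hypothesis dp : dp_constants F (a j) (r j) K A C0 C1 R0 C L.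
Hypothesis tv : tame c a r v K.
Hypothesis tau0 : 0 < tau.
Hypothesis tau1 : tau <= 1.
Hypothesis tauA : A * tau <= r j / 2.
Hypothesis tauL : L * tau <= 1.
Hypothesis HC2 : forall i y p, cball (a i) (8 * r i) y -> `|p| <= K + 1 ->
  in_chart H (c i) (y, p) <= C2.
Hypothesis tauC : tau * (C0 + C2) <= r j / 2.

(** The data of optimal chains are bounded independently of the number of steps. The initial
    momentum is bounded by conservation: [Fk (y, q)] stays close to [Fk (x, p)] and [Fk] is
    superlinear. The cost is bounded above by standing still and below by Fenchel's inequality with
    the covector 0. *)
Lemma discrete_transport x : cball (a j) (6 * r j) x ->
  exists Q B E : R, [/\ 0 <= Q, 0 <= B, 0 <= E & forall m : nat, let h := tau / m.+1%:R in
  exists y p q b, [/\ dval F A h (v \o inv) m.+1 x = v (inv y) + b,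
    chain F (a j) (r j) A h m.+1 y x b, [/\ `|p| <= R0, `|q| <= Q & `|b| <= B],
    forall z z' m1, m1 <= r j / 2 -> `|z| <= m1 -> `|z'| <= m1 -> `|z - z'| <= tau ->
      exists2 b', chain F (a j) (r j) A h m.+1 (y + z') (x + z) b' &
        b' <= b + pairing p z - pairing q z' + C * (`|z - z'| ^+ 2 / tau + tau * m1 ^+ 2) &
    `|Fk (x, p) - Fk (y, q)| <= E * h]].
Proof.
move=> xa; have nF := cover_nice tH hc j; have nG := cover_nice tG hc j.
have rj := cover_pos hc j; have [K0 C00 C10 R00 [_ L0]] := dp_pos dp.
have A0 : 0 <= A by rewrite (dp_A dp); lra.
have [BF BF0 HBF] := nice_bounded nF R0.
have [CK CK0 HCK] := nice_taylor nG (R0 + BF).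
have [B2 B20 HB2] := nice_bounded nG R0.
have [C3 HC3] := nice_superlinear nG 1.
have [L' L'0 HL'] := nice_base_lipschitz 0 nF.
set E := CK * (A ^+ 2 + BF ^+ 2) * 2.
have E0 : 0 <= E by rewrite !mulr_ge0// addr_ge0// exprn_ge0.
have x8 : cball (a j) (8 * r j) x by apply: cball_le xa; move: rj; goal_lra.
have x7 : cball (a j) (7 * r j) x by apply: cball_le xa; move: rj; goal_lra.
exists (Num.max 0 (B2 + E + C3)), (K * A * tau + tau * C0 + tau * (`|F (x, 0)| + L' * (A * tau))),
  (E * tau).
split => //; first by rewrite le_max lexx.
- by rewrite !addr_ge0 ?mulr_ge0 ?addr_ge0 ?mulr_ge0// ltW.
- by rewrite mulr_ge0// ltW.
move=> m h; have h0 : 0 < h by rewrite divr_gt0.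
have mh : m.+1%:R * h = tau by rewrite /h mulrC divfK.
have kh : m.+1%:R * h <= tau by rewrite mh.
have h1 : h <= 1.
  apply: le_trans tau1; rewrite -mh -[leLHS]mul1r; apply: ler_wpM2r; first exact: ltW.
  by rewrite ler1n.
have xd : dom (a j) (r j) A h m.+1 x by exact: (dom_ball dp tauA).
have ulip : forall x y, cball (a j) (8 * r j) x -> cball (a j) (8 * r j) y ->
    `|(v \o inv) x - (v \o inv) y| <= K * `|x - y| by exact: (tv (j := j)).
have HBFx y q : cball (a j) (8 * r j) y -> `|q| <= R0 -> `|gradx F (y, q)| <= BF.
  by move=> ya qR; have [] := HBF y q ya qR.
have [y [p [q [b [bE ch pR two err]]]]] := dval_two_point dp h0 rj tauL ulip nF nG h1 poisson
  HCK CK0 BF0 HBFx kh xd.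
have dxy := chain_dist ch; rewrite mulrCA mh in dxy.
have y8 : cball (a j) (8 * r j) y.
  have -> : y = x + (y - x) by rewrite addrC subrK.
  have dxy' : `|y - x| <= r j by rewrite distrC; apply: le_trans dxy _; apply: le_trans tauA _; lra.
  by apply: cball_le (cover_step xa dxy' (lexx _)); move: rj; goal_lra.
have errE : m.+1%:R * (E * h ^+ 2) = E * tau * h by rewrite -mh; ring.
rewrite -/E errE in err.
exists y, p, q, b; split => //; last first.
  move=> z z' m1 m1r zm zm' zz; have [|b' chb' lb'] := two z z' m1 m1r zm zm'; first by rewrite mh.
  by exists b' => //; rewrite mh in lb'.
split => //.
  rewrite le_max; apply/orP; right; have := HC3 y q y8; have [Fx _ _] := HB2 x p x8 pR.
  have E1 : E * tau * h <= E.
    rewrite -mulrA -[leRHS]mulr1; apply: ler_wpM2l => //; apply: mulr_ile1 => //; exact: ltW.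
  have := le_trans (ler_norm _) Fx; have := le_trans (ler_norm _) err.
  have := le_trans (ler_norm (Fk (y, q) - Fk (x, p))) (le_trans (eq_ind _ (fun z => z <= _) (lexx
    _) _ (distrC _ _)) err).
  move: (Fk _) (Fk _) E1 => b1 b2; rewrite mul1r ; goal_lra.
have low := @chain_lower R n F (a j) (r j) K A C0 C1 R0 C L h dp h0 L' (A * tau) m.+1 y x b 0 x nF L'0.
have up := dval_rest dp h0 rj tauA tauL ulip kh x7; rewrite bE mh in up.
have l1 := le_trans (ler_norm _) (ulip _ _ x8 y8).
have l2 : K * `|x - y| <= K * A * tau by rewrite -mulrA; exact: ler_wpM2l.
have {}low : - (tau * (F (x, 0) + L' * (A * tau))) <= b.
  have low1 y1 y2 : cball (a j) (8 * r j) y1 -> cball (a j) (8 * r j) y2 ->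
      F (y1, 0) <= F (y2, 0) + L' * `|y1 - y2|.
    by move=> h2 h3; apply: HL' => //; rewrite normr0.
  have low2 : `|x - x| + m.+1%:R * (A * h) <= A * tau by rewrite subrr normr0 add0r mulrCA mh.
  by have := low low1 x8 ch low2; rewrite pairing0l sub0r mh.
have k1 : 0 <= K * A * tau by rewrite !mulr_ge0// ltW.
have k2 : 0 <= tau * C0 by rewrite mulr_ge0// ltW.
have k3 : 0 <= tau * (`|F (x, 0)| + L' * (A * tau)).
  by rewrite mulr_ge0 ?(ltW tau0)// addr_ge0// !mulr_ge0// ltW.
have k4 : tau * (F (x, 0) + L' * (A * tau)) <= tau * (`|F (x, 0)| + L' * (A * tau)).
  by apply: (ler_wpM2l (ltW tau0)); rewrite lerD2r; exact: ler_norm.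
rewrite ler_norml; move: l1 up; rewrite /comp/=; move: (v _) (v _) => v1 v2 l1 up.
apply/andP; split; first by apply: le_trans low; lra.
lra.
Qed.

(** A common cluster point of origins, momenta and costs inherits the bounds. The chains become
    curves, and the error of the conserved quantity, of order [tau / m], disappears. *)
Lemma transport_exists x : cball (a j) (6 * r j) x -> exists y p q b,
 [/\ `|x - y| <= A * tau /\ `|p| <= R0,
   ((v (inv y) + b)%:E <= lax_oleinik H tau v (inv x))%E,
   forall z z' m1 e, m1 <= r j / 4 -> `|z| <= m1 -> `|z'| <= m1 -> `|z - z'| <= tau / 2 ->
     0 < e -> reach H 0 tau (inv (y + z')) (inv (x + z))
       (b + pairing p z - pairing q z' + 2 * C * (`|z - z'| ^+ 2 / tau + tau * m1 ^+ 2) + e),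
   Fk (x, p) = Fk (y, q) &
   forall s L', 0 <= L' -> (forall y1 y2, cball (a j) (8 * r j) y1 ->
      cball (a j) (8 * r j) y2 -> F (y1, s) <= F (y2, s) + L' * `|y1 - y2|) ->
     pairing s (x - y) - tau * (F (x, s) + L' * (A * tau)) <= b].
Proof.
move=> xa; have nF := cover_nice tH hc j; have nG := cover_nice tG hc j.
have rj := cover_pos hc j; have [K0 C00 C10 R00 [C0' L0]] := dp_pos dp.
have A0 : 0 <= A by rewrite (dp_A dp); lra.
have x8 : cball (a j) (8 * r j) x by apply: cball_le xa; move: rj; goal_lra.
have [Q [B [E [Q0 B0 E0]]]] := discrete_transport xa.
move=> /choice[y] /choice[p] /choice[q] /choice[b] HZ.
have mh m : m.+1%:R * (tau / m.+1%:R) = tau by rewrite mulrC divfK.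
have h0 m : 0 < tau / m.+1%:R :> R by rewrite divr_gt0.
have yx m : cball x (A * tau) (y m).
  have [_ ch _ _ _] := HZ m; have := chain_dist ch.
  by rewrite mulrCA mh distrC.
have pP m : `|p m| <= R0 by have [_ _ []] := HZ m.
have qQ m : `|q m| <= Q by have [_ _ []] := HZ m.
have bB m : `|b m| <= B by have [_ _ []] := HZ m.
have [y' [p' [q' [b' [yx' pP' qQ' cl]]]]] := cluster_sequence yx pP qQ bB.
have near8 z : `|z - x| <= r j -> cball (a j) (8 * r j) z.
  move=> zx; have -> : z = x + (z - x) by rewrite addrC subrK.
  by apply: cball_le (cover_step xa zx (lexx _)); move: rj; goal_lra.
have At : A * tau <= r j by have ta := tauA; lra.
have y'8 : cball (a j) (8 * r j) y' by apply: near8; apply: le_trans At.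
have y8 m : cball (a j) (8 * r j) (y m) by apply: near8; apply: le_trans At; exact: yx.
have small (e : R) : 0 < e -> exists m0 : nat, forall m, (m0 <= m)%N -> tau / m.+1%:R <= e.
  move=> e0; have [m0 hm] := small_step (ltW tau0) e0; exists m0 => m mm; apply: le_trans hm.
  by apply: (ler_wpM2l (ltW tau0)); rewrite lef_pV2 ?posrE// ler_nat.
exists y', p', q', b'; split.
- by split => //; rewrite distrC.
- apply: le_ereal_inf_tmp => _ [gamma [acg gx] <-].
  apply: (@lee_addgt0_mul R _ _ (K + 2)) => [|e e0]; first by rewrite addr_ge0.
  have [m0 Hm0] := dval_le_action tH hc dp tv tau0 tauA tauL HC2 tauC e0 xa acg gx.
  have [m mm [h1 h2 h3 h4]] := cl e m0 e0.
  have [bE _ _ _ _] := HZ m; have := Hm0 m mm; rewrite bE.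
  move=> /(leeD2r ((K + 2) * e)%:E); apply: le_trans; rewrite -EFinD lee_fin.
  have l1 := le_trans (ler_norm _) (tv y'8 (y8 m)).
  have l2 : K * `|y' - y m| <= K * e by apply: ler_wpM2l => //; rewrite distrC ltW.
  have l3 : b' - b m <= e by apply: le_trans (ler_norm _) _; rewrite distrC ltW.
  have l4 := le_trans l1 l2; clear l1 l2.
  move: (v _) (v _) l3 l4 e0; move: (b m) => k1 k2 k3; rewrite mulrDl.
  by move: (K * e) => k4 *; lra.
- move=> z z' m1 e m1r zm zm' zz e0.
  have m10 : 0 <= m1 by apply: le_trans zm.
  have tn : 0 < tau^-1 by rewrite invr_gt0.
  pose S := 1 + 2 * n%:R * m1 + n%:R * Q + 2 * C * (tau^-1 + tau).
  have S1 : 1 <= S.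
    by rewrite /S -!addrA lerDl !addr_ge0 ?mulr_ge0 ?addr_ge0 ?(ltW tau0) ?(ltW tn).
  have S0 : 0 < S by apply: lt_le_trans S1.
  pose e1 := Num.min (Num.min 1 (e / (2 * S))) (Num.min (tau / 2) (r j / 4)).
  have e10 : 0 < e1 by rewrite !lt_min ltr01 !divr_gt0// mulr_gt0.
  have : e1 <= e1 by []; rewrite {2}/e1 !le_min => /andP[/andP[e1_1 e1_e] /andP[e1_t e1_r]].
  have [m0 Hm0] : exists m0 : nat, forall m, (m0 <= m)%N -> tau / m.+1%:R <= e / (2 * (tau * (L *
    A) + 1)).
    by apply: small; rewrite divr_gt0// mulr_gt0// ltr_wpDl// !mulr_ge0// ltW.
  have [m mm [h1 h2 h3 h4]] := cl e1 m0 e10.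
  set h := tau / m.+1%:R; have [bE ch _ two _] := HZ m.
  (* The curve has to start at [y' + z'], while the discrete bound is centred at [y m]; the
     discrepancy is counted as part of the displacement. This costs the factor 2 before [C] and a
     part of [e]. *)
  pose z'' := z' + (y' - y m).
  have yz : y m + z'' = y' + z' by rewrite /z''; row_ring.
  have dy : `|y' - y m| <= e1 by rewrite distrC ltW.
  have z''m : `|z''| <= m1 + e1 by apply: le_trans (ler_normD _ _) _; exact: lerD.
  have zz'' : `|z - z''| <= `|z - z'| + e1.
    rewrite (_ : z - z'' = (z - z') - (y' - y m)); last by rewrite /z''; row_ring.
    by apply: le_trans (ler_normB _ _) _; rewrite lerD2l.
  have [||||b1 chb1 lb1] := two z z'' (m1 + e1).
  + exact: add_quarters.
  + by apply: le_trans zm _; rewrite lerDl ltW.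
  + exact: z''m.
  + by apply: le_trans zz'' _; exact: add_halves.
  rewrite yz in chb1.
  have yz8 : cball (a j) (8 * r j) (y' + z').
    apply: near8; rewrite (_ : y' + z' - x = (y' - x) + z'); last by row_ring.
    apply: le_trans (ler_normD _ _) _; apply: add_halves; first exact: le_trans yx' tauA.
    apply: le_trans zm' (le_trans m1r _); apply: (ler_wpM2l (ltW rj)).
    by rewrite lef_pV2 ?posrE// ler_nat.
  have := @chain_reach R n M X H (c j) (a j) (r j) K A C0 C1 R0 C L h 0 m.+1 _ _ b1
    (cover_atlas hc j) (cover_cod hc (j := j)) dp (h0 m) yz8 chb1.
  rewrite add0r mh; apply: reach_le.
  have hL : tau * (L * (A * h)) <= e / 2.
    have := Hm0 m mm; rewrite -/h => hm.
    have k0 : 0 <= tau * (L * A) by rewrite !mulr_ge0// ltW.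
    have k1 : 0 < 2 * (tau * (L * A) + 1) by rewrite mulr_gt0// ltr_wpDl.
    have -> : tau * (L * (A * h)) = (tau * (L * A)) * h by ring.
    have k2 : 0 < tau * (L * A) + 1 by rewrite ltr_wpDl.
    apply: le_trans (mul_le_half k2 hm); by apply: (ler_wpM2r (ltW (h0 m))); rewrite lerDl.
  have pz : pairing (p m) z <= pairing p' z + n%:R * e1 * m1.
    rewrite -lerBlDl -pairingBl.
    by apply: pairing_bound => //; exact: ltW.
  have qz : - pairing (q m) z'' <= - pairing q' z' + n%:R * e1 * m1 + n%:R * Q * e1.
    have -> : - pairing (q m) z'' = - pairing q' z' + pairing (q' - q m) z' + pairing (q m) (y m - y').
      by rewrite /z'' !(pairingDr, pairingNr, pairingDl, pairingNl); ring.
    apply: lerD; [rewrite lerD2l|]; apply: pairing_bound => //; last exact: ltW.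
    by rewrite distrC ltW.
  have s1 := sqr_add_le (normr_ge0 _) zz'' (normr_ge0 _) (ltW e10) e1_1.
  have s2 := sqr_add_le (addr_ge0 m10 (ltW e10)) (lexx _) m10 (ltW e10) e1_1.
  have Cs : C * (`|z - z''| ^+ 2 / tau + tau * (m1 + e1) ^+ 2) <=
     2 * C * (`|z - z'| ^+ 2 / tau + tau * m1 ^+ 2) + 2 * C * (tau^-1 + tau) * e1.
    have -> : 2 * C * (`|z - z'| ^+ 2 / tau + tau * m1 ^+ 2) + 2 * C * (tau^-1 + tau) * e1 =
      C * ((2 * `|z - z'| ^+ 2 + 2 * e1) / tau + tau * (2 * m1 ^+ 2 + 2 * e1)) by ring.
    apply: ler_wpM2l => //; apply: lerD; first by apply: ler_wpM2r s1; exact: ltW.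
    by apply: ler_wpM2l s2; exact: ltW.
  have Se : S * e1 <= e / 2 by exact: mul_le_half.
  have bb : b m <= b' + e1 by rewrite -lerBlDl; exact: le_trans (ler_norm _) (ltW h4).
  have SE : S * e1 = e1 + n%:R * e1 * m1 + n%:R * e1 * m1 + n%:R * Q * e1 + 2 * C * (tau^-1 + tau) * e1.
    by rewrite /S; ring.
  rewrite SE in Se; move: lb1 hL pz qz Cs Se bb.
  move: (C * (_ + _)) (2 * C * (_ + _)) (2 * C * _ * e1) (pairing _ _) (pairing _ _) (pairing _ _)
    (pairing _ _).
  move: (n%:R * e1 * m1) (n%:R * Q * e1) (tau * (L * _)) (b m) ; goal_lra.
- apply/eqP; rewrite -subr_eq0 -normr_le0.
  have [L3 L30 HL3] := nice_lipschitz nG (Num.max R0 Q).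
  have pR : `|p'| <= Num.max R0 Q by rewrite le_max pP'.
  have qR : `|q'| <= Num.max R0 Q by rewrite le_max qQ' orbT.
  apply: (@le0_of_small _ _ (L3 + E + 2 * L3) 1) => // e e0 _.
  have [m0 Hm0] := small e e0; have [m mm [h1 h2 h3 h4]] := cl e m0 e0.
  have pmR : `|p m| <= Num.max R0 Q by rewrite le_max pP.
  have qmR : `|q m| <= Num.max R0 Q by rewrite le_max qQ orbT.
  have [_ _ _ _ err] := HZ m.
  have l1 := HL3 _ _ _ _ x8 pmR x8 pR.
  rewrite subrr normr0 add0r distrC in l1.
  have l2 := HL3 _ _ _ _ y'8 qR (y8 m) qmR.
  have k1 : L3 * `|p' - p m| <= L3 * e by apply: ler_wpM2l => //; rewrite distrC ltW.
  have k2 : L3 * (`|y m - y'| + `|q m - q'|) <= L3 * (e + e).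
    by apply: ler_wpM2l => //; apply: lerD; exact: ltW.
  have k3 : E * (tau / m.+1%:R) <= E * e by apply: ler_wpM2l => //; exact: Hm0.
  apply: le_trans (norm_triangle3 l1 err l2) _.
  apply: le_trans (lerD (lerD k1 k3) k2) _; rewrite le_eqVlt; apply/orP; left; apply/eqP; ring.
- move=> s L' L'0 HL'; apply/ler_addgt0Pr => e e0.
  have k0 : 0 < n%:R * `|s| + 1 by rewrite ltr_wpDl// mulr_ge0.
  have [m mm [h1 h2 h3 h4]] := cl (e / (n%:R * `|s| + 1)) 0%N (divr_gt0 e0 k0).
  have [_ ch _ _ _] := HZ m.
  have := @chain_lower R n F (a j) (r j) K A C0 C1 R0 C L _ dp (h0 m) L' (A * tau) m.+1 (y m) x (b m) s x
    nF L'0 HL' x8 ch.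
  rewrite subrr normr0 add0r mulrCA mh lexx => /(_ isT) low.
  have := pairing_ler s (y m - y'); rewrite pairingBr => l1.
  have := ler_norm (b m - b') => l2.
  have l3 : (n%:R * `|s|) * `|y m - y'| <= (n%:R * `|s|) * (e / (n%:R * `|s| + 1)).
    by apply: ler_wpM2l; [exact: mulr_ge0|exact: ltW].
  have l4 : (n%:R * `|s| + 1) * (e / (n%:R * `|s| + 1)) = e by rewrite mulrC divfK// gt_eqF.
  set e' := e / _ in l3 l4 h4; rewrite mulrDl mul1r in l4; rewrite pairingBr -l4.
  rewrite pairingBr in low; move: low (le_trans l1 l3) (le_trans l2 (ltW h4)).
  by move: (tau * _) => k1; move: (_ * e') => k2 *; lra.
Qed.

End transport.

(** * Transports with uniform constants *)

Section uniform_transport.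
Context {R : realType} {n : nat} {M : topologicalType} (X : C2_manifold R n M).
Context (g : riemannian_metric X).
Local Notation V := 'rV[R]_n.
Context (N : nat) (c : 'I_N -> chart R n M) (a : 'I_N -> V) (r : 'I_N -> R).
Hypothesis hc : chart_cover X c a r.
Implicit Types (H G : cotangent_bundle X -> R).

(** What is retained of a minimizer ending at [x]: its origin [y], its action [b], its final
    momentum [p] and initial momentum [q]. The curve itself is forgotten. *)
Record transport_data H G j (v : M -> R) (tau A R0 C : R) (x y p q : V) (b : R) : Prop := {
  tr_dist : `|x - y| <= A * tau ;
  tr_momentum : `|p| <= R0 ;
  tr_value : ((v (chart_inv (c j) y) + b)%:E <= lax_oleinik H tau v (chart_inv (c j) x))%E ;
  tr_reach : forall z z' m e, m <= r j / 4 -> `|z| <= m -> `|z'| <= m ->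
    `|z - z'| <= tau / 2 -> 0 < e ->
    reach H 0 tau (chart_inv (c j) (y + z')) (chart_inv (c j) (x + z))
      (b + pairing p z - pairing q z' + C * (`|z - z'| ^+ 2 / tau + tau * m ^+ 2) + e) ;
  tr_conserved : in_chart G (c j) (x, p) = in_chart G (c j) (y, q) ;
  tr_lower : forall s L, 0 <= L -> (forall y1 y2, cball (a j) (8 * r j) y1 ->
      cball (a j) (8 * r j) y2 ->
      in_chart H (c j) (y1, s) <= in_chart H (c j) (y2, s) + L * `|y1 - y2|) ->
    pairing s (x - y) - tau * (in_chart H (c j) (x, s) + L * (A * tau)) <= b }.

(** The constants depend neither on [v] nor on [tau]; both the iteration of the evolution and the
    limit of small times rely on this. *)
Lemma transport_all H G (K : R) : tonelli g H -> tonelli g G -> 0 <= K ->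
  (forall j y q, cball (a j) (8 * r j) y ->
    pairing (gradx (in_chart G (c j)) (y, q)) (gradp (in_chart H (c j)) (y, q)) =
    pairing (gradp (in_chart G (c j)) (y, q)) (gradx (in_chart H (c j)) (y, q))) ->
  exists A R0 C tau0, [/\ 0 <= A, 0 <= R0, 0 <= C & 0 < tau0] /\
    forall j v tau x, tame c a r v K -> 0 < tau -> tau <= tau0 -> cball (a j) (6 * r j) x ->
      exists y p q b, transport_data H G j v tau A R0 C x y p q b.
Proof.
move=> tH tG K0 pois.
have [C2 C20 HC2] : exists2 C2 : R, 0 <= C2 & forall i y p, cball (a i) (8 * r i) y ->
    `|p| <= K + 1 -> in_chart H (c i) (y, p) <= C2.
  apply: finite_max => [i s t st h y p h1 h2|i]; first exact: le_trans (h y p h1 h2) st.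
  have [B _ HB] := nice_bounded (cover_nice tH hc i) (K + 1); exists B => y p h1 h2.
  by have [h3 _ _] := HB y p h1 h2; exact: le_trans (ler_norm _) h3.
have /choice[A] : forall j, exists A, exists C0 C1 R0 C L : R,
    dp_constants (in_chart H (c j)) (a j) (r j) K A C0 C1 R0 C L.
  by move=> j; exact: dp_constants_exist K0 (cover_nice tH hc j).
move=> /choice[C0] /choice[C1] /choice[R0] /choice[C] /choice[L] dp.
have [A' A'0 HA] : exists2 A' : R, 0 <= A' & forall j, A j <= A'.
  by apply: finite_max => [j s t st h|j]; [exact: le_trans h st|exists (A j)].
have [R0' R0'0 HR] : exists2 A' : R, 0 <= A' & forall j, R0 j <= A'.
  by apply: finite_max => [j s t st h|j]; [exact: le_trans h st|exists (R0 j)].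
have [C' C'0 HC] : exists2 A' : R, 0 <= A' & forall j, 2 * C j <= A'.
  by apply: finite_max => [j s t st h|j]; [exact: le_trans h st|exists (2 * C j)].
have [tau0 tau00 Htau] : exists2 t : R, 0 < t & forall j, [/\ t <= 1, A j * t <= r j / 2,
    L j * t <= 1 & t * (C0 j + C2) <= r j / 2].
  apply: finite_min => [j s t t0 ts [h1 h2 h3 h4]|j].
    have [_ h5 h6 _ [_ h7]] := dp_pos (dp j); have A0 : 0 <= A j by rewrite (dp_A (dp j)); lra.
    split; first exact: le_trans ts h1.
    - by apply: le_trans h2; exact: ler_wpM2l.
    - by apply: le_trans h3; exact: ler_wpM2l.
    - by apply: le_trans h4; apply: ler_wpM2r => //; rewrite addr_ge0.
  have [_ h5 h6 _ [_ h7]] := dp_pos (dp j); have A0 : 0 <= A j by rewrite (dp_A (dp j)); lra.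
  have rj := cover_pos hc j; have r2 : 0 < r j / 2 by rewrite divr_gt0.
  have k1 : 0 < A j + 1 by rewrite ltr_wpDl.
  have k2 : 0 < L j + 1 by rewrite ltr_wpDl.
  have k3 : 0 < C0 j + C2 + 1 by rewrite ltr_wpDl// addr_ge0.
  pose t := Num.min (Num.min 1 (r j / 2 / (A j + 1))) (Num.min (L j + 1)^-1 (r j / 2 / (C0 j + C2 + 1))).
  have t0 : 0 < t by rewrite !lt_min ltr01 invr_gt0 k2 !divr_gt0.
  exists t => //; have : t <= t by [].
  rewrite {2}/t !le_min => /andP[/andP[h1 h2] /andP[h3 h4]].
  rewrite ler_pdivlMr// in h2; rewrite ler_pdivlMr// in h4.
  have {}h3 : t * (L j + 1) <= 1 by rewrite -ler_pdivlMr// div1r.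
  split => //.
  - by apply: le_trans h2; rewrite mulrC; apply: (ler_wpM2l (ltW t0)); rewrite lerDl.
  - by apply: le_trans h3; rewrite mulrC; apply: (ler_wpM2l (ltW t0)); rewrite lerDl.
  - by apply: le_trans h4; apply: (ler_wpM2l (ltW t0)); rewrite lerDl.
exists A', R0', C', tau0; split; first by split.
move=> j v tau x tv t0 t1 xa.
have [h1 h2 h3 h4] := Htau j.
have [_ h5 h6 _ [_ h7]] := dp_pos (dp j); have A0 : 0 <= A j by rewrite (dp_A (dp j)); lra.
have k1 : tau <= 1 by exact: le_trans h1.
have k2 : A j * tau <= r j / 2 by apply: le_trans h2; exact: ler_wpM2l.
have k3 : L j * tau <= 1 by apply: le_trans h3; exact: ler_wpM2l.
have k4 : tau * (C0 j + C2) <= r j / 2.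
  by apply: le_trans h4; apply: ler_wpM2r => //; rewrite addr_ge0.
have nn (s m : R) : 0 <= s ^+ 2 / tau + tau * m ^+ 2.
  have ti : 0 <= tau^-1 by rewrite invr_ge0 ltW.
  exact: (addr_ge0 (mulr_ge0 (sqr_ge0 s) ti) (mulr_ge0 (ltW t0) (sqr_ge0 m))).
have At : A j * tau <= A' * tau by exact: (ler_wpM2r (ltW t0) (HA j)).
have [y [p [q [b [[d1 d2] d3 d4 d5 d6]]]]] :=
  transport_exists tH tG hc (pois j) (dp j) tv t0 k1 k2 k3 HC2 k4 xa.
exists y, p, q, b; split.
- exact: le_trans d1 At.
- exact: le_trans d2 (HR j).
- exact: d3.
- move=> z z' m e m1 zm z'm zz e0; apply: reach_le (d4 z z' m e m1 zm z'm zz e0).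
  by rewrite lerD2r lerD2l; exact: (ler_wpM2r (nn _ _) (HC j)).
- exact: d5.
- move=> s L1 L10 HL; apply: le_trans (d6 s L1 L10 HL).
  by rewrite lerD2l lerN2; apply: (ler_wpM2l (ltW t0)); rewrite lerD2l; apply: (ler_wpM2l L10 At).
Qed.

End uniform_transport.

(** * Functions fixed up to drift: regularity, oscillation and energy level *)

Section fixed_functions.
Context {R : realType} {n : nat} {M : topologicalType} (X : C2_manifold R n M).
Context (g : riemannian_metric X) (G : cotangent_bundle X -> R) (alpha : R).
Hypothesis tG : tonelli g G.
Local Notation V := 'rV[R]_n.
Context (N : nat) (c : 'I_N -> chart R n M) (a : 'I_N -> V) (r : 'I_N -> R).
Hypothesis hc : chart_cover X c a r.
Hypothesis cM : connected [set: M].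

Definition is_fixed (v : M -> R) := forall t x, 0 < t ->
  lax_oleinik G t v x = (v x - t * alpha)%:E.

Definition supergrad (v : M -> R) j (x p : V) (C e : R) := forall z, `|z| <= e ->
  v (chart_inv (c j) (x + z)) <= v (chart_inv (c j) x) + pairing p z + C * `|z| ^+ 2.

Definition subgrad (v : M -> R) j (x q : V) (C e : R) := forall z, `|z| <= e ->
  v (chart_inv (c j) x) + pairing q z - C * `|z| ^+ 2 <= v (chart_inv (c j) (x + z)).

Lemma supergrad_le v j x p (C e C' e' : R) : C <= C' -> e' <= e ->
  supergrad v j x p C e -> supergrad v j x p C' e'.
Proof.
move=> CC ee sg z ze; apply: le_trans (sg z (le_trans ze ee)) _.
by rewrite lerD2l; apply: ler_wpM2r => //; exact: exprn_ge0.
Qed.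

Lemma subgrad_le v j x p (C e C' e' : R) : C <= C' -> e' <= e ->
  subgrad v j x p C e -> subgrad v j x p C' e'.
Proof.
move=> CC ee sg z ze; apply: le_trans (sg z (le_trans ze ee)).
by rewrite lerD2l lerN2; apply: ler_wpM2r => //; exact: exprn_ge0.
Qed.

Lemma sub_super_same v j x p q (C e C' e' : R) : 0 < e -> 0 < e' -> cball (a j) (8 * r j) x ->
  subgrad v j x q C e -> supergrad v j x p C' e' -> p = q.
Proof.
move=> e0 e'0 xa sub sup; have xc : chart_cod (c j) x by exact: (cover_cod hc).
have xd := chart_inv_dom xc; have ac := cover_atlas hc j.
have {}sub : subgrad v j x q (Num.max C C') (Num.min e e').
  by apply: subgrad_le sub; [rewrite le_max lexx|rewrite ge_min lexx].
have {}sup : supergrad v j x p (Num.max C C') (Num.min e e').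
  by apply: supergrad_le sup; [rewrite le_max lexx orbT|rewrite ge_min lexx orbT].
have m0 : 0 < Num.min e e' by rewrite lt_min e0.
have := @sub_super_gradient R n M X v (c j) (c j) (chart_inv (c j) x) q p _ _ ac ac xd xd m0.
by rewrite (trans_id ac xd) trmx1 mulmx1 chart_invK// => sg; exact: sg sub sup.
Qed.

Lemma fixed_reach v t y x b : is_fixed v -> 0 < t -> reach G 0 t y x b ->
  v x <= v y + b + t * alpha.
Proof.
move=> fv t0 yx; have := lax_oleinik_reach v yx; rewrite fv// lee_fin.
by rewrite lerBlDr.
Qed.

(** A segment run at unit speed has bounded Lagrangian, so a fixed function grows along it with
    slope at most [C + |alpha|], whichever fixed function it is. *)
Lemma fixed_tame : exists2 K : R, 0 <= K & forall v, is_fixed v -> tame c a r v K.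
Proof.
have [C C0 HC] : exists2 C : R, 0 <= C & forall j y w, cball (a j) (8 * r j) y -> `|w| <= 1 ->
    lag (in_chart G (c j)) y w <= C.
  apply: finite_max => [j s t st h y w h1 h2|j]; first exact: le_trans (h y w h1 h2) st.
  have [C _ HC] := lag_bounded (cover_nice tG hc j) 1; exists C => y w h1 h2.
  exact: le_trans (ler_norm _) (HC y w h1 h2).
exists (C + `|alpha|); first exact: addr_ge0.
move=> v fv j.
have key x y : cball (a j) (8 * r j) x -> cball (a j) (8 * r j) y ->
    v (chart_inv (c j) x) - v (chart_inv (c j) y) <= (C + `|alpha|) * `|x - y|.
  move=> xa ya; have [->|xy] := eqVneq x y; first by rewrite !subrr normr0 mulr0.
  have d0 : 0 < `|x - y| by rewrite normr_gt0 subr_eq0.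
  have := @segment_reach R n M X G (c j) (a j) (8 * r j) 0 `|x - y| C y x (cover_atlas hc j)
    (cover_cod hc (j := j)) d0 ya xa.
  rewrite subr0 => sr; have {}sr := sr _.
  have /(fixed_reach fv d0) : reach G 0 `|x - y| (chart_inv (c j) y) (chart_inv (c j) x) (`|x - y| * C).
    apply: sr => q q01; apply: HC; first exact: cball_segment.
    by rewrite normrZ normfV normr_id mulVf// gt_eqF.
  have := ler_wpM2l (ltW d0) (ler_norm alpha).
  rewrite mulrDl ![_ * `|x - y|]mulrC; move: (v _) (v _) (`|x - y| * C) (`|x - y| * alpha) => *; lra.
move=> x y xa ya; rewrite ler_norml key// andbT lerNl opprB distrC; exact: key.
Qed.

(** Connectedness propagates local bounds: the points at which all fixed functions differ from their
    value at [x0] by a common bound form an open and closed set. The finite cover then makes the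
    bound uniform. *)
Lemma fixed_osc : exists2 D : R, 0 <= D & forall v, is_fixed v -> forall x y, v x - v y <= D.
Proof.
have [K K0 HK] := fixed_tame.
have loc j x y v : is_fixed v -> in_ball (c j) (a j) (r j) x -> in_ball (c j) (a j) (r j) y ->
    v x - v y <= K * (2 * r j).
  have rj := cover_pos hc j; have rj8 : r j <= 8 * r j by lra.
  move=> fv [xd xa] [yd ya]; have xa8 := cball_le rj8 xa; have ya8 := cball_le rj8 ya.
  have := le_trans (ler_norm _) (HK v fv j _ _ xa8 ya8).
  rewrite !chart_mapK// => /le_trans; apply; apply: ler_wpM2l => //.
  rewrite (_ : c j x - c j y = (c j x - a j) - (c j y - a j)); last by row_ring.
  by apply: le_trans (ler_normB _ _) _; rewrite mulrDl mul1r; exact: lerD.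
have [[x0 _]|M0] := pselect ([set: M] !=set0); last first.
  by exists 0 => // v _ x; exfalso; apply: M0; exists x.
pose A := [set x | exists D : R, forall v, is_fixed v -> v x - v x0 <= D /\ v x0 - v x <= D].
have nb x j : in_ball (c j) (a j) (r j) x -> \forall y \near x, exists D : R,
    forall v, is_fixed v -> v x - v y <= D /\ v y - v x <= D.
  move=> [xd xa]; have rj := cover_pos hc j.
  have h1 : \forall y \near x, chart_dom (c j) y.
    by apply: open_nbhs_nbhs; split => //; exact: open_chart_dom.
  have h2 : \forall y \near x, ball (c j x) (r j) (c j y).
    by apply: (chart_map_cvg xd); exact: nbhsx_ballx.
  move: h1 h2; apply: filterS2 => y yd; rewrite -ball_normE/= => yb.
  exists (K * r j) => v fv.
  have xa8 : cball (a j) (8 * r j) (c j x) by apply: cball_le xa; move: rj; goal_lra.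
  have ya8 : cball (a j) (8 * r j) (c j y).
    have -> : c j y = c j x + (c j y - c j x) by rewrite addrC subrK.
    have xa1 : cball (a j) (1 * r j) (c j x) by rewrite mul1r.
    have yb' : `|c j y - c j x| <= r j by rewrite distrC ltW.
    by apply: cball_le (cover_step xa1 yb' (lexx _)); move: rj; goal_lra.
  have KD : K * `|c j x - c j y| <= K * r j by apply: ler_wpM2l => //; exact: ltW.
  have := HK v fv j _ _ xa8 ya8; rewrite !chart_mapK// ler_norml => /andP[k1 k2].
  by split; [exact: le_trans k2 KD|rewrite -opprB lerNl; apply: le_trans k1; rewrite lerN2].
have AT : A = [set: M].
  have oA : open A.
    rewrite openE => x [D HD]; have [j jx] := cover_all hc x.
    apply: filterS (nb x j jx) => y [D' HD']; exists (D + D') => v fv.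
    have [h1 h2] := HD v fv; have [h3 h4] := HD' v fv.
    by move: h1 h2 h3 h4; move: (v _) (v _) (v _) => *; split; lra.
  have oC : open (~` A).
    rewrite openE => x nA; have [j jx] := cover_all hc x.
    apply: filterS (nb x j jx) => y [D' HD'] [D HD]; apply: nA; exists (D + D') => v fv.
    have [h1 h2] := HD v fv; have [h3 h4] := HD' v fv.
    by move: h1 h2 h3 h4; move: (v _) (v _) (v _) => *; split; lra.
  apply: cM.
  - by exists x0; exists 0 => v _; rewrite subrr.
  - by exists A => //; rewrite setTI.
  - by exists A; [rewrite -openC|rewrite setTI].
have [D D0 HD] : exists2 D : R, 0 <= D & forall j v, is_fixed v -> forall x,
    in_ball (c j) (a j) (r j) x -> v x - v x0 <= D /\ v x0 - v x <= D.
  apply: finite_max => [j s t st h v fv x jx|j].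
    by have [h1 h2] := h v fv x jx; split; exact: le_trans st.
  have [[z jz]|no] := pselect (exists z, in_ball (c j) (a j) (r j) z); last first.
    by exists 0 => v _ x jx; exfalso; apply: no; exists x.
  have [D HD] : A z by rewrite AT.
  exists (D + K * (2 * r j)) => v fv x jx; have [h1 h2] := HD v fv.
  have h3 := loc j x z v fv jx jz; have h4 := loc j z x v fv jz jx.
  by move: h1 h2 h3 h4; move: (v _) (v _) (v _) (K * _) => *; split; lra.
exists (D + D); first exact: addr_ge0.
move=> v fv x y; have [j jx] := cover_all hc x; have [i iy] := cover_all hc y.
have [h1 _] := HD j v fv x jx; have [_ h2] := HD i v fv y iy.
by move: h1 h2; move: (v _) (v _) (v _) => *; lra.
Qed.

(** A Hamiltonian commutes with itself; transports for [G] alone are obtained with [G] in both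
    roles. *)
Lemma self_poisson (H : cotangent_bundle X -> R) j y q : cball (a j) (8 * r j) y ->
  pairing (gradx (in_chart H (c j)) (y, q)) (gradp (in_chart H (c j)) (y, q)) =
  pairing (gradp (in_chart H (c j)) (y, q)) (gradx (in_chart H (c j)) (y, q)).
Proof. by move=> _; exact: pairingC. Qed.

(* The endpoint of a transport may be moved while its origin is kept. *)
Lemma transport_supergrad (K : cotangent_bundle X -> R) v tau A R0 C j x y p q b : 0 < tau ->
  0 <= C -> is_fixed v -> transport_data c a r G K j v tau A R0 C x y p q b ->
  supergrad v j x p (C * (tau^-1 + tau)) (Num.min (r j / 4) (tau / 2)).
Proof.
move=> t0 C0 fv td z; rewrite le_min => /andP[zr zt]; apply/ler_addgt0Pr => e e0.
have := tr_value td; rewrite fv// lee_fin => val.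
have rj := cover_pos hc j.
have z0 : `|0 : V| <= `|z| by rewrite normr0.
have zz : `|z - 0| <= tau / 2 by rewrite subr0.
have re := tr_reach td zr (lexx _) z0 zz e0.
have := fixed_reach fv t0 re; rewrite !subr0 addr0 pairing0r subr0.
have -> : C * (`|z| ^+ 2 / tau + tau * `|z| ^+ 2) = C * (tau^-1 + tau) * `|z| ^+ 2 by ring.
move: val; move: (v _) (v _) (v _) (pairing _ _) (C * _ * _) (tau * _) => *; lra.
Qed.

Lemma fixed_supergrad : exists R0 C e, [/\ 0 <= R0, 0 <= C & 0 < e] /\
  forall v j x, is_fixed v -> cball (a j) (6 * r j) x ->
    exists2 p, `|p| <= R0 & supergrad v j x p C e.
Proof.
have [K K0 HK] := fixed_tame.
have [A [R0 [C [tau [[A0 R00 C0 t0] HT]]]]] := transport_all hc tG tG K0 (@self_poisson G).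
have [r0 r00 rmin] := min_radius hc.
exists R0, (C * (tau^-1 + tau)), (Num.min (r0 / 4) (tau / 2)); split.
  by split => //; [rewrite mulr_ge0// addr_ge0 ?invr_ge0 ?ltW//|rewrite lt_min !divr_gt0].
move=> v j x fv xa; have [y [p [q [b td]]]] := HT j v tau x (HK v fv) t0 (lexx _) xa.
exists p; first exact: tr_momentum td.
apply: supergrad_le (transport_supergrad t0 C0 fv td); first by [].
rewrite le_min !ge_min lexx orbT andbT; apply/orP; left.
by rewrite ler_pM2r ?invr_gt0.
Qed.

(** A short segment leaving [x] with velocity [gradp G (x, q)] gives [G <= alpha]; a transport
    arriving at [x], tested with [q], gives [G >= alpha]. In both cases the subgradient turns the
    inequality on [v] into one between first-order terms in time. *)
Lemma fixed_level v j x q (C e : R) : is_fixed v -> cball (a j) (6 * r j) x -> 0 < e -> 0 <= C ->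
  subgrad v j x q C e -> in_chart G (c j) (x, q) = alpha.
Proof.
move=> fv xa e0 C0 sub; have rj := cover_pos hc j; have nG := cover_nice tG hc j.
have x8 : cball (a j) (8 * r j) x by apply: cball_le xa; move: rj; goal_lra.
suff [k1 k2] : in_chart G (c j) (x, q) - alpha <= 0 /\ alpha - in_chart G (c j) (x, q) <= 0.
  by apply: le_anti; rewrite -subr_le0 k1 -subr_le0 k2.
split.
  set w := gradp (in_chart G (c j)) (x, q).
  have lw := lag_gradp q nG x8; rewrite -/w in lw.
  have [L L0 HL] := lag_lipschitz nG `|w|.
  have w0 : 0 < `|w| + 1 by rewrite ltr_wpDl.
  have t00 : 0 < Num.min (e / (`|w| + 1)) (r j / (`|w| + 1)) by rewrite lt_min !divr_gt0.
  apply: (@le0_of_small _ _ (C * `|w| ^+ 2 + L * `|w|) (Num.min (e / (`|w| + 1)) (r j / (`|w| +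
    1)))) => //.
  move=> t t0; rewrite le_min !ler_pdivlMr// => /andP[te tr].
  have ntw : `|t *: w| = t * `|w| by rewrite normrZ gtr0_norm.
  have tw1 : t * `|w| <= t * (`|w| + 1) by apply: (ler_wpM2l (ltW t0)); rewrite lerDl.
  have zr : `|t *: w| <= r j by rewrite ntw (le_trans tw1).
  have := sub (t *: w); rewrite ntw => /(_ (le_trans tw1 te)).
  have y8 : cball (a j) (8 * r j) (x + t *: w).
    by apply: cball_le (cover_step xa zr (lexx _)); move: rj; goal_lra.
  have := @segment_reach R n M X G (c j) (a j) (8 * r j) 0 t
    (pairing q w - in_chart G (c j) (x, q) + L * (t * `|w|)) x (x + t *: w)
    (cover_atlas hc j) (cover_cod hc (j := j)) t0 x8 y8.
  have -> : x + t *: w - x = t *: w by row_ring.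
  rewrite subr0 scalerA mulVf ?gt_eqF// scale1r => sr.
  have /(fixed_reach fv t0) : reach G 0 t (chart_inv (c j) x) (chart_inv (c j) (x + t *: w))
      (t * (pairing q w - in_chart G (c j) (x, q) + L * (t * `|w|))).
    apply: sr => s /andP[s0 s1].
    have z8 : cball (a j) (8 * r j) (x + s *: (t *: w)).
      have nz : `|s *: (t *: w)| <= r j.
        rewrite normrZ ger0_norm//; apply: le_trans zr; rewrite -[leRHS]mul1r; exact: ler_wpM2r.
      by apply: cball_le (cover_step xa nz (lexx _)); move: rj; goal_lra.
    have := le_trans (ler_norm _) (HL x w _ w x8 (lexx _) z8 (lexx _)).
    have -> : w - w = 0 by exact: subrr.
    have -> : x + s *: (t *: w) - x = s *: (t *: w) by row_ring.
    rewrite normr0 addr0 normrZ ntw ger0_norm// => l1.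
    have l2 : L * (s * (t * `|w|)) <= L * (t * `|w|).
      apply: ler_wpM2l => //; rewrite -[leRHS]mul1r; apply: ler_wpM2r => //.
      by rewrite mulr_ge0// ltW.
    move: lw l1 l2; move: (lag _ _ _) (lag _ _ _) (pairing _ _) (in_chart _ _ _) (L * _) (L * _).
    by move; goal_lra.
  rewrite pairingZr exprMn => k1 k2; rewrite -(ler_pM2l t0).
  have -> : t * ((C * `|w| ^+ 2 + L * `|w|) * t) = C * (t ^+ 2 * `|w| ^+ 2) + t * (L * (t * `|w|))
    by ring.
  move: k1 k2; rewrite !(mulrDr, mulrBr, mulrN).
  move: (v _) (v _) (t * pairing _ _) (t * in_chart _ _ _) (C * _) (t * (L * _)) (t * alpha) ; goal_lra.
have [K K0 HK] := fixed_tame.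
have [A [R0 [C' [tau [[A0 R00 C'0 t0] HT]]]]] := transport_all hc tG tG K0 (@self_poisson G).
have [L L0 HL] := nice_base_lipschitz `|q| nG.
have A1 : 0 < A + 1 by rewrite ltr_wpDl.
have t00 : 0 < Num.min tau (e / (A + 1)) by rewrite lt_min t0 divr_gt0.
apply: (@le0_of_small _ _ (C * A ^+ 2 + L * A) (Num.min tau (e / (A + 1)))) => //.
move=> t tpos; rewrite le_min ler_pdivlMr// => /andP[tt te].
have [y [p [q' [b td]]]] := HT j v t x (HK v fv) tpos tt xa.
have := tr_value td; rewrite fv// lee_fin => val.
have dxy := tr_dist td.
have low : pairing q (x - y) - t * (in_chart G (c j) (x, q) + L * (A * t)) <= b.
  by apply: tr_lower td _ _ L0 _ => y1 y2 h1 h2; exact: HL.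
have dyx : `|y - x| <= A * t by rewrite distrC.
have := sub (y - x); rewrite [x + (y - x)]addrC subrK.
have dye : `|y - x| <= e.
  by apply: le_trans dyx _; apply: le_trans te; rewrite mulrC; apply: (ler_wpM2l (ltW tpos));
    rewrite lerDl.
move=> /(_ dye) sub'.
have sq : C * `|y - x| ^+ 2 <= C * (A * t) ^+ 2.
  by apply: ler_wpM2l => //; rewrite lerXn2r// nnegrE// mulr_ge0// ltW.
rewrite -(ler_pM2l tpos).
have -> : t * ((C * A ^+ 2 + L * A) * t) = C * (A * t) ^+ 2 + t * (L * (A * t)) by ring.
move: val low sub' sq; rewrite !pairingBr mulrBr (mulrDr t).
move: (v _) (v _) (pairing _ _) (pairing _ _) (t * in_chart _ _ _) (C * _) (C * _) (t * (L * _)) (t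
  * alpha).
move; goal_lra.
Qed.

End fixed_functions.

(** * The evolution by the commuting Hamiltonian on fixed functions *)

Lemma bounded_small_drop {R : realType} (psi : nat -> R) (B e : R) :
  (forall k k', psi k - psi k' <= B) -> 0 < e -> exists k : nat, psi k - psi k.+1 <= e.
Proof.
move=> HB e0; apply: contrapT => no.
have drop k : e < psi k - psi k.+1.
  by rewrite ltNge; apply/negP => h; apply: no; exists k.
have sum k : k%:R * e <= psi 0%N - psi k.
  elim: k => [|k IH]; first by rewrite mul0r subrr.
  by have := ltW (drop k); rewrite -natr1 mulrDl mul1r; lra.
have [m hm] : exists m : nat, B / e < m.+1%:R.
  have [B0|B0] := leP 0 (B / e).
    by exists (Num.truncn (B / e)); have /andP[_] := truncn_itv B0.
  by exists 0%N; apply: lt_trans B0 _.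
have := sum m.+1; have := HB 0%N m.+1; rewrite ltr_pdivrMr// in hm; lra.
Qed.

Lemma first_order_lower {R : realType} (v0 v1 b s l a1 t th px py w : R) :
  a1 + t + l <= s -> w <= a1 -> py - px - (th + l) <= b -> v0 + (px - py) - w - t <= v1 ->
  - s <= v1 + b - v0 + th.
Proof. lra. Qed.

Lemma first_order_upper {R : realType} (v0 v1 v2 v3 s l a1 a2 t th tp tq w1 w2 : R) :
  2 * a2 + a1 + t + l <= s -> v3 <= v2 + (tq - th + l) -> v1 <= v0 + tp + w2 ->
  v2 <= v0 - tp + w2 -> v0 + tq - w1 - t <= v1 -> w1 <= a1 -> w2 <= a2 -> v3 - v0 + th <= s.
Proof. lra. Qed.

Section commuting.
Context {R : realType} {n : nat} {M : topologicalType} (X : C2_manifold R n M).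
Context (g : riemannian_metric X) (G H : cotangent_bundle X -> R) (alpha : R).
Hypothesis tG : tonelli g G.
Hypothesis tH : tonelli g H.
Hypothesis GH : poisson_commute G H.
Local Notation V := 'rV[R]_n.
Context (N : nat) (c : 'I_N -> chart R n M) (a : 'I_N -> V) (r : 'I_N -> R).
Hypothesis hc : chart_cover X c a r.
Hypothesis cM : connected [set: M].
Local Notation inv j := (chart_inv (c j)).
Local Notation is_fixed := (is_fixed G alpha).

Let poisG j y q : cball (a j) (8 * r j) y ->
  pairing (gradx (in_chart G (c j)) (y, q)) (gradp (in_chart H (c j)) (y, q)) =
  pairing (gradp (in_chart G (c j)) (y, q)) (gradx (in_chart H (c j)) (y, q)).
Proof. by move=> ya; apply: poisson_grad => //; [exact: (cover_atlas hc)|exact: (cover_cod hc)]. Qed.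

(* The origin of a transport may be moved while its endpoint is kept. *)
Lemma transport_reach_origin (K1 K2 : cotangent_bundle X -> R) v tau A R0 C j x y p q b z (e : R) :
  0 < tau -> transport_data c a r K1 K2 j v tau A R0 C x y p q b ->
  `|z| <= Num.min (r j / 4) (tau / 2) -> 0 < e ->
  reach K1 0 tau (inv j (y + z)) (inv j x)
    (b - pairing q z + C * (tau^-1 + tau) * `|z| ^+ 2 + e).
Proof.
move=> t0 td; rewrite le_min => /andP[zr zt] e0.
have z0 : `|0 : V| <= `|z| by rewrite normr0.
have zz : `|0 - z| <= tau / 2 by rewrite sub0r normrN.
have := tr_reach td zr z0 (lexx _) zz e0; rewrite addr0 pairing0r addr0 sub0r normrN.
apply: reach_le; rewrite le_eqVlt; apply/orP; left; apply/eqP; ring.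
Qed.

(** With the endpoint kept, no displacement of the origin can go below the minimal value; the
    initial momentum is therefore a subgradient of the initial function. *)
Lemma transport_subgrad (K1 K2 : cotangent_bundle X -> R) v tau A R0 C j x y p q b :
  0 < tau -> transport_data c a r K1 K2 j v tau A R0 C x y p q b ->
  subgrad c v j y q (C * (tau^-1 + tau)) (Num.min (r j / 4) (tau / 2)).
Proof.
move=> t0 td z ze; apply/ler_addgt0Pr => e e0.
have := lax_oleinik_reach v (transport_reach_origin t0 td ze e0).
move=> /(le_trans (tr_value td)); rewrite lee_fin.
move: (v _) (v _) (pairing _ _) (C * _ * _) => *; lra.
Qed.

Lemma transport_lax (K1 K2 : cotangent_bundle X -> R) v tau A R0 C j x y p q b :
  0 < tau -> transport_data c a r K1 K2 j v tau A R0 C x y p q b ->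
  lax_oleinik K1 tau v (inv j x) = (v (inv j y) + b)%:E.
Proof.
move=> t0 td; apply/eqP; rewrite eq_le (tr_value td) andbT; apply/lee_addgt0Pr => e e0.
have z0 : `|0 : V| <= Num.min (r j / 4) (tau / 2).
  by rewrite normr0 le_min !divr_ge0// ?(ltW t0)// ltW// (cover_pos hc).
have := lax_oleinik_reach v (transport_reach_origin t0 td z0 e0).
rewrite addr0 pairing0r subr0 normr0 expr0n/= mulr0 addr0 => /le_trans; apply.
by rewrite -EFinD lee_fin addrA.
Qed.

(** The default value of [fine] never matters for a fixed [v] and small [tau], where the infimum is
    shown to be finite. *)
Definition laxr (tau : R) v x := fine (lax_oleinik H tau v x).

(** The initial momentum [q] is a subgradient of [v], hence on the level [alpha] of [G], and so is
    [p] by conservation. As [q] is also a supergradient of [v], moving both ends by the same [z]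
    makes [p] a supergradient of the new function, with a constant free of [1 / tau]; the criterion
    by supergradients applies. *)
Lemma lax_preserves_fixed : exists2 tau1 : R, 0 < tau1 & forall tau v, 0 < tau -> tau <= tau1 ->
  is_fixed v -> is_fixed (laxr tau v) /\
    forall x, lax_oleinik H tau v x = (laxr tau v x)%:E.
Proof.
have [K K0 HK] := fixed_tame alpha tG hc.
have [A [R0 [C [tau0 [[A0 R00 C0 t00] HT]]]]] := transport_all hc tH tG K0 poisG.
have [R1 [C1 [e1 [[R10 C10 e10] Hs]]]] := fixed_supergrad alpha tG hc.
have [r0 r00 rmin] := min_radius hc; have A1 : 0 < A + 1 by rewrite ltr_wpDl.
exists (Num.min tau0 (r0 / (A + 1))); first by rewrite lt_min t00 divr_gt0.
move=> tau v t0; rewrite le_min ler_pdivlMr// => /andP[tt tr] fv.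
have At : A * tau <= r0 by rewrite mulrC; apply: le_trans tr; apply: (ler_wpM2l (ltW t0)); rewrite lerDl.
have tv := HK v fv.
have td j x : cball (a j) (6 * r j) x -> exists y p q b,
    transport_data c a r H G j v tau A R0 C x y p q b by exact: HT.
have fin x : lax_oleinik H tau v x = (laxr tau v x)%:E.
  have [j [xd xa]] := cover_all hc x; have rj := cover_pos hc j.
  have xa6 : cball (a j) (6 * r j) (c j x) by apply: cball_le xa; move: rj; goal_lra.
  have [y [p [q [b /(transport_lax t0)]]]] := td j _ xa6.
  by rewrite chart_mapK// => e; rewrite /laxr e.
split => //.
pose e' := Num.min (Num.min (r0 / 4) (tau / 2)) e1.
have e'0 : 0 < e' by rewrite !lt_min !divr_gt0.
have sd : superdiff_level G c a r alpha (laxr tau v) (C * tau + C1) R0 e'.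
  move=> j x xa; have rj := cover_pos hc j; have rr := rmin j.
  have xa6 : cball (a j) (6 * r j) x by apply: cball_le xa; move: rj; goal_lra.
  have [y [p [q [b tdx]]]] := td j x xa6.
  have ya2 : cball (a j) (2 * r j) y.
    have -> : y = x + (y - x) by rewrite addrC subrK.
    have xa1 : cball (a j) (1 * r j) x by rewrite mul1r.
    have yb' : `|y - x| <= r j by rewrite distrC (le_trans (tr_dist tdx))// (le_trans At).
    by apply: cball_le (cover_step xa1 yb' (lexx _)); goal_lra.
  have ya6 : cball (a j) (6 * r j) y by apply: cball_le ya2; move: rj; goal_lra.
  have ya8 : cball (a j) (8 * r j) y by apply: cball_le ya2; move: rj; goal_lra.
  have sub := transport_subgrad t0 tdx.
  have e2 : 0 < Num.min (r j / 4) (tau / 2) by rewrite lt_min !divr_gt0.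
  have C2 : 0 <= C * (tau^-1 + tau) by rewrite mulr_ge0// addr_ge0// ?invr_ge0 ltW.
  have lev := fixed_level tG hc fv ya6 e2 C2 sub.
  exists p; split; [exact: tr_momentum tdx|by rewrite (tr_conserved tdx)|].
  have [p1 p1R sup] := Hs v j y fv ya6.
  have qp : p1 = q.
    exact: (sub_super_same hc e2 e10 ya8 sub sup).
  move=> z; rewrite !le_min => /andP[/andP[zr zt] z1]; apply/ler_addgt0Pr => e e0.
  have zz : `|z - z| <= tau / 2.
    by have -> : z - z = 0 by [exact: subrr]; rewrite normr0 divr_ge0// ltW.
  have zr' : `|z| <= r j / 4 by apply: le_trans zr _; rewrite ler_pM2r ?invr_gt0.
  have := lax_oleinik_reach v (tr_reach tdx zr' (lexx _) (lexx _) zz e0).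
  rewrite fin lee_fin; have -> : z - z = 0 by exact: subrr.
  have := transport_lax t0 tdx; rewrite fin => -[->].
  have := sup z z1; rewrite qp normr0 expr0n/= mul0r add0r mulrA [in _ + C1]addrC mulrDl.
  move: (v _) (v _) (laxr _ _ _) (pairing _ _) (pairing _ _) (C1 * _) (C * tau * _) ; goal_lra.
have Ct : 0 <= C * tau + C1 by rewrite addr_ge0// mulr_ge0// ltW.
by move=> t x tpos; exact: (lax_oleinik_of_superdiff tG hc Ct R00 e'0 sd).
Qed.

(* The value of H at q is the speed at which v decreases at y under the evolution by H as soon
   as q is a subgradient of v at y, up to an error of order tau ^ 2. *)
Lemma lax_first_order (Rq C1 e1 : R) : 0 <= Rq -> 0 <= C1 -> 0 < e1 ->
  exists C3 tau2, 0 < tau2 /\ forall tau v j y q, 0 < tau -> tau <= tau2 -> is_fixed v ->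
    cball (a j) (2 * r j) y -> `|q| <= Rq ->
    (forall z, `|z| <= e1 -> v (inv j y) + pairing q z - C1 * `|z| ^+ 2 - tau ^+ 2
       <= v (inv j (y + z))) ->
    `|laxr tau v (inv j y) - v (inv j y) + tau * in_chart H (c j) (y, q)| <= C3 * tau ^+ 2.
Proof.
move=> Rq0 C10 e10.
have [K K0 HK] := fixed_tame alpha tG hc.
have [A [R0 [C [tau0 [[A0 R00 C0 t00] HT]]]]] := transport_all hc tH tG K0 poisG.
have [R2 [C2 [e2 [[R20 C20 e20] Hs]]]] := fixed_supergrad alpha tG hc.
have [tau1 t10 Hp] := lax_preserves_fixed.
have [r0 r00 rmin] := min_radius hc.
have [L L0 HL] : exists2 L : R, 0 <= L & forall j y y' q, cball (a j) (8 * r j) y ->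
    cball (a j) (8 * r j) y' -> `|q| <= Rq ->
    in_chart H (c j) (y', q) <= in_chart H (c j) (y, q) + L * `|y' - y|.
  apply: finite_max => [j s t st h y y' q h1 h2 h3|j].
    by apply: le_trans (h y y' q h1 h2 h3) _; rewrite lerD2l; exact: ler_wpM2r.
  by have [L _ HL] := nice_base_lipschitz Rq (cover_nice tH hc j); exists L.
have [W W0 HW] : exists2 W : R, 0 <= W & forall j y q, cball (a j) (8 * r j) y ->
    `|q| <= Rq -> `|gradp (in_chart H (c j)) (y, q)| <= W.
  apply: finite_max => [j s s' ss h y q h1 h2|j]; first exact: le_trans (h _ _ h1 h2) ss.
  have [W _ HW] := nice_bounded (cover_nice tH hc j) Rq.
  by exists W => y q h1 h2; have [] := HW y q h1 h2.
have [L2 L20 HL2] : exists2 L : R, 0 <= L & forall j y v y' v', cball (a j) (8 * r j) y ->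
    `|v| <= W -> cball (a j) (8 * r j) y' -> `|v'| <= W ->
    `|lag (in_chart H (c j)) y' v' - lag (in_chart H (c j)) y v| <= L * (`|y' - y| + `|v' - v|).
  apply: finite_max => [j s s' ss h y q y' q' h1 h2 h3 h4|j].
    by apply: le_trans (h _ _ _ _ h1 h2 h3 h4) _; apply: ler_wpM2r => //; rewrite addr_ge0.
  by have [L' _ HL'] := lag_lipschitz (cover_nice tH hc j) W; exists L'.
have A1 : 0 < A + 1 by rewrite ltr_wpDl.
have W1 : 0 < W + 1 by rewrite ltr_wpDl.
pose d := Num.min (Num.min e1 e2) r0.
have d0 : 0 < d by rewrite !lt_min e10 e20.
exists (Num.max (C1 * A ^+ 2 + 1 + L * A) (2 * C2 * W ^+ 2 + C1 * W ^+ 2 + 1 + L2 * W)).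
exists (Num.min (Num.min tau0 tau1) (Num.min (d / (A + 1)) (d / (W + 1)))).
split; first by rewrite !lt_min t00 t10 !divr_gt0.
move=> tau v j y q t0; rewrite !le_min !ler_pdivlMr// => /andP[/andP[tt0 tt1] /andP[tA tW]].
move=> fv ya2 qR sub; have rj := cover_pos hc j.
have ya6 : cball (a j) (6 * r j) y by apply: cball_le ya2; move: rj; goal_lra.
have ya8 : cball (a j) (8 * r j) y by apply: cball_le ya2; move: rj; goal_lra.
have [_ fin] := Hp tau v t0 tt1 fv.
have At : A * tau <= d by rewrite mulrC; apply: le_trans tA; apply: (ler_wpM2l (ltW t0)); rewrite lerDl.
have Wt : tau * W <= d by apply: le_trans tW; apply: (ler_wpM2l (ltW t0)); rewrite lerDl.
have [de1 de2 dr] : [/\ d <= e1, d <= e2 & d <= r j].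
  have : d <= d by []; rewrite {2}/d !le_min => /andP[/andP[h1 h2] h3].
  by split => //; exact: le_trans h3 (rmin j).
set h := in_chart H (c j) (y, q).
have tau2 := sqr_ge0 tau.
rewrite ler_norml; apply/andP; split.
  have [y' [p [q' [b td]]]] := HT j v tau y (HK v fv) t0 tt0 ya6.
  have := transport_lax t0 td; rewrite fin => -[->].
  have dyy : `|y' - y| <= A * tau by rewrite distrC; exact: tr_dist td.
  have k4 := sub (y' - y) (le_trans dyy (le_trans At de1)).
  rewrite [y + (y' - y)]addrC subrK pairingBr in k4.
  have k3 : pairing q (y - y') - tau * (h + L * (A * tau)) <= b.
    by apply: tr_lower td _ _ L0 _ => y1 y2 h1 h2; exact: HL.
  have k2 : C1 * `|y' - y| ^+ 2 <= C1 * (A ^+ 2 * tau ^+ 2).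
    by apply: ler_wpM2l => //; rewrite -exprMn lerXn2r// nnegrE// mulr_ge0// ltW.
  have k1 : (C1 * A ^+ 2 + 1 + L * A) * tau ^+ 2 <= Num.max (C1 * A ^+ 2 + 1 + L * A)
     (2 * C2 * W ^+ 2 + C1 * W ^+ 2 + 1 + L2 * W) * tau ^+ 2.
    by apply: ler_wpM2r => //; rewrite le_max lexx.
  rewrite (_ : (C1 * A ^+ 2 + 1 + L * A) * tau ^+ 2 =
    C1 * (A ^+ 2 * tau ^+ 2) + tau ^+ 2 + tau * (L * (A * tau))) in k1; last by ring.
  rewrite pairingBr mulrDr in k3; exact: first_order_lower k1 k2 k3 k4.
set w := gradp (in_chart H (c j)) (y, q).
have wW : `|w| <= W by exact: HW.
have tw : `|tau *: w| <= tau * W by rewrite normrZ gtr0_norm//; exact: (ler_wpM2l (ltW t0)).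
have twd := le_trans tw Wt.
(* The upper bound needs [v] at [y - tau *: w] from above, whereas [q] bounds [v] from below. The
   supergradient [p] gives such a bound, and comparing [p] with [q] at [y + tau *: w] replaces [p]
   by [q] up to second order. *)
have [p _ sup] := Hs v j y fv ya6.
have sup1 := sup (tau *: w) (le_trans twd de2).
have sup2 := sup (- (tau *: w)); rewrite normrN in sup2; have {}sup2 := sup2 (le_trans twd de2).
have sub1 := sub (tau *: w) (le_trans twd de1).
rewrite pairingNr in sup2; rewrite !pairingZr in sup1 sup2 sub1.
have sq : `|tau *: w| ^+ 2 <= W ^+ 2 * tau ^+ 2.
  by rewrite -exprMn [W * tau]mulrC lerXn2r// nnegrE// mulr_ge0// ltW.
have sqC1 := ler_wpM2l C10 sq; have sqC2 := ler_wpM2l C20 sq.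
have lw := lag_gradp q (cover_nice tH hc j) ya8; rewrite -/w -/h in lw.
have near8 z : `|z| <= d -> cball (a j) (8 * r j) (y + z).
  move=> zd; have zr := le_trans zd dr.
  by apply: cball_le (cover_step ya2 zr (lexx _)); move: rj; goal_lra.
have ytw : cball (a j) (8 * r j) (y + - (tau *: w)) by apply: near8; rewrite normrN.
have := @segment_reach R n M X H (c j) (a j) (8 * r j) 0 tau
  (pairing q w - h + L2 * (tau * W)) (y + - (tau *: w)) y (cover_atlas hc j)
  (cover_cod hc (j := j)) t0 ytw ya8.
have -> : y - (y - tau *: w) = tau *: w by row_ring.
rewrite subr0 scalerA mulVf ?gt_eqF// scale1r => sr.
have : reach H 0 tau (inv j (y + - (tau *: w))) (inv j y) (tau * (pairing q w - h + L2 * (tau * W))).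
  apply: sr => s /andP[s0 s1].
  have e3 : y + - (tau *: w) + s *: (tau *: w) = y + - ((1 - s) *: (tau *: w)) by row_ring.
  have nz : `|- ((1 - s) *: (tau *: w))| <= tau * W.
    rewrite normrN normrZ ger0_norm ?subr_ge0//; apply: le_trans tw.
    by rewrite -[leRHS]mul1r; apply: ler_wpM2r => //; rewrite gerBl.
  rewrite e3; have z8 := near8 _ (le_trans nz Wt).
  have := le_trans (ler_norm _) (HL2 j y w _ w ya8 wW z8 wW).
  have -> : w - w = 0 by exact: subrr.
  have -> : y + - ((1 - s) *: (tau *: w)) - y = - ((1 - s) *: (tau *: w)) by row_ring.
  rewrite normr0 addr0 => l1; have l2 := ler_wpM2l L20 nz.
  move: lw l1 l2; move: (lag _ _ _) (lag _ _ _) (pairing _ _) (L2 * _) (L2 * _).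
  by move; goal_lra.
move=> /(lax_oleinik_reach v); rewrite fin lee_fin => k2.
have k1 : (2 * C2 * W ^+ 2 + C1 * W ^+ 2 + 1 + L2 * W) * tau ^+ 2 <= Num.max (C1 * A ^+ 2 + 1 + L * A)
     (2 * C2 * W ^+ 2 + C1 * W ^+ 2 + 1 + L2 * W) * tau ^+ 2.
  by apply: ler_wpM2r => //; rewrite le_max lexx orbT.
rewrite (_ : (2 * C2 * W ^+ 2 + C1 * W ^+ 2 + 1 + L2 * W) * tau ^+ 2 =
    2 * (C2 * (W ^+ 2 * tau ^+ 2)) + C1 * (W ^+ 2 * tau ^+ 2) + tau ^+ 2 + tau * (L2 * (tau * W)))
  in k1; last by ring.
rewrite !(mulrDr tau) mulrN in k2; exact: first_order_upper k1 k2 sup1 sup2 sub1 sqC1 sqC2.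
Qed.

End commuting.

(** * Constancy of the commuting Hamiltonian along calibrated chains *)

Lemma le0_of_multiples {R : realType} (x B : R) : (forall m : nat, m%:R * x <= B) -> x <= 0.
Proof.
move=> H; rewrite leNgt; apply/negP => x0.
have := H 0%N; rewrite mul0r => B0.
have := H (Num.truncn (B / x)).+1; rewrite -ler_pdivlMr// leNgt.
by have /andP[_ ->] := truncn_itv (divr_ge0 B0 (ltW x0)).
Qed.

Section level_of_the_commuting_hamiltonian.
Context {R : realType} {n : nat} {M : topologicalType} (X : C2_manifold R n M).
Context (g : riemannian_metric X) (G H : cotangent_bundle X -> R) (alpha : R).
Hypothesis tG : tonelli g G.
Hypothesis tH : tonelli g H.
Hypothesis GH : poisson_commute G H.
Local Notation V := 'rV[R]_n.
Context (N : nat) (c : 'I_N -> chart R n M) (a : 'I_N -> V) (r : 'I_N -> R).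
Hypothesis hc : chart_cover X c a r.
Hypothesis cM : connected [set: M].
Local Notation inv j := (chart_inv (c j)).
Local Notation is_fixed := (is_fixed G alpha).
Variable u : M -> R.
Hypothesis fu : is_fixed u.

(** Quantifying over all charts and all quadratic constants makes the condition intrinsic to [x], so
    that it survives the changes of chart along a chain. *)
Definition level (x : M) (h : R) := forall i p (C e : R), 0 < e -> chart_dom (c i) x ->
  supergrad c u i (c i x) p C e -> in_chart H (c i) (c i x, p) = h.

(** At the origin of a transport [u] has the subgradient [q], so every supergradient there, in any
    chart, is this covector; conservation gives the value of [H] on it. *)
Lemma level_origin tau A R0 C j x y p q b : 0 < tau -> cball (a j) (8 * r j) y ->
  transport_data c a r G H j u tau A R0 C x y p q b ->
  level (inv j y) (in_chart H (c j) (x, p)).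
Proof.
move=> t0 ya td i p' C' e' e'0 yd sup.
have sub := transport_subgrad t0 td; have rj := cover_pos hc j.
have yc : chart_cod (c j) y by exact: (cover_cod hc).
have e0 : 0 < Num.min (r j / 4) (tau / 2) by rewrite lt_min !divr_gt0.
set e := Num.min _ _ in sub e0; set Cs := C * _ in sub.
have m0 : 0 < Num.min e e' by rewrite lt_min e0.
have {}sub : subgrad c u j y q (Num.max Cs C') (Num.min e e').
  by apply: subgrad_le sub; [rewrite le_max lexx|rewrite ge_min lexx].
have {}sup : supergrad c u i (c i (inv j y)) p' (Num.max Cs C') (Num.min e e').
  by apply: supergrad_le sup; [rewrite le_max lexx orbT|rewrite ge_min lexx orbT].
have ydj := chart_inv_dom yc; have acj := cover_atlas hc j; have aci := cover_atlas hc i.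
have sub' z : `|z| <= Num.min e e' ->
    u (inv j y) + pairing q z - Num.max Cs C' * `|z| ^+ 2 <= u (inv j (c j (inv j y) + z)).
  by move=> /sub; rewrite chart_invK.
have sup' z : `|z| <= Num.min e e' ->
    u (inv i (c i (inv j y) + z)) <= u (inv j y) + pairing p' z + Num.max Cs C' * `|z| ^+ 2.
  by move=> /sup; rewrite (chart_mapK yd).
rewrite (sub_super_gradient acj aci ydj yd m0 sub' sup').
apply: etrans (esym (in_chart_trans H q acj aci ydj yd)) _.
apply: etrans (congr1 (fun z => in_chart H (c j) (z, q)) (chart_invK yc)) _.
exact: esym (tr_conserved td).
Qed.

(** A link of a calibrated chain. The last clause concerns every fixed [v], with the cost [b]
    calibrated by [u]. For [z = 0] it says that [u - v] does not increase from [x] to [x']; when it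
    almost stays constant, [q] is almost a subgradient of [v] at [y]. *)
Definition backward (Rq C e : R) (x x' : M) := exists j y q b,
  [/\ x' = inv j y /\ u x = u x' + b, cball (a j) (2 * r j) y, `|q| <= Rq,
   forall h, level x h -> level x' h /\ in_chart H (c j) (y, q) = h &
   forall v z, is_fixed v -> `|z| <= e ->
     v x - b + pairing q z - C * `|z| ^+ 2 <= v (inv j (y + z))].

(** A link is a transport for [G] over a time fixed once and for all, unrelated to the small time of
    the evolution by [H]. The last clause concerns endpoints: the value of [H] on the chosen
    supergradient is the level of the origin. *)
Lemma backward_step : exists R0 C e, [/\ 0 <= R0, 0 <= C & 0 < e] /\
  (forall x, exists x', backward R0 C e x x') /\
  (forall j x, cball (a j) (r j) x -> exists p, [/\ `|p| <= R0, supergrad c u j x p C e &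
     exists x', level x' (in_chart H (c j) (x, p))]).
Proof.
have [K K0 HK] := fixed_tame alpha tG hc.
have pois j y q : cball (a j) (8 * r j) y ->
  pairing (gradx (in_chart H (c j)) (y, q)) (gradp (in_chart G (c j)) (y, q)) =
  pairing (gradp (in_chart H (c j)) (y, q)) (gradx (in_chart G (c j)) (y, q)).
  by move=> ya; apply: poisson_gradC => //; [exact: (cover_atlas hc)|exact: (cover_cod hc)].
have [A [R0 [C [tau0 [[A0 R00 C0 t00] HT]]]]] := transport_all hc tG tH K0 pois.
have [R1 [C1 [e1 [[R10 C10 e10] Hs]]]] := fixed_supergrad alpha tG hc.
have [r0 r00 rmin] := min_radius hc; have A1 : 0 < A + 1 by rewrite ltr_wpDl.
pose tau := Num.min tau0 (r0 / (A + 1)).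
have t0 : 0 < tau by rewrite lt_min t00 divr_gt0.
have : tau <= tau by []; rewrite {2}/tau le_min ler_pdivlMr// => /andP[tt tr].
have At : A * tau <= r0 by rewrite mulrC; apply: le_trans tr; apply: (ler_wpM2l (ltW t0)); rewrite lerDl.
have tu := HK u fu.
pose e := Num.min (r0 / 4) (tau / 2).
have e0 : 0 < e by rewrite lt_min !divr_gt0.
have ej j z : `|z : V| <= e -> `|z| <= Num.min (r j / 4) (tau / 2).
  rewrite !le_min => /andP[h1 ->]; rewrite andbT; apply: le_trans h1 _.
  by rewrite ler_pM2r ?invr_gt0.
have data j x : cball (a j) (r j) x -> exists y p q b,
    transport_data c a r G H j u tau A R0 C x y p q b /\ cball (a j) (2 * r j) y.
  move=> xa; have rj := cover_pos hc j.
  have xa6 : cball (a j) (6 * r j) x by apply: cball_le xa; move: rj; goal_lra.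
  have [y [p [q [b td]]]] := HT j u tau x tu t0 tt xa6; exists y, p, q, b; split => //.
  have -> : y = x + (y - x) by rewrite addrC subrK.
  have xa1 : cball (a j) (1 * r j) x by rewrite mul1r.
  have yb' : `|y - x| <= r j by rewrite distrC (le_trans (tr_dist td))// (le_trans At).
  by apply: cball_le (cover_step xa1 yb' (lexx _)); goal_lra.
have y8 j y : cball (a j) (2 * r j) y -> cball (a j) (8 * r j) y.
  by have rj := cover_pos hc j; apply: cball_le; lra.
have y6 j y : cball (a j) (2 * r j) y -> cball (a j) (6 * r j) y.
  by have rj := cover_pos hc j; apply: cball_le; lra.
have C'0 : 0 <= C * (tau^-1 + tau) by rewrite mulr_ge0// addr_ge0// ?invr_ge0 ltW.
exists (Num.max R0 R1), (C * (tau^-1 + tau)), e; split; first by split => //; rewrite le_max R00.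
split; last first.
  move=> j x xa; have [y [p [q [b [td ya]]]]] := data j x xa; exists p; split.
  - by rewrite le_max (tr_momentum td).
  - by move=> z ze; apply: (transport_supergrad hc t0 C0 fu td); exact: ej.
  - by exists (inv j y); exact: level_origin t0 (y8 _ _ ya) td.
move=> x; have [j [xd xa]] := cover_all hc x; have rj := cover_pos hc j.
have [y [p [q [b [td ya]]]]] := data j _ xa.
(* The shift by [tau * alpha] absorbs the drift of fixed functions, so that the link carries no time
   term. *)
exists (inv j y), j, y, q, (b + tau * alpha); split => //.
- split => //; have := transport_lax hc t0 td; rewrite chart_mapK// fu// => -[].
  by move: (u _) (u _) => u1 u2; move: (tau * alpha) => k; goal_lra.
- have [p1 p1R sup] := Hs u j y fu (y6 _ _ ya).
  have e2 : 0 < Num.min (r j / 4) (tau / 2) by rewrite lt_min !divr_gt0.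
  have := sub_super_same hc e2 e10 (y8 _ _ ya) (transport_subgrad t0 td) sup.
  by move=> <-; rewrite le_max p1R orbT.
- move=> h xh; have e2 : 0 < Num.min (r j / 4) (tau / 2) by rewrite lt_min !divr_gt0.
  have <- := xh j p _ _ e2 xd (transport_supergrad hc t0 C0 fu td).
  by split; [exact: level_origin t0 (y8 _ _ ya) td|rewrite (tr_conserved td)].
- move=> v z fv /(ej j) ze; apply/ler_addgt0Pr => d d0.
  have := fixed_reach fv t0 (transport_reach_origin t0 td ze d0); rewrite chart_mapK//.
  move: (v _) (v _) (pairing _ _) (C * _ * _) (tau * alpha) ; goal_lra.
Qed.

(** The [m] functions [u - v i] are monotone along the same chain, so their sum is too, and it is
    bounded. At some link the sum drops by at most [tau ^ 2], hence so does each term; this is the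
    defect tolerated by the first-order expansion, which is then summed over [i] at the origin of
    that link. *)
Lemma level_drift : exists C3 tau3, 0 < tau3 /\ forall tau (m : nat) x h, 0 < tau -> tau <= tau3 ->
  level x h -> exists y, `|iter m (laxr H tau) u y - u y + m%:R * (tau * h)| <= m%:R * (C3 * tau ^+ 2).
Proof.
have [Rq [C [e [[Rq0 C0 e0] [Hb _]]]]] := backward_step.
have [C3 [tau2 [t20 HC3]]] := lax_first_order alpha tG tH GH hc Rq0 C0 e0.
have [tau1 t10 Hp] := lax_preserves_fixed alpha tG tH GH hc.
have [D D0 HD] := fixed_osc alpha tG hc cM.
exists C3, (Num.min tau1 tau2); split; first by rewrite lt_min t10.
move=> tau m x h t0; rewrite le_min => /andP[tt1 tt2] xh.
pose v i := iter i (laxr H tau) u.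
have fv i : is_fixed (v i) by elim: i => //= i IH; have [] := Hp tau (v i) t0 tt1 IH.
have /choice[f fP] := Hb.
pose F k := iter k f x.
have lF k : level (F k) h.
  elim: k => //= k IH; have [j [y [q [b [_ _ _ lev _]]]]] := fP (F k).
  by have [] := lev h IH.
pose d i k := (u (F k) - v i (F k)) - (u (F k.+1) - v i (F k.+1)).
have d_ge0 i k : 0 <= d i k.
  have [j [y [q [b [[e1 e2] _ _ _ e3]]]]] := fP (F k).
  have z0 : `|0 : V| <= e by rewrite normr0 ltW.
  have := e3 (v i) 0 (fv i) z0; rewrite addr0 pairing0r normr0 expr0n/= mulr0 -e1.
  rewrite /d /= -/(F k) e2; move: (u _) (v i _) (v i _) ; goal_lra.
pose psi k := \sum_(i < m) (u (F k) - v i (F k)).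
have psi_drop k : psi k - psi k.+1 = \sum_(i < m) d i k.
  by rewrite /psi -sumrB.
have [k hk] : exists k : nat, psi k - psi k.+1 <= tau ^+ 2.
  apply: (@bounded_small_drop _ _ (m%:R * (D + D))); last exact: exprn_gt0.
  move=> k k'; rewrite /psi -sumrB; apply: le_trans (_ : \sum_(i < m) (D + D) <= _).
    apply: ler_sum => i _; have := HD u fu (F k) (F k'); have := HD (v i) (fv i) (F k') (F k).
    move: (u _) (u _) (v i _) (v i _) ; goal_lra.
  by rewrite sumr_const card_ord mulr_natl.
have dk i : (i < m)%N -> d i k <= tau ^+ 2.
  move=> im; apply: le_trans hk; rewrite psi_drop (bigD1 (Ordinal im))//= lerDl.
  by apply: sumr_ge0.
have [j [y [q [b [[e1 e2] ya qR lev e3]]]]] := fP (F k).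
have [_ yq] := lev h (lF k); exists (inv j y).
have step i : (i < m)%N ->
    `|v i.+1 (inv j y) - v i (inv j y) + tau * h| <= C3 * tau ^+ 2.
  move=> im; rewrite -yq.
  have sub z : `|z| <= e ->
      v i (inv j y) + pairing q z - C * `|z| ^+ 2 - tau ^+ 2 <= v i (inv j (y + z)).
    move=> ze; apply: le_trans (e3 (v i) z (fv i) ze).
    have := dk i im; rewrite /d /F iterS -/(F k) e2 e1.
    move: (u _) (v i _) (v i _) (pairing _ _) (C * _) (tau ^+ 2) ; goal_lra.
  exact: (HC3 tau (v i) j y q t0 tt2 (fv i) ya qR sub).
suff main i : (i <= m)%N ->
    `|v i (inv j y) - u (inv j y) + i%:R * (tau * h)| <= i%:R * (C3 * tau ^+ 2) by exact: main.
elim: i => [_|i IH im]; first by rewrite !mul0r addr0 subrr normr0.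
have := ler_normD (v i.+1 (inv j y) - v i (inv j y) + tau * h)
  (v i (inv j y) - u (inv j y) + i%:R * (tau * h)).
move=> /le_trans - /(_ _ (lerD (step i im) (IH (ltnW im)))).
rewrite -natr1 (mulrDl _ _ (C3 * _)) mul1r [_ + C3 * _]addrC.
congr (`|_| <= _); ring.
Qed.

(** The two drift estimates hold at different points; the oscillation of [u] and of its iterate
    compares them up to [D + D]. Letting [m] grow at fixed [tau] removes this bound, and small [tau]
    removes the error [2 * C3 * tau]. *)
Lemma level_le x h x' h' : level x h -> level x' h' -> h <= h'.
Proof.
move=> xh xh'; have [C3 [tau3 [t30 HC]]] := level_drift.
have [D D0 HD] := fixed_osc alpha tG hc cM.
have [tau1 t10 Hp] := lax_preserves_fixed alpha tG tH GH hc.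
rewrite -subr_le0; apply: (@le0_of_small _ _ (2 * C3) (Num.min tau1 tau3)); first by rewrite lt_min t10.
move=> tau t0; rewrite le_min => /andP[tt1 tt3].
rewrite -subr_le0; apply: (@le0_of_multiples _ _ ((D + D) / tau)) => m.
rewrite ler_pdivlMr//.
have [y] := HC tau m x h t0 tt3 xh; have [y'] := HC tau m x' h' t0 tt3 xh'.
have fm : is_fixed (iter m (laxr H tau) u).
  elim: m => [|m IH]; first exact: fu.
  by have [] := Hp tau _ t0 tt1 IH.
have o1 := HD _ fm y' y; have o2 := HD u fu y y'.
rewrite !ler_norml => /andP[k1 k2] /andP[k3 k4].
have -> : m%:R * (h - h' - 2 * C3 * tau) * tau =
  m%:R * (tau * h) - m%:R * (tau * h') - 2 * (m%:R * (C3 * tau ^+ 2)) by ring.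
move: o1 o2 k1 k2 k3 k4; move: (iter _ _ _ _) (iter _ _ _ _) (u _) (u _).
by move: (m%:R * (tau * h)) (m%:R * (tau * h')) (m%:R * (C3 * _)) => *; lra.
Qed.

Lemma level_eq x h x' h' : level x h -> level x' h' -> h = h'.
Proof. by move=> l1 l2; apply: le_anti; rewrite (level_le l1 l2) (level_le l2 l1). Qed.

Lemma fixed_weak_kam : weak_kam_solution H u.
Proof.
(* For empty [M], which is connected in this sense, any constant will do. *)
have [[x0 _]|M0] := pselect ([set: M] !=set0); last first.
  by exists 0 => t _ x; exfalso; apply: M0; exists x.
have [R0 [C [e [[R00 C0 e0] [_ Hs]]]]] := backward_step.
have [j0 [xd0 xa0]] := cover_all hc x0.
have [p0 [_ _ [y0 ly0]]] := Hs j0 _ xa0.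
(* The value at one arbitrary point serves everywhere, each chosen supergradient having the level of
   some origin as its value of [H]. *)
set h := in_chart H (c j0) (c j0 x0, p0) in ly0.
exists h => t t0 x.
have sd : superdiff_level H c a r h u C R0 e.
  move=> j y ya; have [p [pR sup [z lz]]] := Hs j y ya; exists p; split; [exact: pR| |exact: sup].
  exact: level_eq lz ly0.
by rewrite (lax_oleinik_of_superdiff tH hc C0 R00 e0 sd)// -EFinD subrK.
Qed.

End level_of_the_commuting_hamiltonian.

Theorem theorem0p3 (R : realType) (n : nat) (M : topologicalType)
    (X : C2_manifold R n M) (g : riemannian_metric X)
    (G H : cotangent_bundle X -> R) :
  connected [set: M] ->
  riemannian_complete g ->
  tonelli g G ->
  tonelli g H ->
  poisson_commute G H ->
  compact [set: M] ->
  forall u : M -> R, weak_kam_solution G u -> weak_kam_solution H u.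
Proof.
move=> cM _ tG tH GH kM u [alpha ua].
have [N [c [a [r hc]]]] := chart_cover_exists X kM.
apply: (fixed_weak_kam tG tH GH hc cM (alpha := alpha)) => t x t0.
by rewrite EFinB (ua t t0 x) addeK.
Qed.
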